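(* Let $n\ge 1$, let $f$ be a transcendental entire function on $\mathbb{C}^n$, and let $a,b\in\mathbb{C}$ be such that $b\neq a$ and $b\neq 0$. Suppose that (i) for every $i=1,2,\ldots,n$: $f=a\Rightarrow \partial_{z_i}(f)=a$; (ii) for every $i=1,2,\ldots,n$: $f=b\Leftrightarrow \partial_{z_i}(f)=b$. Then one of the following cases must occur: (1) $f(z)=c\,e^{z_1+z_2+\cdots+z_n}$, where $c\in\mathbb{C}$ is a non-zero constant; (2) $f(z)=a+c\,e^{\frac{b}{b-a}(z_1+z_2+\cdots+z_n)}$, where $c\in\mathbb{C}$ is a non-zero constant; (3) $f(z)=b+c\,e^{\frac{a}{a-b}(z_1+z_2+\cdots+z_n)}$, where $a\neq 0$ and $c\in\mathbb{C}$ is a non-zero constant.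
   Context: Write $z=(z_1,\ldots,z_n)\in\mathbb{C}^n$ and $\partial_{z_i}(f)=\partial f/\partial z_i$. An entire function on $\mathbb{C}^n$ is a function holomorphic on all of $\mathbb{C}^n$; it is transcendental if it is not a polynomial. For functions $f,g$ and $a\in\mathbb{C}$, the notation $f=a\Rightarrow g=a$ means that $g(z)=a$ at every point $z$ with $f(z)=a$; the notation $f=a\Leftrightarrow g=a$ means that both $f=a\Rightarrow g=a$ and $g=a\Rightarrow f=a$ hold. *)

(* Defs.v *)
From HB Require Import structures.
From mathcomp Require Import all_boot all_order all_algebra.
From mathcomp Require Import all_classical all_reals all_analysis.
From mathcomp Require Import complex.
From mathcomp Require mpoly.
Set Implicit Arguments.
Unset Strict Implicit.
Unset Printing Implicit Defensive.
Import Order.TTheory GRing.Theory Num.Theory.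
Import numFieldNormedType.Exports.
Local Open Scope ring_scope.
Local Open Scope complex_scope.

(* R[i] as a normed space over itself, for the norm `|x +i* y| = sqrt(x^2+y^2);
   'rV[R[i]]_n then gets the max norm. The scalars being complex,
   [differentiable] and 'D_v below are complex differentiability and complex
   directional derivatives. *)
HB.instance Definition _ (R : realType) := NormedModule.copy R[i] R[i]^o.

(* e^(x + iy) = e^x (cos y + i sin y) *)
Definition expC (R : realType) (z : R[i]) : R[i] :=
  (expR (complex.Re z))%:C * (cos (complex.Im z) +i* sin (complex.Im z)).

Definition entire (R : realType) (n : nat) (f : 'rV[R[i]]_n -> R[i]) : Prop :=
  forall z, differentiable f z.

Definition polynomial_function (R : realType) (n : nat)
    (f : 'rV[R[i]]_n -> R[i]) : Prop :=
  exists p : mpoly.mpoly n R[i], forall z, f z = mpoly.meval (z 0) p.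

Definition transcendental_entire (R : realType) (n : nat)
    (f : 'rV[R[i]]_n -> R[i]) : Prop :=
  entire f /\ ~ polynomial_function f.

Definition partial (R : realType) (n : nat) (i : 'I_n)
    (f : 'rV[R[i]]_n -> R[i]) (z : 'rV[R[i]]_n) : R[i] :=
  'D_('e_i) f z.

(* Main.v *)
(** On a line parallel to a coordinate axis, f restricts to an entire function g of
    one variable with g = a => g' = a and g = b <=> g' = b.  We show that g is constant,
    g' = g, or g' = b/(b-a) (g - a).  By the identity theorem the alternative depends
    only on the axis; since f takes the value b, no axis has the constant type, and two
    different types would meet at an a-point with a vanishing partial derivative.
    Case (3) never occurs: there f omits b, while its partial derivatives take it.

    In one variable, let g' be unbounded on {|g| <= 1}.  Rescaling at points where g' is
    almost maximal gives a limit G with G = a => G' = 0 and G' = 0 => G = b, because a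
    zero of G' is a limit of b-points of g'.  Hence G omits a; then G' = al (G - a), so G
    takes the value b with G' <> 0, which is impossible as b-points of G are ramified.
    By Pommerenke's argument (Harnack and Hopf for log|g|), g' = O(1 + |g|).
    It follows that phi = g'(g' - g)/((g - a)(g - b)) is a bounded entire function, so
    a constant c, and s = 2g' - g satisfies s^2 = (1+4c) g^2 - 4c(a+b) g + 4cab.  A simple
    nonzero root r of the right-hand side is omitted by g, whence g' = al (g - r); in
    the degenerate cases the equation for g factors explicitly. *)
Require Import Defs.
From mathcomp Require Import all_boot all_order all_algebra.
From mathcomp Require Import all_classical all_reals all_analysis.
From mathcomp Require Import complex.
From mathcomp Require mpoly.
From mathcomp Require Import ring lra.
Set Implicit Arguments.
Unset Strict Implicit.
Unset Printing Implicit Defensive.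
Import Order.TTheory GRing.Theory Num.Theory.
Import numFieldNormedType.Exports.
Local Open Scope ring_scope.
Local Open Scope complex_scope.

(** * The modulus and complex-valued derivatives *)

(** The delicate point is that phi is bounded: its denominator vanishes at every a-point and b-point
    of g, so the estimates must be uniform over these points. The bound g' = O(1 + |g|) provides
    this: by a Gronwall estimate, g and g' are bounded on a disc of fixed radius about any point
    where |g| <= K, with a constant that does not depend on the point. At a b-point, and at an
    a-point when a is not 0, g' has a fixed nonzero value, so such points are simple with
    neighbourhoods of uniform size, and the numerator of phi vanishes there. For a = 0 the a-points
    are multiple; phi is then read as (g'^2/g - g')/(g - b), and g'^2/g is bounded by an identity of
    its own.

    The function s completes a square: s^2 = 4 g'(g' - g) + g^2. A simple root r is omitted because
    g = r gives s = 0, hence g' = 0 by differentiation, hence s = -r, which is not 0. The last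
    degenerate equation, s^2 = b g, is refuted by a point with g' = b and g = 4b.

    Moduli are real-valued and derivatives are epsilon-delta relations, so that all estimates are
    inequalities between reals. *)

Notation nm := Normc.normc.

Section Norm.
Variable R : realType.
Implicit Types (x y z : R[i]).

Lemma nm_ge0 z : 0 <= nm z.
Proof. by case: z => a b; rewrite /= sqrtr_ge0. Qed.

Lemma nm0 : nm (0 : R[i]) = 0.
Proof. exact: Normc.normc0. Qed.

Lemma nm1 : nm (1 : R[i]) = 1.
Proof. exact: Normc.normc1. Qed.

Lemma nmM x y : nm (x * y) = nm x * nm y.
Proof. exact: Normc.normcM. Qed.

Lemma nmV x : nm x^-1 = (nm x)^-1.
Proof. exact: Normc.normcV. Qed.

Lemma nmf x y : nm (x / y) = nm x / nm y.
Proof. by rewrite nmM nmV. Qed.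

Lemma nmD x y : nm (x + y) <= nm x + nm y.
Proof. exact: le_normcD. Qed.

Lemma nmN x : nm (- x) = nm x.
Proof. exact: normcN. Qed.

Lemma nmC x y : nm (x - y) = nm (y - x).
Proof. by rewrite -nmN opprB. Qed.

Lemma nmB x y : nm (x - y) <= nm x + nm y.
Proof. by rewrite -(nmN y); exact: nmD. Qed.

Lemma nm_eq0 x : (nm x == 0) = (x == 0).
Proof.
apply/eqP/eqP => [/Normc.eq0_normc//|->]; exact: nm0.
Qed.

Lemma nm_gt0 x : (0 < nm x) = (x != 0).
Proof. by rewrite lt_neqAle nm_ge0 andbT eq_sym nm_eq0. Qed.

Lemma nm_tri x y z : nm (x - z) <= nm (x - y) + nm (y - z).
Proof. by have := nmD (x - y) (y - z); rewrite subrKA. Qed.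

Lemma nm_dist x y : `|nm x - nm y| <= nm (x - y).
Proof.
rewrite ler_norml; apply/andP; split.
  by have := nmD (y - x) x; rewrite subrK nmC; lra.
by have := nmD (x - y) y; rewrite subrK; lra.
Qed.

Lemma nm_sub x y : nm x - nm y <= nm (x - y).
Proof. by apply: le_trans (nm_dist x y); exact: ler_norm. Qed.

Lemma nm_sqr z : nm z ^+ 2 = complex.Re z ^+ 2 + complex.Im z ^+ 2.
Proof. by case: z => a b /=; rewrite sqr_sqrtr // addr_ge0 ?sqr_ge0. Qed.

Lemma nmR (t : R) : nm t%:C = `|t|.
Proof. by rewrite /= expr0n addr0 sqrtr_sqr. Qed.

Lemma nmI : nm ('i%C : R[i]) = 1.
Proof. by rewrite /= expr0n add0r expr1n sqrtr1. Qed.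

Lemma nm_n (n : nat) : nm (n%:R : R[i]) = n%:R.
Proof. by rewrite -(rmorph_nat (@real_complex R)) nmR ger0_norm. Qed.

Lemma nmX z n : nm (z ^+ n) = nm z ^+ n.
Proof. by elim: n => [|n IH]; rewrite ?expr0 ?nm1 // !exprS nmM IH. Qed.

Lemma nm_Re z : `|complex.Re z| <= nm z.
Proof.
rewrite -(ger0_norm (nm_ge0 z)) -ler_sqr ?nnegrE ?normr_ge0 //.
by rewrite !real_normK ?num_real // nm_sqr lerDl sqr_ge0.
Qed.

Lemma nm_Im z : `|complex.Im z| <= nm z.
Proof.
rewrite -(ger0_norm (nm_ge0 z)) -ler_sqr ?nnegrE ?normr_ge0 //.
by rewrite !real_normK ?num_real // nm_sqr lerDr sqr_ge0.
Qed.

Lemma nm_ReIm z : nm z <= `|complex.Re z| + `|complex.Im z|.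
Proof.
rewrite -(ler_sqr (x := nm z)) ?nnegrE ?nm_ge0 ?addr_ge0 // nm_sqr.
rewrite sqrrD !real_normK ?num_real //.
have : 0 <= `|complex.Re z| * `|complex.Im z| by rewrite mulr_ge0.
rewrite mulr2n; lra.
Qed.

Lemma nm_sum n (F : 'I_n -> R[i]) : nm (\sum_(i < n) F i) <= \sum_(i < n) nm (F i).
Proof.
elim: n F => [|n IH] F; first by rewrite !big_ord0 nm0.
by rewrite !big_ord_recr /=; apply: le_trans (nmD _ _) _; rewrite lerD2r.
Qed.

End Norm.

(** Limit passages take this form: an error [e * K] available for every positive [e] is dropped. The
    [K + 1] in the chosen [e] covers [K = 0]. *)
Lemma le_eps (R : realType) (x y K : R) : 0 <= K ->
  (forall e : R, 0 < e -> x <= y + e * K) -> x <= y.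
Proof.
move=> K0 H; rewrite leNgt; apply/negP => xy.
have e0 : 0 < (x - y) / (2 * (K + 1)) by apply: divr_gt0; lra.
have := H _ e0.
have -> : (x - y) / (2 * (K + 1)) * K = (x - y) / 2 * (K / (K + 1)).
  by field; apply/eqP; lra.
have : K / (K + 1) <= 1 by rewrite ler_pdivrMr; lra.
move=> H1; have : (x - y) / 2 * (K / (K + 1)) <= (x - y) / 2 * 1.
  by apply: ler_wpM2l => //; lra.
lra.
Qed.

(* [ddv io f x l]: f : K -> R[i] has derivative l at x, the variable being read
   through the embedding io of K in R[i]; used with K = R[i] and K = R. *)
Definition cntg (R : realType) (K : Type) (io : K -> R[i]) (f : K -> R[i]) (x : K) :=
  forall e : R, 0 < e -> exists2 d : R, 0 < d &
    forall y, nm (io y - io x) < d -> nm (f y - f x) < e.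

Definition ddv (R : realType) (K : Type) (io : K -> R[i]) (f : K -> R[i]) (x : K) (l : R[i]) :=
  forall e : R, 0 < e -> exists2 d : R, 0 < d &
    forall y, nm (io y - io x) < d ->
      nm (f y - f x - l * (io y - io x)) <= e * nm (io y - io x).

Section Deriv.
Variables (R : realType) (K : Type) (io : K -> R[i]).
Implicit Types (f g : K -> R[i]) (x y : K) (l m : R[i]).

Lemma ddv_eqd f x l l' : ddv io f x l -> l = l' -> ddv io f x l'.
Proof. by move=> ? <-. Qed.

Lemma ddv_ext f g x l : ddv io f x l -> (forall y, f y = g y) -> ddv io g x l.
Proof. by move=> H /funext <-. Qed.

Lemma ddv_loc f g x l : ddv io f x l ->
  (exists2 r : R, 0 < r & forall y, nm (io y - io x) < r -> f y = g y) -> ddv io g x l.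
Proof.
move=> H [r r0 E] e e0; have [d d0 Hd] := H e e0.
exists (Num.min d r); first by rewrite lt_min d0.
move=> y; rewrite lt_min => /andP[yd yr].
rewrite -!E ?subrr ?nm0 //; exact: Hd.
Qed.

Lemma ddv_cntg f x l : ddv io f x l -> cntg io f x.
Proof.
move=> H e e0; have [d d0 Hd] := H 1 ltr01.
have k0 : 0 < 1 + nm l + 1 by have := nm_ge0 l; lra.
exists (Num.min d (e / (1 + nm l + 1))); first by rewrite lt_min d0 divr_gt0.
move=> y; rewrite lt_min => /andP[yd]; rewrite ltr_pdivlMr // => ye.
have := Hd y yd.
have := nmD (f y - f x - l * (io y - io x)) (l * (io y - io x)).
rewrite subrK nmM; have := nm_ge0 (io y - io x); have := nm_ge0 l.
move: (nm (io y - io x)) (nm l) (nm (f y - f x)) ye => u v w; nra.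
Qed.

Lemma ddv_cst (c : R[i]) x : ddv io (fun _ => c) x 0.
Proof.
move=> e e0; exists 1 => // y _; rewrite subrr mul0r subr0 nm0.
by rewrite mulr_ge0 ?nm_ge0 ?ltW.
Qed.

Lemma ddv_io x : ddv io io x 1.
Proof.
move=> e e0; exists 1 => // y _; rewrite mul1r subrr nm0.
by rewrite mulr_ge0 ?nm_ge0 ?ltW.
Qed.

Lemma ddvD f g x l m : ddv io f x l -> ddv io g x m ->
  ddv io (fun y => f y + g y) x (l + m).
Proof.
move=> Hf Hg e e0; have e2 : 0 < e / 2 by lra.
have [d d0 Hd] := Hf _ e2; have [d' d'0 Hd'] := Hg _ e2.
exists (Num.min d d'); first by rewrite lt_min d0.
move=> y; rewrite lt_min => /andP[/Hd H1 /Hd' H2].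
have -> : f y + g y - (f x + g x) - (l + m) * (io y - io x) =
  (f y - f x - l * (io y - io x)) + (g y - g x - m * (io y - io x)) by ring.
by apply: le_trans (nmD _ _) _; lra.
Qed.

Lemma ddvM f g x l m : ddv io f x l -> ddv io g x m ->
  ddv io (fun y => f y * g y) x (l * g x + f x * m).
Proof.
move=> Hf Hg e e0.
(* The factors that multiply [e / B] in the three terms below are [nm (g y) <= nm (g x) + 1], [nm l]
   and [nm (f x)]; the last 1 makes [B] positive. *)
pose B := nm (g x) + 1 + nm (f x) + nm l + 1.
have B0 : 0 < B by rewrite /B; have := nm_ge0 (g x); have := nm_ge0 (f x); have := nm_ge0 l; lra.
have e2 : 0 < e / B by rewrite divr_gt0.
have [d d0 Hd] := Hf _ e2; have [d' d'0 Hd'] := Hg _ e2.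
have e3 : 0 < Num.min (e / B) 1 by rewrite lt_min e2 ltr01.
have [d2 d20 Hd2] := ddv_cntg Hg e3.
exists (Num.min d (Num.min d' d2)); first by rewrite !lt_min d0 d'0.
move=> y; rewrite !lt_min => /andP[/Hd H1 /andP[/Hd' H2 /Hd2]].
rewrite lt_min => /andP[H3 H4].
have -> : f y * g y - f x * g x - (l * g x + f x * m) * (io y - io x) =
  (f y - f x - l * (io y - io x)) * g y + (l * (io y - io x)) * (g y - g x)
  + f x * (g y - g x - m * (io y - io x)) by ring.
apply: le_trans (nmD _ _) _; apply: le_trans (lerD (nmD _ _) (lexx _)) _.
rewrite !nmM.
have G : nm (g y) <= nm (g x) + 1.
  by have := nmD (g y - g x) (g x); rewrite subrK; lra.
have := nm_ge0 (io y - io x); set u := nm (io y - io x) in H1 H2 *.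
have T1 : nm (f y - f x - l * (io y - io x)) * nm (g y) <= e / B * u * (nm (g x) + 1).
  by apply: ler_pM => //; apply: nm_ge0.
have T2 : nm l * u * nm (g y - g x) <= nm l * u * (e / B).
  by apply: ler_wpM2l; [rewrite mulr_ge0 ?nm_ge0|lra].
have T3 : nm (f x) * nm (g y - g x - m * (io y - io x)) <= nm (f x) * (e / B * u).
  by apply: ler_wpM2l; [exact: nm_ge0|].
move=> u0.
have -> : e * u = e / B * u * B by rewrite mulrAC divfK // gt_eqF.
rewrite /B; have : 0 <= e / B * u by rewrite mulr_ge0 // ltW.
move: (e / B) T1 T2 T3 => q T1 T2 T3 qu; nra.
Qed.

Lemma ddvZ c f x l : ddv io f x l -> ddv io (fun y => c * f y) x (c * l).
Proof.
move=> H; have := ddvM (ddv_cst c x) H; by rewrite mul0r add0r.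
Qed.

Lemma ddvN f x l : ddv io f x l -> ddv io (fun y => - f y) x (- l).
Proof.
move=> H; have := ddvZ (-1) H; rewrite mulN1r => /ddv_ext; apply=> y; exact: mulN1r.
Qed.

Lemma ddvB f g x l m : ddv io f x l -> ddv io g x m ->
  ddv io (fun y => f y - g y) x (l - m).
Proof. by move=> Hf Hg; apply: ddvD Hf (ddvN Hg). Qed.

Lemma ddvV f x l : f x != 0 -> ddv io f x l ->
  ddv io (fun y => (f y)^-1) x (- l / f x ^+ 2).
Proof.
move=> fx0 Hf e e0.
have n0 : 0 < nm (f x) by rewrite nm_gt0.
set u0 := nm (f x) in n0.
have h0 : 0 < u0 / 2 by lra.
pose B := 2 * (nm l + 1) / u0 ^+ 3 + 1 / u0 ^+ 2.
have l0 := nm_ge0 l.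
have B0 : 0 < B.
  apply: ltr_pwDl; first by rewrite divr_gt0 ?exprn_gt0 //; lra.
  by rewrite divr_ge0 ?exprn_ge0 //; lra.
(* The two summands are what the two terms of the remainder cost per unit of [e1], once
   [u0 / 2 < nm (f y)]. *)
pose e1 := e / (2 / u0 ^+ 2 * 1 + 2 * (nm l + 1) / u0 ^+ 3 * 1).
have e10 : 0 < e1.
  rewrite divr_gt0 // !mulr1 addr_gt0 // divr_gt0 ?exprn_gt0 //; lra.
have [d d0 Hd] := Hf _ e10.
have e2 : 0 < Num.min (u0 / 2) e1 by rewrite lt_min h0.
have [d2 d20 Hd2] := ddv_cntg Hf e2.
exists (Num.min d d2); first by rewrite lt_min d0.
move=> y; rewrite lt_min => /andP[/Hd H1 /Hd2].
rewrite lt_min => /andP[H3 H4].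
have fy : u0 / 2 < nm (f y).
  have := nmD (f x - f y) (f y); rewrite subrK nmC -/u0; lra.
have fy0 : f y != 0 by rewrite -nm_gt0; lra.
have -> : (f y)^-1 - (f x)^-1 - - l / f x ^+ 2 * (io y - io x) =
  - (f y - f x - l * (io y - io x)) * ((f x)^-1 * (f y)^-1) + (l * (io y - io x)) * (f y - f x) * ((f x)^-2 * (f y)^-1).
  by field; rewrite fx0 fy0.
apply: le_trans (nmD _ _) _; rewrite !nmM nmN !nmV nmX -/u0.
have iy : (nm (f y))^-1 <= 2 / u0.
  rewrite -div1r ler_pdivrMr; last by lra.
  by rewrite mulrAC ler_pdivlMr //; lra.
have iy0 : 0 <= (nm (f y))^-1 by rewrite invr_ge0 nm_ge0.
have w0 := nm_ge0 (io y - io x); set w := nm (io y - io x) in H1 w0 *.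
have T1 : nm (f y - f x - l * (io y - io x)) * (u0^-1 * (nm (f y))^-1) <= e1 * w * (u0^-1 * (2 / u0)).
  apply: ler_pM => //; first exact: nm_ge0.
    by rewrite mulr_ge0 // invr_ge0 ltW.
  by rewrite ler_wpM2l // invr_ge0 ltW.
have T2 : nm l * w * nm (f y - f x) * ((u0 ^+ 2)^-1 * (nm (f y))^-1) <= (nm l + 1) * w * e1 * ((u0 ^+ 2)^-1 * (2 / u0)).
  apply: ler_pM.
  - by rewrite !mulr_ge0 ?nm_ge0.
  - by rewrite mulr_ge0 // invr_ge0 exprn_ge0 // ltW.
  - apply: ler_pM; rewrite ?mulr_ge0 ?nm_ge0 //; last by lra.
    by apply: ler_wpM2r => //; lra.
  - by rewrite ler_wpM2l // invr_ge0 exprn_ge0 // ltW.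
apply: le_trans (lerD T1 T2) _.
have -> : e = e1 * (2 / u0 ^+ 2 * 1 + 2 * (nm l + 1) / u0 ^+ 3 * 1).
  rewrite divfK // gt_eqF // !mulr1 addr_gt0 // divr_gt0 ?exprn_gt0 //; lra.
by rewrite le_eqVlt; apply/orP; left; apply/eqP; field; rewrite gt_eqF.
Qed.

Lemma ddvf f g x l m : g x != 0 -> ddv io f x l -> ddv io g x m ->
  ddv io (fun y => f y / g y) x ((l * g x - f x * m) / g x ^+ 2).
Proof.
move=> g0 Hf Hg; apply: ddv_eqd (ddvM Hf (ddvV g0 Hg)) _.
by field.
Qed.

Lemma ddvX f x l n : ddv io f x l -> ddv io (fun y => f y ^+ n) x (n%:R * f x ^+ n.-1 * l).
Proof.
move=> H; elim: n => [|n IH].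
  by apply: ddv_eqd (ddv_cst 1 x) _; rewrite !mul0r.
apply: ddv_eqd (ddv_ext (ddvM H IH) _) _; first by move=> y; rewrite exprS.
case: n {IH} => [|n] /=; first by ring.
rewrite -[in RHS]natr1 exprS; ring.
Qed.

End Deriv.

(** The inner function may be a curve with a real parameter, so one chain rule serves holomorphic
    compositions and paths. *)
Lemma ddv_comp (R : realType) K (io : K -> R[i]) (f : R[i] -> R[i]) (g : K -> R[i]) x l m :
  ddv id f (g x) l -> ddv io g x m -> ddv io (fun y => f (g y)) x (l * m).
Proof.
move=> Hf Hg e e0.
have l0 := nm_ge0 l; have m0 := nm_ge0 m.
have e1 : 0 < e / (nm m + 1 + 1) by rewrite divr_gt0 //; lra.
have [d d0 Hd] := Hf _ e1.
have e2 : 0 < Num.min 1 (e / (nm m + 1 + 1) / (nm l + 1)).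
  by rewrite lt_min ltr01 divr_gt0 //; lra.
have [d2 d20 Hd2] := Hg _ e2.
have [d3 d30 Hd3] := ddv_cntg Hg d0.
exists (Num.min d2 d3); first by rewrite lt_min d20.
move=> y; rewrite lt_min => /andP[/Hd2 H2 /Hd3 /Hd H1].
have -> : f (g y) - f (g x) - l * m * (io y - io x) =
 (f (g y) - f (g x) - l * (g y - g x)) + l * (g y - g x - m * (io y - io x)) by ring.
apply: le_trans (nmD _ _) _; rewrite nmM.
have w0 := nm_ge0 (io y - io x); move: H1 H2 => /= H1 H2; set w := nm (io y - io x) in H2 w0 *.
set q := Num.min _ _ in e2 H2.
have q1 : q <= 1 by rewrite ge_min lexx.
have q2 : q * (nm l + 1) <= e / (nm m + 1 + 1).
  by rewrite -ler_pdivlMr ?ge_min ?lexx ?orbT //; lra.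
have G : nm (g y - g x) <= (nm m + 1) * w.
  have := nmD (g y - g x - m * (io y - io x)) (m * (io y - io x)).
  by rewrite subrK nmM -/w; nra.
have -> : e * w = e / (nm m + 1 + 1) * ((nm m + 1) * w) + e / (nm m + 1 + 1) * w.
  by field; apply/eqP; lra.
apply: lerD; first by apply: le_trans H1 _; rewrite ler_wpM2l // ltW.
apply: le_trans (ler_wpM2l l0 H2) _.
have : q * (nm l + 1) * w <= e / (nm m + 1 + 1) * w by exact: ler_wpM2r.
nra.
Qed.

Notation cdv := (ddv id).
Notation cdr := (ddv (real_complex _)).

Section Unique.
Variable R : realType.

Lemma ddv_unique K (io : K -> R[i]) f x l m :
  (forall d : R, 0 < d -> exists2 y, io y != io x & nm (io y - io x) < d) ->
  ddv io f x l -> ddv io f x m -> l = m.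
Proof.
move=> acc Hf Hg; apply/eqP; rewrite -subr_eq0 -nm_eq0 eq_le nm_ge0 andbT.
apply: (@le_eps _ _ _ 2) => // e e0.
have [d d0 Hd] := Hf _ e0; have [d' d'0 Hd'] := Hg _ e0.
have [|y yx] := acc (Num.min d d'); first by rewrite lt_min d0.
rewrite lt_min => /andP[/Hd H1 /Hd' H2].
have w0 : 0 < nm (io y - io x) by rewrite nm_gt0 subr_eq0.
rewrite -(ler_pM2r w0) -nmM.
have -> : (l - m) * (io y - io x) = - (f y - f x - l * (io y - io x)) + (f y - f x - m * (io y - io x)) by ring.
apply: le_trans (nmD _ _) _; rewrite nmN; lra.
Qed.

Lemma cdv_unique (f : R[i] -> R[i]) x l m : cdv f x l -> cdv f x m -> l = m.
Proof.
apply: ddv_unique => d d0; exists (x + (d / 2)%:C) => /=.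
  by rewrite -subr_eq0 addrAC subrr add0r -nm_eq0 nmR normr_eq0; apply/eqP; lra.
by rewrite addrAC subrr add0r nmR ger0_norm; lra.
Qed.

End Unique.

(** * Compactness, the mean value inequality and Goursat's lemma *)

Section ClusterSequence.
Local Open Scope classical_set_scope.

(** Tychonoff's theorem replaces a diagonal argument: [c] is a cluster point of the sequence [u k]
    in a product of segments, and a basic neighbourhood controls finitely many coordinates. *)
Lemma cluster_seq (R : realType) (u : nat -> nat -> R) (B : R) :
  (forall k n, `|u k n| <= B) ->
  exists c : nat -> R, forall (N k0 : nat) (e : R), 0 < e ->
    exists2 k, (k0 <= k)%N & forall n, (n < N)%N -> `|u k n - c n| < e.
Proof.
move=> uB.
have Kc : @compact (prod_topology (fun _ : nat => R)) [set f | forall n, `[- B, B]%classic (f n)].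
  by apply: (@tychonoff nat (fun _ => R) (fun _ => `[- B, B]%classic)) => n; exact: segment_compact.
have [c [_ cl]] : [set f | forall n, `[- B, B]%classic (f n)] `&`
    @cluster (prod_topology (fun _ : nat => R)) (u @ \oo) !=set0.
  have FF : ProperFilter (u @ \oo) by exact: fmap_proper_filter.
  apply: (Kc _ FF); exists 0%N => // k _ n /=; rewrite in_itv /= -ler_norml.
  exact: uB.
exists c => N k0 e e0.
pose PT : topologicalType := prod_topology (fun _ : nat => R).
have Fc : Filter (@nbhs PT PT c) by exact: (@nbhs_filter PT).
have nb : @nbhs PT PT c [set f | forall n, (n < N)%N -> `|f n - c n| < e].
  elim: N => [|N IH].
    by apply: (@filterS _ _ Fc setT); [move=> f _|exact: (@filterT _ _ Fc)].
  have P : @nbhs PT PT c [set f | `|f N - c N| < e].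
    have /= := @proj_continuous _ (fun _ : nat => R) N c.
    move=> /(_ [set x | `|x - c N| < e]); apply.
    apply/nbhs_ballP; exists e => //= x; rewrite /ball /= distrC //.
  apply: (@filterS _ _ Fc _ _ _ (@filterI _ _ Fc _ _ IH P)) => f [H1 H2] n.
  by rewrite ltnS leq_eqVlt => /orP[/eqP ->//|]; exact: H1.
have [f [[k /= k0k <-] H]] := cl [set u k | k in [set k | (k0 <= k)%N]] _
  (ex_intro2 _ _ k0 I (fun k H => ex_intro2 _ _ k H erefl)) nb.
by exists k.
Qed.

End ClusterSequence.

Lemma exp2_small (R : realType) (w d : R) : 0 < d -> exists N, forall n, (N <= n)%N -> w / 2 ^+ n < d.
Proof.
move=> d0; have [w0|w0] := leP w 0.
  exists 0%N => n _; apply: le_lt_trans d0.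
  by rewrite pmulr_lle0 // invr_gt0 exprn_gt0.
pose N := Num.bound (w / d).
exists N => n Nn; rewrite ltr_pdivrMr ?exprn_gt0 // mulrC -ltr_pdivrMr //.
have H := archi_boundP (ltW (divr_gt0 w0 d0)); apply: lt_le_trans H _.
apply: le_trans (_ : n%:R <= _); first by rewrite ler_nat.
by rewrite -natrX ler_nat ltnW // ltn_expl.
Qed.

Section Cousin.
Variable R : realType.
Variable P : R -> R -> R -> R -> Prop.
Variables a b a' b' : R.
Hypotheses (ab : a <= b) (ab' : a' <= b').
Hypothesis split : forall s s' t t', s <= s' -> t <= t' ->
  P s ((s + s') / 2) t ((t + t') / 2) -> P s ((s + s') / 2) ((t + t') / 2) t' ->
  P ((s + s') / 2) s' t ((t + t') / 2) -> P ((s + s') / 2) s' ((t + t') / 2) t' ->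
  P s s' t t'.
Hypothesis local : forall c c', a <= c <= b -> a' <= c' <= b' ->
  exists2 d : R, 0 < d & forall s s' t t', a <= s -> s <= c -> c <= s' -> s' <= b ->
    a' <= t -> t <= c' -> c' <= t' -> t' <= b' -> s' - s < d -> t' - t < d -> P s s' t t'.

(* Nested rectangles as in Goursat's proof. *)
Lemma cousin : P a b a' b'.
Proof.
apply: contrapT => nP.
pose w := b - a; pose w' := b' - a'.
pose Q n (p : R * R) := P p.1 (p.1 + w / 2 ^+ n) p.2 (p.2 + w' / 2 ^+ n).
have w0 : 0 <= w by rewrite subr_ge0.
have w'0 : 0 <= w' by rewrite subr_ge0.
have h0 n (v : R) : 0 <= v -> 0 <= v / 2 ^+ n by move=> ?; rewrite divr_ge0 // exprn_ge0.
have hS n (v : R) : v / 2 ^+ n = v / 2 ^+ n.+1 + v / 2 ^+ n.+1.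
  by rewrite exprS; field; rewrite expf_neq0.
(* The implication makes the statement hold for every rectangle, so that [choice] gives a function;
   if [P] fails on a rectangle, it fails on one of the four quarters. *)
have step (np : nat * (R * R)) : exists p : R * R, (~ Q np.1 np.2 -> ~ Q np.1.+1 p) /\
   (np.2.1 <= p.1 <= np.2.1 + w / 2 ^+ np.1.+1) /\ (np.2.2 <= p.2 <= np.2.2 + w' / 2 ^+ np.1.+1).
  case: np => n [s t] /=; apply: contrapT => H; set u := w / _ in H; set v := w' / _ in H.
  have u0 : 0 <= u by exact: h0. have v0 : 0 <= v by exact: h0.
  have X i j : (i = 0 \/ i = u) -> (j = 0 \/ j = v) -> Q n.+1 (s + i, t + j).
    move=> Hi Hj; apply: contrapT => nQ; apply: H; exists (s + i, t + j); split => //=.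
    by split; apply/andP; split; case: Hi; case: Hj; lra.
  have nQ : ~ Q n (s, t).
    by move=> HQ; apply: H; exists (s, t); split => //=; lra.
  apply: nQ; rewrite /Q /=; have E1 := hS n w; have E2 := hS n w'.
  rewrite -/u in E1; rewrite -/v in E2; rewrite E1 E2.
  have M1 : (s + (s + (u + u))) / 2 = s + u by lra.
  have M2 : (t + (t + (v + v))) / 2 = t + v by lra.
  apply: split; rewrite ?M1 ?M2; try lra.
  - by have := X 0 0 (or_introl erefl) (or_introl erefl); rewrite /Q /= -/u -/v !addr0.
  - by have := X 0 v (or_introl erefl) (or_intror erefl); rewrite /Q /= -/u -/v !addr0 -addrA.
  - by have := X u 0 (or_intror erefl) (or_introl erefl); rewrite /Q /= -/u -/v !addr0 -addrA.
  - by have := X u v (or_intror erefl) (or_intror erefl); rewrite /Q /= -/u -/v -!addrA.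
have [f Hf] := choice step.
pose q := fix q n := if n is m.+1 then f (m, q m) else (a, a').
have nQ n : ~ Q n (q n).
  elim: n => [|n IH] /=; last by have [/(_ IH)] := Hf (n, q n).
  by rewrite /Q /= expr0 !divr1 /w /w' !(addrC _ (_ - _)) !subrK.
have st n : (q n).1 <= (q n.+1).1 <= (q n).1 + w / 2 ^+ n.+1 /\ (q n).2 <= (q n.+1).2 <= (q n).2 + w' / 2 ^+ n.+1.
  by have [_] := Hf (n, q n).
have mon n k : (q n).1 <= (q (n + k)%N).1 <= (q n).1 + (w / 2 ^+ n - w / 2 ^+ (n + k)) /\
   (q n).2 <= (q (n + k)%N).2 <= (q n).2 + (w' / 2 ^+ n - w' / 2 ^+ (n + k)).
  elim: k => [|k [/andP[I1 I2] /andP[I3 I4]]]; first by rewrite addn0; lra.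
  rewrite addnS; have [/andP[J1 J2] /andP[J3 J4]] := st (n + k)%N.
  have := hS (n + k)%N w; have := hS (n + k)%N w'; lra.
have in0 n : a <= (q n).1 /\ (q n).1 + w / 2 ^+ n <= b /\ a' <= (q n).2 /\ (q n).2 + w' / 2 ^+ n <= b'.
  have [] := mon 0%N n; rewrite add0n expr0 !divr1 -[(q 0%N).1]/a -[(q 0%N).2]/a'.
  have Ew : w = b - a by []. have Ew' : w' = b' - a' by [].
  move: (w / _) (w' / _) => x x' /andP[? ?] /andP[? ?]; do !split; lra.
(* Both corner coordinates are packed into one sequence, at index 0 and at index 1. *)
pose u k n := if n is 0%N then (q k).1 else (q k).2.
have [|c Hc] := @cluster_seq R u (`|a| + `|b| + `|a'| + `|b'|).
  move=> k n; have [i1 [i2 [i3 i4]]] := in0 k; have := h0 k _ w0; have := h0 k _ w'0.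
  have e1 : u k n = (q k).1 \/ u k n = (q k).2 by rewrite /u; case: n; [left|right].
  move: (ler_norm a) (ler_norm (-a)) (ler_norm b) (normr_ge0 a') (normr_ge0 b') (normr_ge0 b).
  move: (ler_norm a') (ler_norm (-a')) (ler_norm b') (normr_ge0 a).
  rewrite ler_norml !normrN; case: e1 => ->; lra.
have cin n : (q n).1 <= c 0%N <= (q n).1 + w / 2 ^+ n /\ (q n).2 <= c 1%N <= (q n).2 + w' / 2 ^+ n.
  have X e : 0 < e -> exists k, `|(q (n + k)%N).1 - c 0%N| < e /\ `|(q (n + k)%N).2 - c 1%N| < e.
    move=> e0; have [k nk Hk] := Hc 2%N n e e0.
    by exists (k - n)%N; rewrite subnKC //; split; [exact: (Hk 0%N)|exact: (Hk 1%N)].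
  split; apply/andP; split; apply: (@le_eps _ _ _ 1) => // e /X [k [X1 X2]];
    have [/andP[I1 I2] /andP[I3 I4]] := mon n k;
    have := h0 (n + k)%N _ w0; have := h0 (n + k)%N _ w'0;
    move: X1 X2; rewrite !ltr_norml => /andP[? ?] /andP[? ?]; lra.
have [d d0 Hd] : exists2 d : R, 0 < d & forall s s' t t', a <= s -> s <= c 0%N -> c 0%N <= s' -> s' <= b ->
    a' <= t -> t <= c 1%N -> c 1%N <= t' -> t' <= b' -> s' - s < d -> t' - t < d -> P s s' t t'.
  by apply: local; have := cin 0%N; rewrite /= expr0 !divr1 /w /w'; lra.
have [N HN] := exp2_small w d0; have [N' HN'] := exp2_small w' d0.
pose n := maxn N N'.
have W := HN n (leq_maxl _ _); have W' := HN' n (leq_maxr _ _).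
apply: (nQ n); have [/andP[? ?] /andP[? ?]] := cin n; have [? [? [? ?]]] := in0 n.
by apply: Hd => //; lra.
Qed.

End Cousin.

(** Cousin's lemma with the second side reduced to the point 0: an interval around c that is short
    enough satisfies the bound with slope [k + e], by splitting its increment at c, and the bound is
    additive. *)
Lemma mvt (R : realType) (F dF : R -> R[i]) (a b k : R) : a <= b ->
  (forall t, a <= t <= b -> cdr F t (dF t)) -> (forall t, a <= t <= b -> nm (dF t) <= k) ->
  nm (F b - F a) <= k * (b - a).
Proof.
move=> ab HF Hk; apply: (@le_eps _ _ _ (b - a)); first by lra.
move=> e e0; rewrite -mulrDl.
have := @cousin R (fun s s' _ _ => nm (F s' - F s) <= (k + e) * (s' - s)) a b 0 0 ab (lexx _).
apply.
  move=> s s' _ _ ss' _ H1 _ H2 _; apply: le_trans (nm_tri _ (F ((s + s') / 2)) _) _.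
  by apply: le_trans (lerD H2 H1) _; rewrite -mulrDr; lra.
move=> c c' cab _; have [d d0 Hd] := HF c cab _ e0.
exists d => // s s' _ _ as_ sc cs' s'b _ _ _ _ ss' _.
have X y : nm (y%:C - c%:C) = `|y - c| by rewrite -rmorphB nmR.
have [H1 H2] : nm ((s'%:C : R[i]) - c%:C) < d /\ nm ((s%:C : R[i]) - c%:C) < d.
  by rewrite !X !ltr_norml; lra.
have Y y : `|y - c| < d -> nm (F y - F c) <= (k + e) * `|y - c|.
  rewrite -X => /Hd; have := nmD (F y - F c - dF c * (y%:C - c%:C)) (dF c * (y%:C - c%:C)).
  rewrite subrK nmM X; have := Hk c cab; have := normr_ge0 (y - c); nra.
apply: le_trans (nm_tri _ (F c) _) _; rewrite [X in _ + X]nmC.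
rewrite X in H1; rewrite X in H2; apply: le_trans (lerD (Y _ H1) (Y _ H2)) _.
by rewrite -mulrDr ger0_norm ?ler0_norm; lra.
Qed.

Lemma cdr_const (R : realType) (F : R -> R[i]) (a b : R) : a <= b ->
  (forall t, a <= t <= b -> cdr F t 0) -> F b = F a.
Proof.
move=> ab HF; have := @mvt R F (fun _ => 0) a b 0 ab HF.
rewrite nm0 mul0r => /(_ (fun _ _ => lexx _)) H.
by apply/eqP; rewrite -subr_eq0 -nm_eq0 eq_le H nm_ge0.
Qed.

Section Goursat.
Variable R : realType.
Variables (A B FA FB : R -> R -> R[i]) (a b a' b' : R).
Hypotheses (ab : a <= b) (ab' : a' <= b').
Hypothesis HFA : forall s t, a <= s <= b -> a' <= t <= b' -> cdr (FA ^~ t) s (A s t).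
Hypothesis HFB : forall s t, a <= s <= b -> a' <= t <= b' -> cdr (FB s) t (B s t).
Hypothesis closed : forall s t, a <= s <= b -> a' <= t <= b' ->
  exists P A0 B0 : R -> R -> R[i],
   [/\ forall x y, a <= x <= b -> a' <= y <= b' -> cdr (P ^~ y) x (A0 x y),
       forall x y, a <= x <= b -> a' <= y <= b' -> cdr (P x) y (B0 x y) &
       forall e : R, 0 < e -> exists2 d : R, 0 < d & forall x y, a <= x <= b -> a' <= y <= b' ->
         `|x - s| < d -> `|y - t| < d ->
         nm (A x y - A0 x y) <= e * (`|x - s| + `|y - t|) /\
         nm (B x y - B0 x y) <= e * (`|x - s| + `|y - t|)].

(** This is the integral of the form A ds + B dt around the rectangle, written with partial
    primitives. By [closed] the form is tangent to an exact form dP at each point, so that over a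
    small rectangle the integral is at most e times twice the squared half-perimeter; this bound is
    exactly additive under quartering. *)
Lemma goursat_form : FA b a' - FA a a' + (FB b b' - FB b a') - (FA b b' - FA a b') - (FB a b' - FB a a') = 0.
Proof.
pose E s s' t t' := FA s' t - FA s t + (FB s' t' - FB s' t) - (FA s' t' - FA s t') - (FB s t' - FB s t).
suff : nm (E a b a' b') = 0 by move/eqP; rewrite nm_eq0 => /eqP.
apply/eqP; rewrite eq_le nm_ge0 andbT.
apply: (@le_eps _ _ _ (2 * (b - a + (b' - a')) ^+ 2)).
  by rewrite mulr_ge0 // exprn_ge0 // addr_ge0 // subr_ge0.
move=> e e0; rewrite add0r.
have := @cousin R (fun s s' t t' => nm (E s s' t t') <= e * (2 * (s' - s + (t' - t)) ^+ 2)) a b a' b' ab ab'.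
apply.
  move=> s s' t t' ss' tt'; set m := (s + s') / 2; set n := (t + t') / 2.
  move=> H1 H2 H3 H4.
  have -> : E s s' t t' = E s m t n + E s m n t' + (E m s' t n + E m s' n t') by rewrite /E; ring.
  apply: le_trans (nmD _ _) _; apply: le_trans (lerD (nmD _ _) (nmD _ _)) _.
  apply: le_trans (lerD (lerD H1 H2) (lerD H3 H4)) _.
  by rewrite /m /n le_eqVlt; apply/orP; left; apply/eqP; field.
move=> c c' cab cab'; have [P [A0 [B0 [HA0 HB0 /(_ e e0) [d d0 Hd]]]]] := closed cab cab'.
exists d => // s s' t t' as_ sc cs' s'b at_ tc' ct' t'b sd td.
set K := e * (s' - s + (t' - t)).
have K1 x y : s <= x <= s' -> t <= y <= t' -> e * (`|x - c| + `|y - c'|) <= K.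
  move=> xs yt; rewrite ler_pM2l //; apply: lerD; rewrite ler_norml; lra.
have dd x y : s <= x <= s' -> t <= y <= t' -> `|x - c| < d /\ `|y - c'| < d.
  by move=> xs yt; rewrite !ltr_norml; lra.
have TA y : t <= y <= t' -> nm (FA s' y - P s' y - (FA s y - P s y)) <= K * (s' - s).
  move=> yt; apply: (@mvt R (fun x => FA x y - P x y) (fun x => A x y - A0 x y)); first by lra.
    by move=> x xs; apply: ddvB; [apply: HFA|apply: HA0]; lra.
  move=> x xs; have [X1 X2] := dd x y xs yt.
  have xab : a <= x <= b by lra.
  have yab : a' <= y <= b' by lra.
  by have [/le_trans H _] := Hd x y xab yab X1 X2; apply: H; exact: K1.
have TB x : s <= x <= s' -> nm (FB x t' - P x t' - (FB x t - P x t)) <= K * (t' - t).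
  move=> xs; apply: (@mvt R (fun y => FB x y - P x y) (fun y => B x y - B0 x y)); first by lra.
    by move=> y yt; apply: ddvB; [apply: HFB|apply: HB0]; lra.
  move=> y yt; have [X1 X2] := dd x y xs yt.
  have xab : a <= x <= b by lra.
  have yab : a' <= y <= b' by lra.
  by have [_ /le_trans H] := Hd x y xab yab X1 X2; apply: H; exact: K1.
have -> : E s s' t t' = (FA s' t - P s' t - (FA s t - P s t)) - (FA s' t' - P s' t' - (FA s t' - P s t'))
  + ((FB s' t' - P s' t' - (FB s' t - P s' t)) - (FB s t' - P s t' - (FB s t - P s t))) by rewrite /E; ring.
apply: le_trans (nmD _ _) _; apply: le_trans (lerD (nmB _ _) (nmB _ _)) _.
have tt1 : t <= t <= t' by lra. have tt2 : t <= t' <= t' by lra.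
have ss1 : s <= s <= s' by lra. have ss2 : s <= s' <= s' by lra.
apply: le_trans (lerD (lerD (TA t tt1) (TA t' tt2)) (lerD (TB s' ss2) (TB s ss1))) _.
by rewrite /K le_eqVlt; apply/orP; left; apply/eqP; ring.
Qed.

End Goursat.

(** * Cauchy's formula and power series *)

Section RealPrimitives.
Local Open Scope classical_set_scope.

Lemma is_derive_eps (R : realType) (F : R -> R) (x l : R) : is_derive x 1 F l ->
  forall e : R, 0 < e -> exists2 d : R, 0 < d & forall y : R, `|y - x| < d -> `|F y - F x - l * (y - x)| <= e * `|y - x|.
Proof.
move=> [dF <-] e e0.
have /cvgrPdist_le/(_ e e0) : h^-1 *: (F (h *: 1 + x) - F x) @[h --> 0^'] --> 'D_1 F x by exact: dF.
move=> /nbhs_ballP[d /= d0 Hd]; exists d => // y yx.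
have [->|yx0] := eqVneq y x; first by rewrite !subrr mulr0 subr0 normr0 mulr0.
have := Hd (y - x); rewrite /ball /= sub0r normrN subr_eq0 => /(_ yx yx0).
rewrite /GRing.scale /= mulr1 subrK => H.
have yx1 : y - x != 0 by rewrite subr_eq0.
have -> : F y - F x - 'D_1 F x * (y - x) = - ('D_1 F x - (y - x)^-1 * (F y - F x)) * (y - x).
  by field.
by rewrite normrM normrN ler_wpM2r.
Qed.

Lemma cdr_ReIm (R : realType) (u v : R -> R) (x du dv : R) :
  is_derive x 1 u du -> is_derive x 1 v dv -> cdr (fun t => u t +i* v t) x (du +i* dv).
Proof.
move=> Hu Hv e e0; have e2 : 0 < e / 2 by lra.
have [d d0 Hd] := is_derive_eps Hu e2; have [d' d'0 Hd'] := is_derive_eps Hv e2.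
exists (Num.min d d'); first by rewrite lt_min d0.
move=> y; rewrite -rmorphB nmR lt_min => /andP[/Hd H1 /Hd' H2].
apply: le_trans (nm_ReIm _) _; rewrite /= !mulr0 subr0 add0r.
by lra.
Qed.

Lemma cntg_Re (R : realType) (u : R -> R[i]) (x : R) : cntg (real_complex R) u x ->
  {for x, continuous (fun t => complex.Re (u t))} /\ {for x, continuous (fun t => complex.Im (u t))}.
Proof.
move=> H; split; apply/cvgrPdist_lt => e e0; have [d d0 Hd] := H e e0;
  apply/nbhs_ballP; exists d => //= y; rewrite /ball /= distrC => yx;
  rewrite distrC; apply: le_lt_trans (Hd y _); rewrite -?rmorphB ?nmR //.
  by have := nm_Re (u y - u x); case: (u y) (u x) => ? ? [].
by have := nm_Im (u y - u x); case: (u y) (u x) => ? ? [].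
Qed.

Lemma primitive_real (R : realType) (B : R) (u : R -> R) : continuous u ->
  exists F : R -> R, forall x : R, `|x| < B -> is_derive x 1 F (u x).
Proof.
move=> cu; exists (fun x => (\int[lebesgue_measure]_(t in `[- B, x]) u t)%R) => x.
rewrite ltr_norml => /andP[x1 x2].
have [|d1 d2] := @continuous_FTC1_closed R u (- B) x B x2 _ x1 (cu x).
  apply: continuous_compact_integrable; first exact: segment_compact.
  exact: continuous_subspaceT.
by split; [exact: d1|rewrite -derive1E; exact: d2].
Qed.

Lemma primitive_exists (R : realType) (B : R) (u : R -> R[i]) :
  (forall x, cntg (real_complex R) u x) ->
  exists F : R -> R[i], forall x, `|x| < B -> cdr F x (u x).
Proof.
move=> cu.
have [F HF] := @primitive_real R B (fun t => complex.Re (u t)) (fun x => (cntg_Re (cu x)).1).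
have [G HG] := @primitive_real R B (fun t => complex.Im (u t)) (fun x => (cntg_Re (cu x)).2).
exists (fun t => F t +i* G t) => x xB.
by have := cdr_ReIm (HF x xB) (HG x xB); case: (u x).
Qed.

End RealPrimitives.

(** The induction proves n q^n (1 - q) <= 1 - q^n: each of the n terms of 1 + q + ... + q^(n-1) is
    at least q^n. It yields both the decay of q^n and the cost of a factor n on power series
    coefficients. *)
Lemma mul_geo_le (R : realType) (q : R) (n : nat) : 0 <= q < 1 -> n%:R * q ^+ n <= (1 - q)^-1.
Proof.
move=> /andP[q0 q1]; have p0 : 0 < 1 - q by lra.
rewrite -(ler_pM2r p0) mulVf ?gt_eqF //.
suff : n%:R * q ^+ n * (1 - q) <= 1 - q ^+ n by have := exprn_ge0 n q0; lra.
elim: n => [|n IH]; first by rewrite !mul0r expr0 subrr.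
have H := exprn_ge0 n q0; have H1 : q ^+ n <= 1 by rewrite exprn_ile1 // ltW.
rewrite -natr1 exprS; move: (q ^+ n) (n%:R) IH H H1 => x m IH H H1.
have : q * (m * x * (1 - q)) <= q * (1 - x) by rewrite ler_wpM2l.
have : 0 <= (1 - q) * (1 - q * x) by apply: mulr_ge0; nra.
nra.
Qed.

Lemma geo_small (R : realType) (q K e : R) : 0 <= q < 1 -> 0 <= K -> 0 < e ->
  exists n0, forall n, (n0 <= n)%N -> K * q ^+ n < e.
Proof.
move=> q01 K0 e0; have /andP[q0 q1] := q01; have p0 : 0 < 1 - q by lra.
pose n0 := Num.bound (K / (1 - q) / e).
exists n0.+1 => n n0n.
have n1 : (0 : R) < n%:R by rewrite ltr0n; case: n n0n.
have H : K / (1 - q) / e < n%:R.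
  apply: lt_le_trans (archi_boundP _) _; first by rewrite !divr_ge0 // ltW.
  by rewrite ler_nat ltnW.
rewrite -(ltr_pM2l n1) mulrCA mulrC; apply: le_lt_trans (_ : K / (1 - q) < _).
  by rewrite mulrC ler_wpM2l // mul_geo_le.
by rewrite -ltr_pdivrMr.
Qed.

(** On |z| < rho, f is the sum of the power series with coefficients c. Infinite sums are avoided:
    one constant M carries Cauchy's estimates and the geometric tail bound that they imply. *)
Definition psrep (R : realType) (c : nat -> R[i]) (rho M : R) (f : R[i] -> R[i]) :=
  (forall n, nm (c n) * rho ^+ n <= M) /\
  forall z, nm z < rho -> forall N,
    nm (f z - \sum_(i < N) c i * z ^+ i) <= M * (nm z / rho) ^+ N / (1 - nm z / rho).

Section Circle.
Variable R : realType.
Let T : R := pi *+ 2.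

Definition eit (t : R) : R[i] := cos t +i* sin t.

Lemma nm_eit t : nm (eit t) = 1.
Proof. by rewrite /= cos2Dsin2 sqrtr1. Qed.

Lemma eit_neq0 t : eit t != 0.
Proof. by rewrite -nm_eq0 nm_eit oner_eq0. Qed.

Lemma eitT : eit T = eit 0.
Proof. by rewrite /eit cos2pi sin2pi cos0 sin0. Qed.

Lemma cdr_eit t : cdr eit t ('i%C * eit t).
Proof.
apply: ddv_eqd (cdr_ReIm (is_derive_cos t) (is_derive_sin t)) _.
by rewrite /eit; apply/eqP; rewrite eq_complex /= !mul0r !mul1r sub0r add0r !eqxx.
Qed.

Lemma cdr_exp (t : R) : cdr (fun s => (expR s)%:C) t (expR t)%:C.
Proof.
have := cdr_ReIm (is_derive_expR t) (is_derive_cst (0 : R) t 1).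
by apply.
Qed.

Lemma twopi_gt0 : 0 < T.
Proof. by rewrite /T pmulrn_lgt0 // pi_gt0. Qed.

(** The integral over a period as a relation: v is the increment of some primitive. Linearity and
    bounds then come from the rules for derivatives and the mean value inequality. *)
Definition isint (u : R -> R[i]) (v : R[i]) :=
  exists2 F : R -> R[i], forall t, 0 <= t <= T -> cdr F t (u t) & F T - F 0 = v.

Lemma isint_bound u v K : isint u v -> (forall t, nm (u t) <= K) -> nm v <= K * T.
Proof.
move=> [F HF <-] HK; rewrite -[X in _ * X]subr0.
by apply: (mvt (ltW twopi_gt0) HF) => t _.
Qed.

Lemma isint_uniq u v v' : isint u v -> isint u v' -> v = v'.
Proof.
move=> [F HF <-] [G HG <-].
have H : forall t, 0 <= t <= T -> cdr (fun s => F s - G s) t 0.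
  by move=> t tT; apply: ddv_eqd (ddvB (HF t tT) (HG t tT)) _; rewrite subrr.
have /= E := cdr_const (ltW twopi_gt0) H.
have -> : F T = G T + (F 0 - G 0) by rewrite -E; ring.
ring.
Qed.

Lemma isintD u u' v v' : isint u v -> isint u' v' -> isint (fun t => u t + u' t) (v + v').
Proof.
move=> [F HF <-] [G HG <-]; exists (fun t => F t + G t); last by ring.
by move=> t tT; apply: ddvD; [exact: HF|exact: HG].
Qed.

Lemma isintZ k u v : isint u v -> isint (fun t => k * u t) (k * v).
Proof.
move=> [F HF <-]; exists (fun t => k * F t); last by ring.
by move=> t tT; apply: ddvZ; exact: HF.
Qed.

Lemma isint_sum n (u : nat -> R -> R[i]) (v : nat -> R[i]) : (forall k, (k < n)%N -> isint (u k) (v k)) ->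
  isint (fun t => \sum_(k < n) u k t) (\sum_(k < n) v k).
Proof.
elim: n => [|n IH] H.
  exists (fun _ => 0); last by rewrite big_ord0 subrr.
  by move=> t _; apply: ddv_ext (ddv_eqd (ddv_cst _ 0 t) _) _ => //; rewrite big_ord0.
rewrite big_ord_recr /=.
have -> : (fun t => \sum_(k < n.+1) u k t) = (fun t => \sum_(k < n) u k t + u n t).
  by apply/funext => t; rewrite big_ord_recr.
by apply: isintD; [apply: IH => k kn; apply: H; rewrite ltnS ltnW|exact: H].
Qed.

Lemma isint_exists u : (forall t, cntg (real_complex R) u t) -> exists v, isint u v.
Proof.
move=> cu; have [F HF] := primitive_exists (T + 1) cu.
exists (F T - F 0), F => // t tT; apply: HF.
by rewrite ger0_norm; lra.
Qed.

(* The circular moments [int w^-n] vanish because w^-n has a periodic primitive. *)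
Lemma isint_pow (rho : R) n : 0 < rho ->
  isint (fun t => (rho%:C * eit t) ^- n) (if n is 0%N then T%:C else 0).
Proof.
move=> r0; case: n => [|n].
  exists (fun t => t%:C); last by rewrite subr0.
  by move=> t _; rewrite expr0 invr1; exact: ddv_io.
have r1 : rho%:C != 0 by rewrite -nm_eq0 nmR normr_eq0 gt_eqF.
have i0 : 'i%C != 0 :> R[i] by rewrite -nm_eq0 nmI oner_eq0.
have n0 : (n.+1%:R : R[i]) != 0 by rewrite pnatr_eq0.
exists (fun t => (rho%:C * eit t) ^- n.+1 / (- 'i%C * n.+1%:R)); last by rewrite eitT subrr.
move=> t _; have e0 := eit_neq0 t.
have w0 : (rho%:C * eit t) ^+ n.+1 != 0 by rewrite expf_neq0 // mulf_neq0.
have H := @ddvV R R _ (fun y => (rho%:C * eit y) ^+ n.+1) t _ w0 (ddvX n.+1 (ddvZ rho%:C (cdr_eit t))).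
apply: ddv_eqd (ddv_ext (ddvZ (- 'i%C * n.+1%:R)^-1 H) _) _; first by move=> y; rewrite mulrC.
rewrite -[n.+1.-1]/n expr2 !exprS; move: (eit t) e0 {w0 H} => x e0.
have n0' : 1 + n%:R != 0 :> R[i] by rewrite addrC natr1.
have xn : (rho%:C * x) ^+ n != 0 by rewrite expf_neq0 // mulf_neq0.
move: ((rho%:C * x) ^+ n) xn => y y0; field.
by rewrite y0 e0 r1 i0 ?n0 ?n0'.
Qed.
End Circle.

Section ClusterPoint.
Variable R : realType.

Lemma cluster_pt (z : nat -> R[i]) (B : R) : (forall k, nm (z k) <= B) ->
  exists2 w, nm w <= B & forall k0 (e : R), 0 < e -> exists2 k, (k0 <= k)%N & nm (z k - w) < e.
Proof.
move=> zB; pose u k n := if n is 0%N then complex.Re (z k) else complex.Im (z k).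
have [|c Hc] := @cluster_seq R u B.
  move=> k n; apply: le_trans (zB k); rewrite /u; case: n => [|n]; [exact: nm_Re|exact: nm_Im].
have H k0 e : 0 < e -> exists2 k, (k0 <= k)%N & nm (z k - (c 0%N +i* c 1%N)) < e.
  move=> e0; have e2 : 0 < e / 2 by lra.
  have [k k0k Hk] := Hc 2%N k0 _ e2; exists k => //.
  apply: le_lt_trans (nm_ReIm _) _; have := Hk 0%N isT; have := Hk 1%N isT.
  by rewrite /u; case: (z k) => x y /=; lra.
exists (c 0%N +i* c 1%N) => //.
apply: (@le_eps _ _ _ 1) => // e e0; have [k _ Hk] := H 0%N e e0.
have := zB k; have := nm_tri (c 0%N +i* c 1%N) (z k) 0; rewrite !subr0 (nmC _ (z k)); lra.
Qed.

Lemma bounded_disc (f df : R[i] -> R[i]) (r rho : R) : rho < r ->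
  (forall z, nm z < r -> cdv f z (df z)) -> exists2 B, 0 <= B & forall z, nm z <= rho -> nm (f z) <= B.
Proof.
move=> rr Hf; apply: contrapT => H.
have H1 (k : nat) : exists z, nm z <= rho /\ k%:R < nm (f z).
  apply: contrapT => H2; apply: H; exists k%:R => // z zr; rewrite leNgt.
  by apply/negP => H3; apply: H2; exists z.
have [z Hz] := choice H1.
have [w wr Hw] := @cluster_pt z rho (fun k => (Hz k).1).
have [d d0 Hd] := ddv_cntg (Hf w (le_lt_trans wr rr)) ltr01.
have [k kk kw] := Hw (Num.bound (nm (f w) + 1)) d d0.
have := Hd _ kw; have := (Hz k).2; have := nm_sub (f (z k)) (f w).
have : nm (f w) + 1 < k%:R.
  apply: lt_le_trans (archi_boundP _) _; first by have := nm_ge0 (f w); lra.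
  by rewrite ler_nat.
lra.
Qed.

End ClusterPoint.

Section Cauchy.
Variable R : realType.
Let T : R := pi *+ 2.
Variables (f df : R[i] -> R[i]) (r rho : R).
Hypotheses (rho0 : 0 < rho) (rhor : rho < r).
Hypothesis Hf : forall z, nm z < r -> cdv f z (df z).

Let w (t : R) : R[i] := rho%:C * eit t.

Lemma nm_circle t : nm (w t) = rho.
Proof. by rewrite nmM nmR nm_eit mulr1 gtr0_norm. Qed.

Lemma cdr_circle t : cdr w t ('i%C * w t).
Proof. apply: ddv_eqd (ddvZ rho%:C (cdr_eit t)) _; rewrite /w; ring. Qed.

Lemma circle_neq0 t : w t != 0.
Proof. by rewrite -nm_gt0 nm_circle. Qed.

Section Point.
Variable z : R[i].
Hypothesis zr : nm z < rho.

Let m (t : R) : R[i] := 'i%C * w t / (w t - z).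
(** Homotheties of centre z in logarithmic scale: s = 0 gives the circle, and s tending to minus
    infinity contracts it to z. The form dζ/(ζ - z) pulls back to ds + [m t] dt, whose coefficients
    do not depend on s. *)
Let Psi (s t : R) : R[i] := z + (expR s)%:C * (w t - z).

Lemma circle_sub_neq0 t : w t - z != 0.
Proof.
rewrite -nm_gt0; have := nm_sub (w t) z; rewrite nm_circle.
by apply: lt_le_trans; rewrite subr_gt0.
Qed.

Lemma circle_sub_ge t : rho - nm z <= nm (w t - z).
Proof. by have := nm_sub (w t) z; rewrite nm_circle. Qed.

Lemma nm_kernel t : nm (m t) <= rho / (rho - nm z).
Proof.
rewrite nmf nmM nmI mul1r nm_circle; apply: ler_wpM2l; first exact: ltW.
rewrite lef_pV2 ?posrE ?circle_sub_ge ?subr_gt0 //.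
by apply: lt_le_trans (circle_sub_ge t); rewrite subr_gt0.
Qed.

Lemma cdr_Psi_s s t : cdr (Psi ^~ t) s ((expR s)%:C * (w t - z)).
Proof.
have := ddvD (ddv_cst (real_complex R) z s) (ddvM (cdr_exp s) (ddv_cst _ (w t - z) s)).
by move=> H; apply: ddv_eqd H _; ring.
Qed.

Lemma cdr_Psi_t s t : cdr (Psi s) t ((expR s)%:C * ('i%C * w t)).
Proof.
have := ddvD (ddv_cst (real_complex R) z t) (ddvZ (expR s)%:C (ddvB (cdr_circle t) (ddv_cst _ z t))).
by move=> H; apply: ddv_eqd H _; ring.
Qed.

Lemma kernel_derivable t : exists l, cdr m t l.
Proof.
eexists; apply: (@ddvf R R _ (fun t => 'i%C * w t) (fun t => w t - z) t _ _ (circle_sub_neq0 t)); first by apply: ddvZ; exact: cdr_circle.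
by apply: ddvB; [exact: cdr_circle|exact: ddv_cst].
Qed.

Lemma Psi_in s t : s <= 0 -> nm (Psi s t) <= rho.
Proof.
move=> s0; rewrite /Psi.
have -> : z + (expR s)%:C * (w t - z) = (1 - expR s)%:C * z + (expR s)%:C * w t.
  by rewrite rmorphB rmorph1; ring.
have e0 := expR_ge0 s; have e1 : expR s <= 1 by rewrite -expR0 ler_expR.
apply: le_trans (nmD _ _) _.
rewrite (nmM _ z) (nmM _ (w t)) nm_circle !nmR !ger0_norm ?subr_ge0 //.
move: (expR s) e0 e1 => e e0 e1.
have : 0 <= (1 - e) * (rho - nm z) by apply: mulr_ge0; rewrite subr_ge0 // ltW.
lra.
Qed.

Lemma Psi_r s t : s <= 0 -> nm (Psi s t) < r.
Proof. by move=> /Psi_in H; apply: le_lt_trans (H t) rhor. Qed.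

Lemma Psi0 t : Psi 0 t = w t.
Proof. by rewrite /Psi expR0 rmorph1; ring. Qed.

(** [primitive_exists] asks for continuity on the whole line, whereas [Psi s t] is known to stay in
    the disc of holomorphy only for s <= 0; clamping s at 0 bridges the two. *)
Lemma cdr_min (u : R -> R[i]) s : (forall x, x <= 0 -> cntg (real_complex R) u x) ->
  cntg (real_complex R) (fun x => u (Num.min x 0)) s.
Proof.
move=> H e e0; have m0 : Num.min s 0 <= 0 by rewrite ge_min lexx orbT.
have [d d0 Hd] := H _ m0 e e0; exists d => // y yd; apply: Hd.
move: yd; rewrite -!rmorphB !nmR; apply: le_lt_trans.
rewrite /Num.min; have := ler_norm (y - s); have := ler_norm (- (y - s)); rewrite normrN.
have := normr_ge0 (y - s).
by case: ltP => ?; case: ltP => ? ? ? ?; rewrite ler_norml; lra.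
Qed.

Lemma Psi_lip x y s t : x <= 0 -> s <= 0 ->
  nm (Psi x y - Psi s t) <= 2 * rho * (`|x - s| + `|y - t|).
Proof.
move=> x0 s0; have zr' : nm z < rho := zr. have rho0' : 0 < rho := rho0.
have E0 a : a <= 0 -> expR a <= 1 by rewrite -expR0 ler_expR.
apply: le_trans (nm_tri _ (Psi s y) _) _; rewrite mulrDr; apply: lerD.
  have wz : nm (w y - z) <= 2 * rho by apply: le_trans (nmB _ _) _; rewrite nm_circle; lra.
  have Q a b : a <= b -> b <= 0 -> nm (Psi b y - Psi a y) <= 2 * rho * (b - a).
    move=> ab b0; apply: (mvt ab (fun x0 _ => cdr_Psi_s x0 y)) => c /andP[_ cb].
    rewrite nmM nmR ger0_norm ?expR_ge0 // -[leRHS]mul1r.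
    apply: ler_pM; [exact: expR_ge0|exact: nm_ge0| |exact: wz].
    by apply: E0; apply: le_trans b0.
  have [sx|/ltW xs] := leP s x.
    by rewrite (@ger0_norm _ (x - s)) ?subr_ge0 //; exact: Q.
  by rewrite nmC (@ler0_norm _ (x - s)) ?subr_le0 // opprB; exact: Q.
have Q a b : a <= b -> nm (Psi s b - Psi s a) <= 2 * rho * (b - a).
  move=> ab; apply: (mvt ab (fun x0 _ => cdr_Psi_t s x0)) => c _.
  rewrite nmM (nmM 'i%C) nmI mul1r nm_circle nmR ger0_norm ?expR_ge0 // -[leRHS]mul1r.
  by apply: ler_pM; [exact: expR_ge0|exact: ltW|exact: E0|lra].
have [ty|/ltW yt] := leP t y.
  by rewrite (@ger0_norm _ (y - t)) ?subr_ge0 //; exact: Q.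
by rewrite nmC (@ler0_norm _ (y - t)) ?subr_le0 // opprB; exact: Q.
Qed.

(** Replacing f by its tangent affine function at [Psi s t] changes both coefficients of the form by
    a small multiple of the distance; [L] is the Lipschitz constant of [Psi] and [K] bounds the
    kernel. *)
Lemma form_closed s t (s1 b1 c1 : R) (e : R) : s <= 0 ->
  0 < e -> exists2 d : R, 0 < d & forall x y, s1 <= x <= 0 -> b1 <= y <= c1 ->
   `|x - s| < d -> `|y - t| < d ->
   nm (f (Psi x y) - (f (Psi s t) - df (Psi s t) * (Psi s t - z) + df (Psi s t) * (Psi x y - z)))
      <= e * (`|x - s| + `|y - t|) /\
   nm (f (Psi x y) * m y - (f (Psi s t) - df (Psi s t) * (Psi s t - z) + df (Psi s t) * (Psi x y - z)) * m y)
      <= e * (`|x - s| + `|y - t|).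
Proof.
have zr' : nm z < rho := zr. have rho0' : 0 < rho := rho0.
move=> s0 e0; pose K := rho / (rho - nm z); pose L := 2 * rho.
have K0 : 0 <= K by rewrite divr_ge0 ?subr_ge0 // ltW.
have L0 : 0 <= L by rewrite mulr_ge0 // ltW.
have [e2 e20 E2] : exists2 e2 : R, 0 < e2 & e2 * L * (K + 1) <= e.
  exists (e / ((K + 1) * (L + 1))).
    by apply: divr_gt0 => //; apply: mulr_gt0; exact: ltr_pwDr.
  move: (K) (L) K0 L0 => k l k0 l0.
  have -> : e / ((k + 1) * (l + 1)) * l * (k + 1) = e * (l / (l + 1)).
    by field; apply/andP; split; lra.
  by rewrite -[leRHS]mulr1 ler_pM2l // ler_pdivrMr; lra.
have [d1 d10 Hd1] := Hf (Psi_r t s0) e20.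
have [d d0 Hd] : exists2 d : R, 0 < d & forall D, 0 <= D < d + d -> L * D < d1.
  exists (d1 / (2 * (L + 1))); first by apply: divr_gt0 => //; apply: mulr_gt0 => //; exact: ltr_pwDr.
  move: (L) L0 => l l0 D /andP[D0 D1].
  have : D < d1 / (l + 1) by apply: lt_le_trans D1 _; rewrite le_eqVlt; apply/orP; left; apply/eqP; field; lra.
  by rewrite ltr_pdivlMr; lra.
exists d => // x y /andP[_ x0] _ xs yt.
have := Psi_lip y t x0 s0; rewrite -/L.
have : 0 <= `|x - s| + `|y - t| by rewrite addr_ge0.
have : `|x - s| + `|y - t| < d + d by exact: ltrD.
move: (_ + _) => D Dd D0 HL.
have := Hd1 (Psi x y) (le_lt_trans HL (Hd D _)); rewrite D0 Dd => /(_ isT) /=.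
set F0 := f _ - _ - _; set F := f _ - (_ + _).
have -> : F0 = F by rewrite /F0 /F; ring.
move=> H3; rewrite -mulrBl nmM.
have {}H3 : nm F <= e2 * (L * D) by apply: le_trans H3 _; rewrite ler_pM2l.
have H4 : e2 * L * (K + 1) * D <= e * D by rewrite ler_wpM2r.
have H5 : nm F * nm (m y) <= e2 * (L * D) * K.
  by apply: ler_pM; rewrite ?nm_ge0 ?nm_kernel.
have P0 : 0 <= e2 * (L * D) by rewrite !mulr_ge0 // ltW.
have P1 : 0 <= e2 * (L * D) * K by rewrite mulr_ge0.
move: (nm F) (nm F * _) H3 H4 H5 P0 P1 => u v; move: (L) (K) => l k ? ? ? ? ?; split; lra.
Qed.

(** On the rectangle [s1, 0] x [0, 2π] the sides t = 0 and t = 2π cancel by periodicity, so v is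
    also the integral over the contracted curve s = s1, where f is close to f z. The value of v' is
    left open here. *)
Lemma cauchy_core v v' : isint (fun t => f (w t) * m t) v -> isint m v' -> v = f z * v'.
Proof.
have zr' : nm z < rho := zr. have rho0' : 0 < rho := rho0. have rhor' : rho < r := rhor.
move=> iv iv'; apply/eqP; rewrite -subr_eq0 -nm_eq0 eq_le nm_ge0 andbT.
pose K := rho / (rho - nm z).
have K0 : 0 <= K by apply: divr_ge0; lra.
have T0 : 0 < T := twopi_gt0 R.
apply: (@le_eps _ _ _ (K * T)); first by rewrite mulr_ge0 // ltW.
move=> e e0; rewrite add0r mulrA.
have [d d0 Hd] := ddv_cntg (Hf (lt_trans zr rhor)) e0.
(* choose s1 with e^{s1} * 2 rho < d *)
pose q := Num.min 1 (d / (2 * rho + 1)).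
have q0 : 0 < q by rewrite lt_min ltr01 divr_gt0 //; lra.
have q1 : q <= 1 by rewrite ge_min lexx.
have qd : q * (2 * rho) < d.
  have : q <= d / (2 * rho + 1) by rewrite ge_min lexx orbT.
  rewrite ler_pdivlMr; last by lra.
  by move: q q0 {q1} => q q0; lra.
pose s1 := ln q.
have s10 : s1 <= 0 by rewrite -ln1 ler_ln ?posrE.
have es1 : expR s1 = q by rewrite lnK ?posrE.
have PC s t : s <= 0 -> cdr (fun x => f (Psi x t)) s (df (Psi s t) * ((expR s)%:C * (w t - z))).
  by move=> s0; apply: ddv_comp (cdr_Psi_s s t); apply: Hf; exact: Psi_r.
have cA t s : cntg (real_complex R) (fun x => f (Psi (Num.min x 0) t)) s.
  by apply: (cdr_min (u := fun x => f (Psi x t))) => x x0; exact: ddv_cntg (PC x t x0).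
have cB s t : s <= 0 -> cntg (real_complex R) (fun y => f (Psi s y) * m y) t.
  move=> s0; have [l Hl] := kernel_derivable t.
  by apply: ddv_cntg (ddvM (ddv_comp (Hf (Psi_r t s0)) (cdr_Psi_t s t)) Hl).
pose B := T + `|s1| + 1.
(* A total operator [P] sending functions to primitives, with an arbitrary value on discontinuous
   functions. Since [Psi] takes the same values at t = 0 and t = T, the primitives chosen for these
   two sides are equal, and not merely equal up to a constant. *)
have prim (u : R -> R[i]) : exists F : R -> R[i],
    (forall x, cntg (real_complex R) u x) -> forall x, `|x| < B -> cdr F x (u x).
  have [H|H] := pselect (forall x, cntg (real_complex R) u x); last by exists u.
  by have [F HF] := primitive_exists B H; exists F.
have [P HP] := choice prim.
pose FA s t := P (fun x => f (Psi (Num.min x 0) t)) s.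
pose FB s t := P (fun y => f (Psi s y) * m y) t.
have inB x : s1 <= x <= 0 -> `|x| < B.
  by move=> xs; rewrite ler0_norm /B ?ler0_norm; lra.
have inT x : 0 <= x <= T -> `|x| < B.
  by move=> xs; rewrite ger0_norm /B; have := normr_ge0 s1; lra.
have HFA s t : s1 <= s <= 0 -> 0 <= t <= T -> cdr (FA ^~ t) s (f (Psi s t)).
  move=> ss tt; have := HP _ (cA t) s (inB s ss).
  by have -> : Num.min s 0 = s by apply: min_idPl; lra.
have HFB s t : s1 <= s <= 0 -> 0 <= t <= T -> cdr (FB s) t (f (Psi s t) * m t).
  by move=> ss tt; apply: (HP (fun y => f (Psi s y) * m y) _ t (inT t tt)) => x; apply: cB; lra.
have cm t : cntg (real_complex R) m t by have [l Hl] := kernel_derivable t; exact: ddv_cntg Hl.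
have HL t : 0 <= t <= T -> cdr (P m) t (m t) by move=> tt; exact: (HP m cm t (inT t tt)).
have := @goursat_form R (fun s t => f (Psi s t)) (fun s t => f (Psi s t) * m t) FA FB s1 0 0 T s10 (ltW T0) HFA HFB.
have H : FA 0 T = FA 0 0 /\ FA s1 T = FA s1 0.
  by split; rewrite /FA; congr (P _ _); apply/funext => x; rewrite /Psi /w eitT.
case: H => H1 H2; rewrite H1 H2 => G.
have {}G : FB 0 T - FB 0 0 = FB s1 T - FB s1 0.
  apply/eqP; rewrite -subr_eq0; apply/eqP; rewrite -[RHS]G; first by ring.
  move=> s t ss tt; pose p0 := Psi s t.
  (* The tangent function is c0 + c1 (ζ - z). Divided by ζ - z it has the primitive c0 log(ζ - z) +
     c1 ζ, and in these coordinates the logarithm is s + [P m t]. *)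
  pose c1 := df p0; pose c0 := f p0 - c1 * (p0 - z).
  exists (fun x y => c0 * (x%:C + P m y) + c1 * Psi x y), (fun x y => c0 + c1 * (Psi x y - z)),
    (fun x y => (c0 + c1 * (Psi x y - z)) * m y); split.
  - move=> x y xx yy.
    have := ddvD (ddvZ c0 (ddvD (ddv_io (real_complex R) x) (ddv_cst _ (P m y) x))) (ddvZ c1 (cdr_Psi_s x y)).
    by move=> H; apply: ddv_eqd H _; rewrite /Psi; ring.
  - move=> x y xx yy.
    have := ddvD (ddvZ c0 (ddvD (ddv_cst (real_complex R) x%:C y) (HL y yy))) (ddvZ c1 (cdr_Psi_t x y)).
    by move=> H; apply: ddv_eqd H _; rewrite /Psi /m; field; exact: circle_sub_neq0.
  - move=> e' e'0; have s0 : s <= 0 by case/andP: ss.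
    have [d1 d10 Hd1] := @form_closed s t s1 0 T e' s0 e'0.
    by exists d1 => // x y xx yy xs yt; exact: Hd1.
have E1 : v = FB s1 T - FB s1 0.
  rewrite -G; apply: isint_uniq iv _; exists (FB 0) => // t tt.
  by have := HFB 0 t; rewrite Psi0; apply => //; rewrite s10 lexx.
have i1 : isint (fun t => (f (Psi s1 t) - f z) * m t) (v - f z * v').
  have i2 : isint (fun t => f (Psi s1 t) * m t) v.
    by exists (FB s1) => // t tt; apply: HFB => //; rewrite s10 lexx.
  have := isintD i2 (isintZ (- f z) iv'); rewrite mulNr.
  have -> : (fun t => f (Psi s1 t) * m t + - f z * m t) = (fun t => (f (Psi s1 t) - f z) * m t).
    by apply/funext => t; ring.
  by [].
apply: (isint_bound i1) => t; rewrite nmM; apply: ler_pM; rewrite ?nm_ge0 ?nm_kernel //.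
apply/ltW/Hd => /=; rewrite /Psi es1 [z + _]addrC addrK nmM nmR ger0_norm; last exact: ltW.
apply: le_lt_trans qd; rewrite ler_pM2l //.
by apply: le_trans (nmB _ _) _; rewrite nm_circle; lra.
Qed.

End Point.
End Cauchy.

(** The kernel w/(w - z) is expanded as a finite geometric sum with explicit remainder; the
    coefficients are the moments of f on the circle. The same expansion applied to the constant 1
    evaluates the integral of the kernel. *)
Lemma cauchy_series (R : realType) (f df : R[i] -> R[i]) (r rho B : R) : 0 < rho -> rho < r ->
  (forall z, nm z < r -> cdv f z (df z)) -> (forall z, nm z = rho -> nm (f z) <= B) ->
  exists c, psrep c rho B f.
Proof.
move=> rho0 rhor Hf HB; pose T : R := pi *+ 2; have T0 : 0 < T := twopi_gt0 R.
pose w (t : R) : R[i] := rho%:C * eit t.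
have nw t : nm (w t) = rho := nm_circle rho0 t.
have w0 t : w t != 0 := circle_neq0 rho0 t.
have cdw t : cdr w t ('i%C * w t) := cdr_circle rho t.
have T1 : T%:C != 0 :> R[i] by rewrite -nm_eq0 nmR normr_eq0 gt_eqF.
have B0 : 0 <= B by apply: le_trans (HB (w 0) (nw 0)); exact: nm_ge0.
have cint n : exists v, isint (fun t => f (w t) * w t ^- n) v.
  apply: isint_exists => t; apply: ddv_cntg.
  apply: (@ddvM R R _ (fun t => f (w t)) (fun t => w t ^- n)).
    by apply: ddv_comp (cdw t); apply: Hf; rewrite nw.
  by apply: (@ddvV R R _ (fun t => w t ^+ n)); [exact: expf_neq0|apply: ddvX (cdw t)].
have [v Hv] := choice cint.
pose c n := v n / T%:C.
have nT : nm (T%:C : R[i]) = T by rewrite nmR gtr0_norm.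
exists c; split.
  move=> n; rewrite nmf nT.
  have : nm (v n) <= B * (rho ^+ n)^-1 * T.
    apply: isint_bound (Hv n) _ => t; rewrite nmM nmV nmX nw.
    by rewrite ler_wpM2r ?invr_ge0 ?exprn_ge0 ?(ltW rho0) // HB.
  rewrite -ler_pdivrMr // => H; rewrite -ler_pdivlMr ?exprn_gt0 //.
move=> z zr N.
have i0 : 'i%C != 0 :> R[i] by rewrite -nm_eq0 nmI oner_eq0.
have wz t : w t - z != 0 := circle_sub_neq0 rho0 zr t.
have zr0 : 0 < rho - nm z by rewrite subr_gt0.
have cwz t : exists l, cdr (fun t => w t / (w t - z)) t l.
  eexists; apply: (@ddvf R R _ w (fun t => w t - z) t _ _ (wz t) (cdw t)).
  exact: ddvB (cdw t) (ddv_cst _ z t).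
have [v0 Hv0] : exists v, isint (fun t => f (w t) * (w t / (w t - z))) v.
  apply: isint_exists => t; have [l Hl] := cwz t; apply: ddv_cntg.
  apply: (@ddvM R R _ (fun t => f (w t)) _ _ _ _ _ Hl).
  by apply: ddv_comp (cdw t); apply: Hf; rewrite nw.
have [v1 Hv1] : exists v, isint (fun t => w t / (w t - z)) v.
  by apply: isint_exists => t; have [l Hl] := cwz t; exact: ddv_cntg Hl.
have core : v0 = f z * v1.
  have := @cauchy_core R f df r rho rho0 rhor Hf z zr ('i%C * v0) ('i%C * v1).
  have e1 : (fun t => f (w t) * ('i%C * w t / (w t - z))) = (fun t => 'i%C * (f (w t) * (w t / (w t - z)))).
    by apply/funext => t; ring.
  have e2 : (fun t => 'i%C * w t / (w t - z)) = (fun t => 'i%C * (w t / (w t - z))).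
    by apply/funext => t; ring.
  rewrite /= -/w e1 e2 => /(_ (isintZ 'i%C Hv0) (isintZ 'i%C Hv1)) H.
  by apply: (mulfI i0); rewrite H; ring.
have geo (u : R[i]) k : u != 0 -> u - z != 0 ->
    u / (u - z) = \sum_(i < k) z ^+ i * u ^- i + (z / u) ^+ k * (u / (u - z)).
  move=> u0 uz; elim: k => [|k IH]; first by rewrite big_ord0 expr0 add0r mul1r.
  rewrite big_ord_recr /= -addrA {1}IH; congr (_ + _).
  rewrite exprS expr_div_n; move: (z ^+ k) (u ^+ k) (expf_neq0 k u0) => a b b0.
  by field; rewrite u0 uz b0.
pose q := nm z / rho.
have q01 : 0 <= q < 1 by rewrite divr_ge0 ?nm_ge0 ?(ltW rho0) //= ltr_pdivrMr // mul1r.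
have /andP[q0 q1] := q01; have p0 : 0 < 1 - q by rewrite subr_gt0.
have wzb t : nm (w t / (w t - z)) <= (1 - q)^-1.
  rewrite nmf nw; have H := circle_sub_ge rho0 z t.
  rewrite ler_pdivrMr; last by apply: lt_le_trans H.
  rewrite -ler_pdivrMl ?invr_gt0 // invrK; apply: le_trans H.
  rewrite mulrBl mul1r /q mulrVK // unitfE gt_eqF //.
(* Used twice: with g = 1, where only the moment of index 0 survives and [v1] comes out as 2π, and
   with g = f on the circle. *)
have rem (g : R -> R[i]) K (s : R[i]) (a : nat -> R[i]) k :
    (forall t, nm (g t) <= K) -> isint (fun t => g t * (w t / (w t - z))) s ->
    (forall n, (n < k)%N -> isint (fun t => g t * w t ^- n) (a n)) ->
    nm (s - \sum_(i < k) a i * z ^+ i) <= K * q ^+ k / (1 - q) * T.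
  move=> gK Hs Ha; have K0 : 0 <= K by apply: le_trans (gK 0); exact: nm_ge0.
  have H1 := isintD Hs (isintZ (-1) (isint_sum (fun n nk => isintZ (z ^+ n) (Ha n nk)))).
  have -> : s - \sum_(i < k) a i * z ^+ i = s + -1 * \sum_(k < k) z ^+ k * a k.
    by rewrite mulN1r; congr (_ - _); apply: eq_bigr => i _; rewrite mulrC.
  apply: isint_bound H1 _ => t.
  rewrite [in X in nm (X + _)](geo (w t) k) // mulrDr mulr_sumr mulN1r.
  have -> : \sum_(i < k) g t * (z ^+ i * w t ^- i) = \sum_(k < k) z ^+ k * (g t * w t ^- k).
    by apply: eq_bigr => i _; ring.
  rewrite addrAC subrr add0r nmM nmM nmX (nmf z) nw -/q -mulrA.
  apply: ler_pM; [exact: nm_ge0|apply: mulr_ge0; [exact: exprn_ge0|exact: nm_ge0]|exact: gK|].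
  by apply: ler_wpM2l (wzb t); rewrite exprn_ge0.
have v1T : v1 = T%:C.
  apply/eqP; rewrite -subr_eq0 -nm_eq0 eq_le nm_ge0 andbT.
  apply: (@le_eps _ _ _ 1) => // e e0; rewrite add0r mulr1.
  have [n0 Hn0] := @geo_small R q (T / (1 - q)) e q01 (divr_ge0 (ltW T0) (ltW p0)) e0.
  have := rem (fun _ => 1) 1 v1 (fun n => if n is 0%N then T%:C else 0) n0.+1.
  have -> : (fun t => 1 * (w t / (w t - z))) = (fun t => w t / (w t - z)) by apply/funext => t; rewrite mul1r.
  move=> /(_ _ Hv1 _); rewrite nm1 => /(_ (fun _ => lexx _)).
  rewrite big_ord_recl /= expr0 mulr1 big1 ?addr0; last by move=> i _; rewrite mul0r.
  move=> H; apply: le_trans (H _) _.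
    move=> n _; have := isint_pow n rho0.
    by have -> : (fun t => 1 * w t ^- n) = (fun t => w t ^- n) by apply/funext => t; rewrite mul1r.
  by apply: ltW; apply: le_lt_trans (Hn0 n0.+1 (leqnSn _)); rewrite le_eqVlt; apply/orP; left; apply/eqP; ring.
have fB t : nm (f (w t)) <= B by exact: HB.
have := rem (fun t => f (w t)) B v0 v N fB Hv0 (fun n _ => Hv n).
rewrite core v1T -/q => H; rewrite -(ler_pM2r T0); apply: le_trans H.
rewrite le_eqVlt; apply/orP; left; apply/eqP.
rewrite -[X in _ * X = _]nT -nmM; congr nm.
rewrite mulrBl; congr (_ - _); rewrite mulr_suml; apply: eq_bigr => i _.
by rewrite /c mulrAC divfK.
Qed.

Lemma cauchy_series_ex (R : realType) (f df : R[i] -> R[i]) (r rho : R) : 0 < rho -> rho < r ->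
  (forall z, nm z < r -> cdv f z (df z)) -> exists c B, psrep c rho B f.
Proof.
move=> rho0 rhor Hf; have [B B0 HB] := bounded_disc rhor Hf.
have [|c Hc] := @cauchy_series R f df r rho B rho0 rhor Hf; last by exists c, B.
by move=> z zr; apply: HB; rewrite zr.
Qed.

(** * Sums of power series, uniqueness of coefficients, Taylor remainders of powers *)

Section Series.
Variable R : realType.
Implicit Types (c : nat -> R[i]) (f g : R[i] -> R[i]).

Definition psbound c (rho M : R) := forall n, nm (c n) * rho ^+ n <= M.

Lemma psbound_ge0 c rho M : psbound c rho M -> 0 <= M.
Proof. by move=> H; apply: le_trans (H 0%N); rewrite expr0 mulr1 nm_ge0. Qed.

Lemma ratio01 (z : R[i]) (rho : R) : 0 < rho -> nm z < rho -> 0 <= nm z / rho < 1.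
Proof. by move=> r0 zr; rewrite divr_ge0 ?nm_ge0 ?(ltW r0) //= ltr_pdivrMr // mul1r. Qed.

Lemma ps_term c rho M z n : 0 < rho -> psbound c rho M -> nm (c n * z ^+ n) <= M * (nm z / rho) ^+ n.
Proof.
move=> r0 H; rewrite nmM nmX expr_div_n mulrA ler_pdivlMr ?exprn_gt0 //.
by rewrite mulrAC; apply: ler_wpM2r (H n); rewrite exprn_ge0 ?nm_ge0.
Qed.

Lemma ps_tail c rho M z N K : 0 < rho -> psbound c rho M -> nm z < rho ->
  nm (\sum_(i < N + K) c i * z ^+ i - \sum_(i < N) c i * z ^+ i) <= M * (nm z / rho) ^+ N / (1 - nm z / rho).
Proof.
move=> r0 H zr; have /andP[q0 q1] := ratio01 r0 zr.
have p0 : 0 < 1 - nm z / rho by rewrite subr_gt0.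
rewrite big_split_ord /= addrAC subrr add0r.
apply: le_trans (nm_sum _) _.
apply: le_trans (_ : \sum_(i < K) M * (nm z / rho) ^+ (N + i) <= _).
  by apply: ler_sum => i _; exact: ps_term.
rewrite ler_pdivlMr //; move: (nm z / rho) q0 q1 {p0} => q q0 q1.
have -> : (\sum_(i < K) M * q ^+ (N + i)) * (1 - q) = M * q ^+ N * (1 - q ^+ K).
  elim: K => [|K IH]; first by rewrite big_ord0 expr0 subrr mul0r mulr0.
  by rewrite big_ord_recr /= mulrDl IH exprD exprS; ring.
rewrite -[leRHS]mulr1 ler_wpM2l ?mulr_ge0 ?exprn_ge0 ?(psbound_ge0 H) //.
by rewrite gerBl exprn_ge0.
Qed.

(** A cluster point of the partial sums satisfies the tail bound of every admissible radius, so one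
    function serves all radii; where there is none, its value is 0. *)
Lemma ps_exists c : exists f, forall rho M, 0 < rho -> psbound c rho M -> psrep c rho M f.
Proof.
have X z : exists l, forall rho M, 0 < rho -> psbound c rho M -> nm z < rho ->
    forall N, nm (l - \sum_(i < N) c i * z ^+ i) <= M * (nm z / rho) ^+ N / (1 - nm z / rho).
  have [[rho [M [r0 H zr]]]|no] := pselect (exists rho M, [/\ 0 < rho, psbound c rho M & nm z < rho]); last first.
    by exists 0 => rho M r0 H zr; case: no; exists rho, M.
  pose s k := \sum_(i < k) c i * z ^+ i.
  have [|l _ Hl] := @cluster_pt R s (M * (nm z / rho) ^+ 0 / (1 - nm z / rho)).
    by move=> k; have := ps_tail 0%N k r0 H zr; rewrite add0n big_ord0 subr0.
  exists l => rho' M' r0' H' zr' N.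
  apply: (@le_eps _ _ _ 1) => // e e0; have [k Nk Hk] := Hl N e e0.
  have := ps_tail N (k - N) r0' H' zr'; rewrite subnKC // => H1.
  apply: le_trans (nm_tri _ (s k) _) _; rewrite nmC mulr1 addrC.
  by apply: lerD; [exact: H1|exact: ltW].
have [f Hf] := choice X; exists f => rho M r0 H; split=> // z zr N; exact: Hf.
Qed.

Lemma ps_tail0 (z : R[i]) (rho M e : R) : 0 < rho -> 0 <= M -> nm z < rho -> 0 < e ->
  exists n0, forall n, (n0 <= n)%N -> M * (nm z / rho) ^+ n / (1 - nm z / rho) < e.
Proof.
move=> r0 M0 zr e0; have q01 := ratio01 r0 zr; have /andP[q0 q1] := q01.
have p0 : 0 < 1 - nm z / rho by rewrite subr_gt0.
have [n0 H] := geo_small q01 (divr_ge0 M0 (ltW p0)) e0.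
by exists n0 => n /H; rewrite mulrAC.
Qed.

Lemma psrep_eq c rho M f rho' M' g z : 0 < rho -> 0 < rho' -> psrep c rho M f -> psrep c rho' M' g ->
  nm z < rho -> nm z < rho' -> f z = g z.
Proof.
move=> r0 r0' [Hb Hf] [Hb' Hg] zr zr'; apply/eqP; rewrite -subr_eq0 -nm_eq0 eq_le nm_ge0 andbT.
apply: (@le_eps _ _ _ 2) => // e e0.
have [n0 H0] := ps_tail0 r0 (psbound_ge0 Hb) zr e0.
have [n1 H1] := ps_tail0 r0' (psbound_ge0 Hb') zr' e0.
pose N := maxn n0 n1; have := H0 N (leq_maxl _ _); have := H1 N (leq_maxr _ _).
have := Hf z zr N; have := Hg z zr' N; rewrite (nmC (g z)).
have := nm_tri (f z) (\sum_(i < N) c i * z ^+ i) (g z).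
move: (nm _) (nm _) (nm _) (M * _ / _) (M' * _ / _) => *; lra.
Qed.

Lemma psrep_ball c rho M f rho' : 0 < rho' -> rho' <= rho -> psrep c rho M f -> psrep c rho' M f.
Proof.
move=> r0' rr [Hb Hf]; have r0 : 0 < rho by apply: lt_le_trans rr.
have Hb' : psbound c rho' M.
  move=> n; apply: le_trans (Hb n); apply: ler_wpM2l; first exact: nm_ge0.
  by apply: lerXn2r => //; rewrite nnegrE ltW.
have [g Hg] := ps_exists c.
split=> // z zr N; have zr1 : nm z < rho by apply: lt_le_trans rr.
by rewrite (psrep_eq r0 r0' (conj Hb Hf) (Hg _ _ r0' Hb') zr1 zr); apply: (Hg _ _ r0' Hb').2.
Qed.

(** Once the coefficients below n agree, the two tail bounds at a small real t give |c n - c' n| t^n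
    <= K t^(n+1), with K independent of t. *)
Lemma psrep_uniq c rho M f c' rho' M' : 0 < rho -> 0 < rho' ->
  psrep c rho M f -> psrep c' rho' M' f -> forall n, c n = c' n.
Proof.
move=> r0 r0' Hf Hg; pose s := Num.min rho rho' / 2.
have m0 : 0 < Num.min rho rho' by rewrite lt_min r0.
have s0 : 0 < s by rewrite divr_gt0.
have sm : s < Num.min rho rho' by rewrite ltr_pdivrMr // mulrC mulr2n mulrDl mul1r ltrDr.
move: sm; rewrite lt_min => /andP[sr sr'].
have [Hb {}Hf] := psrep_ball s0 (ltW sr) Hf.
have [Hb' {}Hg] := psrep_ball s0 (ltW sr') Hg.
have M0 := psbound_ge0 Hb; have M0' := psbound_ge0 Hb'.
move=> n; elim/ltn_ind: n => n IH.
apply/eqP; rewrite -subr_eq0 -nm_eq0 eq_le nm_ge0 andbT.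
pose K := 2 * (M + M') / s ^+ n.+1.
have K0 : 0 <= K by rewrite divr_ge0 ?exprn_ge0 ?(ltW s0) // mulr_ge0 // addr_ge0.
apply: (@le_eps _ _ _ K) => // e e0; rewrite add0r.
pose t := Num.min e (s / 2).
have t0 : 0 < t by rewrite lt_min e0 divr_gt0.
have te : t <= e by rewrite ge_min lexx.
have ts : t <= s / 2 by rewrite ge_min lexx orbT.
have nt : nm (t%:C : R[i]) = t by rewrite nmR gtr0_norm.
have tns : nm (t%:C : R[i]) < s by rewrite nt; lra.
have := Hf _ tns n.+1; have := Hg _ tns n.+1; rewrite nt !big_ord_recr /=.
have -> : \sum_(i < n) c i * t%:C ^+ i = \sum_(i < n) c' i * t%:C ^+ i.
  by apply: eq_bigr => i _; rewrite IH.
set S := \sum_(i < n) _ => H1 H2.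
have q12 : t / s <= 1 / 2 by rewrite ler_pdivrMr //; lra.
have q0 : 0 <= t / s by rewrite divr_ge0 // ltW.
have B X : 0 <= X -> X * (t / s) ^+ n.+1 / (1 - t / s) <= 2 * X / s ^+ n.+1 * t ^+ n.+1.
  move=> X0; rewrite ler_pdivrMr ?subr_gt0; last by lra.
  rewrite expr_div_n; have : 0 <= X * (t ^+ n.+1 / s ^+ n.+1).
    by rewrite mulr_ge0 // divr_ge0 // exprn_ge0 // ltW.
  have -> : 2 * X / s ^+ n.+1 * t ^+ n.+1 * (1 - t / s) = X * (t ^+ n.+1 / s ^+ n.+1) * (2 * (1 - t / s)) by ring.
  by move=> Y0; rewrite -[leLHS]mulr1 ler_wpM2l //; lra.
have := le_trans H1 (B _ M0'); have := le_trans H2 (B _ M0); clear H1 H2.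
set u := f _ - _; set v := f _ - _ => H2 H1.
have D : nm ((c n - c' n) * t%:C ^+ n) <= K * t ^+ n.+1.
  have -> : (c n - c' n) * t%:C ^+ n = v - u by rewrite /u /v; ring.
  apply: le_trans (nmB _ _) _; apply: le_trans (lerD H1 H2) _.
  by rewrite le_eqVlt; apply/orP; left; apply/eqP; rewrite /K; ring.
move: D; rewrite nmM nmX nt exprS mulrA ler_pM2r ?exprn_gt0 // => /le_trans; apply.
by rewrite mulrC ler_wpM2r.
Qed.

Lemma psrep_cdv0 c rho M f : 0 < rho -> psrep c rho M f -> cdv f 0 (c 1%N).
Proof.
move=> r0 [Hb Hf] e e0; have M0 := psbound_ge0 Hb.
have K0 : 0 < 2 * M / rho ^+ 2 + 1 by rewrite ltr_wpDl // divr_ge0 ?exprn_ge0 ?(ltW r0) // mulr_ge0.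
exists (Num.min (rho / 2) (e / (2 * M / rho ^+ 2 + 1))).
  by rewrite lt_min !divr_gt0.
move=> y; rewrite /= subr0 lt_min => /andP[y1]; rewrite ltr_pdivlMr // => y2.
have f0 : f 0 = c 0%N.
  have z0 : nm (0 : R[i]) < rho by rewrite nm0.
  have := Hf 0 z0 1%N; rewrite big_ord_recl big_ord0 addr0 expr0 mulr1 nm0 mul0r expr1 mulr0 mul0r => H.
  by apply/eqP; rewrite -subr_eq0 -nm_eq0 eq_le H nm_ge0.
have yr : nm y < rho by lra.
have := Hf y yr 2%N; rewrite big_ord_recl big_ord1 /= expr0 mulr1 expr1 f0 opprD addrA.
move=> /le_trans; apply; set q := nm y / rho.
have q12 : q <= 1 / 2 by rewrite ler_pdivrMr //; lra.
have q0 : 0 <= q by rewrite divr_ge0 ?nm_ge0 ?ltW.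
rewrite ler_pdivrMr ?subr_gt0; last by lra.
have E : 2 * M / rho ^+ 2 * nm y * nm y = 2 * (M * q ^+ 2).
  by rewrite /q; field; rewrite gt_eqF.
have Y := nm_ge0 y; have Q : 0 <= M * q ^+ 2 by rewrite mulr_ge0 // exprn_ge0.
have Q2 : 2 * (M * q ^+ 2) <= e * nm y.
  by rewrite -E; apply: ler_wpM2r => //; rewrite mulrC; apply: le_trans (ltW y2); rewrite ler_wpM2l // lerDl.
have : M * q ^+ 2 <= e * nm y * (1 / 2) by lra.
move/le_trans; apply; rewrite ler_wpM2l //; last by lra.
by rewrite mulr_ge0 // ltW.
Qed.

(** The second-order remainder n^2 r^(n-2) |w - z|^2, with r^2 moved to the left so that no exponent
    n - 2 occurs. *)
Lemma pow_taylor (z w : R[i]) (r : R) n : nm z <= r -> nm w <= r -> 0 <= r ->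
  nm (w ^+ n - z ^+ n - n%:R * z ^+ n.-1 * (w - z)) * r ^+ 2 <= n%:R ^+ 2 * r ^+ n * nm (w - z) ^+ 2.
Proof.
move=> zr wr r0; elim: n => [|n IH].
  by rewrite !expr0 subrr !mul0r subrr nm0 mul0r expr0n /= !mul0r.
have -> : w ^+ n.+1 - z ^+ n.+1 - n.+1%:R * z ^+ n.+1.-1 * (w - z) =
  w * (w ^+ n - z ^+ n - n%:R * z ^+ n.-1 * (w - z)) + n%:R * z ^+ n.-1 * (w - z) ^+ 2.
  case: n {IH} => [|n] /=; first by rewrite expr0 !expr1; ring.
  by rewrite -!natr1 !exprS; ring.
apply: le_trans (ler_wpM2r (exprn_ge0 2 r0) (nmD _ _)) _.
rewrite mulrDl (nmM w).
have h0 := nm_ge0 (w - z); have rn := exprn_ge0 n r0.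
have T1 := ler_pM (nm_ge0 w) (mulr_ge0 (nm_ge0 _) (exprn_ge0 2 r0)) wr IH; rewrite mulrA in T1.
have T2 : nm (n%:R * z ^+ n.-1 * (w - z) ^+ 2) * r ^+ 2 <= n%:R * r ^+ n * r * nm (w - z) ^+ 2.
  case: n {IH T1} rn => [|n] rn; first by rewrite !mul0r nm0 !mul0r.
  rewrite /= !nmM !nmX nm_n.
  rewrite [leRHS](_ : _ = n.+1%:R * nm (w - z) ^+ 2 * (r ^+ n * r ^+ 2)); last by rewrite exprS; ring.
  rewrite [leLHS](_ : _ = n.+1%:R * nm (w - z) ^+ 2 * (nm z ^+ n * r ^+ 2)); last by ring.
  apply: ler_wpM2l; first by rewrite mulr_ge0 ?ler0n ?exprn_ge0.
  by apply: ler_wpM2r; [exact: exprn_ge0|apply: lerXn2r; rewrite ?nnegrE ?nm_ge0].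
apply: le_trans (lerD T1 T2) _; rewrite -natr1 [r ^+ n.+1]exprS.
move: (nm (w - z) ^+ 2) (exprn_ge0 2 h0) (r ^+ n) rn => h hh x x0.
have : 0 <= r * x * h by rewrite !mulr_ge0.
move: (n%:R) (ler0n R n) => m m0 P.
have : 0 <= m * (r * x * h) by rewrite mulr_ge0.
lra.
Qed.

End Series.

(** * Holomorphic functions on discs *)

Section Hol.
Variable R : realType.
Implicit Types (f g : R[i] -> R[i]).

Lemma psbound_n (c : nat -> R[i]) (rho r M : R) : 0 < r -> r < rho -> psbound c rho M ->
  psbound (fun n => n%:R * c n) r (M / (1 - r / rho)).
Proof.
move=> r0 rr H n; have rho0 : 0 < rho by exact: lt_trans rr.
have q01 : 0 <= r / rho < 1 by rewrite divr_ge0 ?(ltW r0) ?(ltW rho0) //= ltr_pdivrMr // mul1r.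
rewrite nmM nm_n.
have -> : n%:R * nm (c n) * r ^+ n = nm (c n) * rho ^+ n * (n%:R * (r / rho) ^+ n).
  by rewrite expr_div_n; field; rewrite expf_neq0 // gt_eqF.
apply: ler_pM (H n) (mul_geo_le n q01).
  by rewrite mulr_ge0 ?nm_ge0 // exprn_ge0 // ltW.
by rewrite mulr_ge0 // exprn_ge0 //; case/andP: q01.
Qed.

Lemma psbound_S (c : nat -> R[i]) (rho M : R) : 0 < rho -> psbound c rho M ->
  psbound (fun n => c n.+1) rho (M / rho).
Proof.
by move=> r0 H n; rewrite ler_pdivlMr // -mulrA -exprSr; exact: H.
Qed.

(** By [pow_taylor], f differs from its tangent at z by at most the sum of n^2 |c n| a^(n-2) |w -
    z|^2. Each factor n costs a smaller radius, from rho to r and from r to b, and a < b makes the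
    remaining sum geometric. *)
Lemma ps_deriv (c : nat -> R[i]) (rho M r : R) f : 0 < r -> r < rho -> psrep c rho M f ->
  exists M1 f1, psrep (fun n => n.+1%:R * c n.+1) r M1 f1 /\ forall z, nm z < r -> cdv f z (f1 z).
Proof.
move=> r0 rr Hf; have rho0 : 0 < rho by exact: lt_trans rr.
have Hb1 := psbound_S r0 (psbound_n r0 rr Hf.1).
have [f1 /(_ _ _ r0 Hb1) Hf1] := ps_exists (fun n => n.+1%:R * c n.+1).
eexists; exists f1; split; first exact: Hf1.
move=> z zr; pose a := (nm z + r) / 2; pose b := (a + r) / 2.
have [za ar ab br] : [/\ nm z < a, a < r, a < b & b < r] by rewrite /b /a; split; lra.
have a0 : 0 < a by apply: le_lt_trans za; exact: nm_ge0.
have b0 : 0 < b by exact: lt_trans ab.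
have Hb2 := psbound_n b0 br (psbound_n r0 rr Hf.1).
set M2 := _ / _ in Hb2.
have q01 : 0 <= a / b < 1 by rewrite divr_ge0 ?(ltW a0) ?(ltW b0) //= ltr_pdivrMr // mul1r.
have M20 := psbound_ge0 Hb2; have p0 : 0 < 1 - a / b by rewrite subr_gt0; case/andP: q01.
pose B := M2 / (1 - a / b) / a ^+ 2.
have B0 : 0 <= B by rewrite divr_ge0 ?exprn_ge0 ?(ltW a0) // divr_ge0 // ltW.
have main w : nm w <= a -> nm (f w - f z - f1 z * (w - z)) <= B * nm (w - z) ^+ 2.
  move=> wa; apply: (@le_eps _ _ _ (2 + nm (w - z))); first by rewrite addr_ge0 ?nm_ge0.
  move=> e e0.
  have wr : nm w < rho by apply: le_lt_trans wa _; exact: lt_trans ar rr.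
  have zr' : nm z < rho by exact: lt_trans rr.
  have M0 := psbound_ge0 Hf.1.
  have [n0 H0] := ps_tail0 rho0 M0 zr' e0; have [n1 H1] := ps_tail0 rho0 M0 wr e0.
  have [n2 H2] := ps_tail0 r0 (psbound_ge0 Hf1.1) zr e0.
  pose N := maxn n0 (maxn n1 n2).
  have {}H0 := le_lt_trans (Hf.2 z zr' N.+1) (H0 N.+1 (leqW (leq_maxl _ _))).
  have {}H1 := le_lt_trans (Hf.2 w wr N.+1) (H1 N.+1 (leqW (leq_trans (leq_maxl _ _) (leq_maxr _ _)))).
  have {}H2 := le_lt_trans (Hf1.2 z zr N) (H2 N (leq_trans (leq_maxr _ _) (leq_maxr _ _))).
  pose D n := c n * (w ^+ n - z ^+ n - n%:R * z ^+ n.-1 * (w - z)).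
  have E : \sum_(i < N.+1) D i = \sum_(i < N.+1) c i * w ^+ i - \sum_(i < N.+1) c i * z ^+ i
      - (\sum_(i < N) i.+1%:R * c i.+1 * z ^+ i) * (w - z).
    rewrite -sumrB [X in _ = X - _]big_ord_recl [LHS]big_ord_recl /= mulr_suml -addrA -sumrB; congr (_ + _).
      by rewrite /D !expr0; ring.
    by apply: eq_bigr => i _; rewrite /D /bump /= add1n; ring.
  have HD : nm (\sum_(i < N.+1) D i) <= B * nm (w - z) ^+ 2.
    apply: le_trans (nm_sum _) _.
    have h2 : 0 <= nm (w - z) ^+ 2 / a ^+ 2 by rewrite divr_ge0 ?exprn_ge0 ?nm_ge0 // ltW.
    apply: le_trans (_ : \sum_(i < N.+1) M2 * (a / b) ^+ i * (nm (w - z) ^+ 2 / a ^+ 2) <= _).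
      apply: ler_sum => i _; rewrite nmM.
      have T := @pow_taylor R z w a i (ltW za) wa (ltW a0).
      have a2 : 0 < a ^+ 2 by rewrite exprn_gt0.
      rewrite mulrA ler_pdivlMr //.
      apply: le_trans (_ : nm (c i) * (i%:R ^+ 2 * a ^+ i * nm (w - z) ^+ 2) <= _).
        by rewrite -[leLHS]mulrA; apply: ler_wpM2l T; exact: nm_ge0.
      rewrite mulrA; apply: ler_wpM2r; first by rewrite exprn_ge0 ?nm_ge0.
      have := Hb2 i; rewrite !nmM !nm_n => Hi.
      have bi : 0 < b ^+ i by rewrite exprn_gt0.
      have -> : M2 * (a / b) ^+ i = M2 * a ^+ i / b ^+ i by rewrite expr_div_n mulrA.
      rewrite ler_pdivlMr //.
      rewrite [leLHS](_ : _ = i%:R * (i%:R * nm (c i)) * b ^+ i * a ^+ i); last by ring.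
      by apply: ler_wpM2r Hi; rewrite exprn_ge0 // ltW.
    rewrite -mulr_suml.
    have -> : B * nm (w - z) ^+ 2 = M2 / (1 - a / b) * (nm (w - z) ^+ 2 / a ^+ 2) by rewrite /B; ring.
    apply: ler_wpM2r => //; rewrite ler_pdivlMr //.
    move: (a / b) q01 => q /andP[q0 q1]; rewrite -mulr_sumr -mulrA -[leRHS]mulr1; apply: ler_wpM2l => //.
    have -> : (\sum_(i < N.+1) q ^+ i) * (1 - q) = 1 - q ^+ N.+1.
      elim: (N.+1) => [|K IH]; first by rewrite big_ord0 expr0 subrr mul0r.
      by rewrite big_ord_recr /= mulrDl IH exprS; ring.
    by rewrite gerBl exprn_ge0.
  rewrite [X in nm X](_ : _ = (f w - \sum_(i < N.+1) c i * w ^+ i) - (f z - \sum_(i < N.+1) c i * z ^+ i)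
    - (f1 z - \sum_(i < N) i.+1%:R * c i.+1 * z ^+ i) * (w - z) + \sum_(i < N.+1) D i); last by rewrite E; ring.
  apply: le_trans (nmD _ _) _; rewrite [leLHS]addrC; apply: lerD HD _.
  apply: le_trans (nmB _ _) _; rewrite [leRHS]mulrDr; apply: lerD.
    apply: le_trans (nmB _ _) _.
    have -> : e * 2 = e + e by rewrite mulr2n mulrDr mulr1.
    by apply: lerD; exact: ltW.
  by rewrite nmM ler_wpM2r ?nm_ge0 // ltW.
move=> e e0; have B1 : 0 < B + 1 by rewrite ltr_wpDl.
exists (Num.min (a - nm z) (e / (B + 1))); first by rewrite lt_min subr_gt0 za divr_gt0.
move=> w /=; rewrite lt_min => /andP[w1]; rewrite ltr_pdivlMr // => w2.
apply: le_trans (main w _) _.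
  by have := nmD (w - z) z; rewrite subrK; lra.
rewrite expr2 mulrA; apply: ler_wpM2r; first exact: nm_ge0.
by have := nm_ge0 (w - z); lra.
Qed.

Lemma cdv_cst (k z : R[i]) : cdv (fun _ => k) z 0.
Proof. exact: (@ddv_cst R R[i] id k z). Qed.

Lemma cdv_id (z : R[i]) : cdv (fun w => w) z 1.
Proof. exact: (@ddv_io R R[i] id z). Qed.

(** The derivative travels along as an explicit function, with arbitrary values outside the disc. *)
Definition hol f f1 (c : R[i]) (r : R) := forall z, nm (z - c) < r -> cdv f z (f1 z).

Lemma cdv_shift f c z l : cdv f (c + z) l -> cdv (fun w => f (c + w)) z l.
Proof.
move=> H; have H1 : cdv (fun w => c + w) z 1.
  by apply: ddv_eqd (ddvD (cdv_cst c z) (cdv_id z)) _; rewrite add0r.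
by have := @ddv_comp R R[i] id f (fun w => c + w) z l 1 H H1; rewrite mulr1.
Qed.

Lemma cdv_unshift f c z l : cdv (fun w => f (c + w)) (z - c) l -> cdv f z l.
Proof.
move=> H.
have H1 : cdv (fun w => w - c) z 1.
  by apply: ddv_eqd (ddvB (cdv_id z) (cdv_cst c z)) _; rewrite subr0.
have := @ddv_comp R R[i] id (fun w => f (c + w)) (fun w => w - c) z l 1 H H1.
by rewrite mulr1 => H2; apply: (ddv_ext H2) => y /=; rewrite addrC subrK.
Qed.

Lemma hol_shift f f1 c r : hol f f1 c r -> hol (fun z => f (c + z)) (fun z => f1 (c + z)) 0 r.
Proof. by move=> H z; rewrite subr0 => zr; apply: cdv_shift; apply: H; rewrite addrC addKr. Qed.

Lemma hol0 f f1 r z : hol f f1 0 r -> nm z < r -> cdv f z (f1 z).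
Proof. by move=> H zr; apply: H; rewrite subr0. Qed.

(** By uniqueness of coefficients, the sequence found for the radius r/2 serves every circle and
    every bound on it. *)
Lemma hol_series f f1 (r : R) : hol f f1 0 r -> exists c : nat -> R[i],
  forall rho B, 0 < rho -> rho < r -> (forall z, nm z = rho -> nm (f z) <= B) -> psrep c rho B f.
Proof.
move=> H; have H0 z : nm z < r -> cdv f z (f1 z) by exact: hol0.
have [r0|r0] := ltP 0 r; last by exists (fun _ => 0) => rho B rho0 rr; move: (lt_trans rho0 rr); rewrite ltNge r0.
have r2 : 0 < r / 2 by rewrite divr_gt0.
have r2r : r / 2 < r by lra.
have [c [B0 Hc]] := cauchy_series_ex r2 r2r H0.
exists c => rho B rho0 rr HB; have [c' Hc'] := cauchy_series rho0 rr H0 HB.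
have -> // : c = c'.
by apply/funext => n; exact: (psrep_uniq r2 rho0 Hc Hc').
Qed.

Lemma hol_bound f f1 (r rho : R) : hol f f1 0 r -> rho < r ->
  exists2 B, 0 <= B & forall z, nm z <= rho -> nm (f z) <= B.
Proof. by move=> H rr; apply: bounded_disc rr (fun z => @hol0 f f1 r z H). Qed.

(** Near z the derived series represents f1, by uniqueness of derivatives, and it can be
    differentiated once more on a smaller disc. *)
Lemma hol_deriv f f1 c r : hol f f1 c r -> exists f2, hol f1 f2 c r.
Proof.
move=> H0; have H := hol_shift H0.
suff X z : exists l, nm (z - c) < r -> cdv f1 z l.
  by have [f2 Hf2] := choice X; exists f2 => z; exact: Hf2.
have [zr|zr] := ltP (nm (z - c)) r; last by exists 0.
suff [l Hl] : exists l, cdv (fun w => f1 (c + w)) (z - c) l by exists l => _; exact: cdv_unshift Hl.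
move: (z - c) zr => {}z zr.
have [s Hs] := hol_series H.
pose a := (nm z + r) / 2; pose b := (nm z + a) / 2; pose d := (nm z + b) / 2.
have [zd db ba ar] : [/\ nm z < d, d < b, b < a & a < r] by rewrite /d /b /a; split; lra.
have d0 : 0 < d by apply: le_lt_trans zd; exact: nm_ge0.
have b0 : 0 < b by exact: lt_trans db. have a0 : 0 < a by exact: lt_trans ba.
have [B B0 HB] := hol_bound H ar.
have [M1 [g [Hg Hfg]]] := ps_deriv b0 ba (Hs a B a0 ar (fun z H => HB z (eq_ind_r (fun x => x <= a) (lexx a) H))).
have [M2 [h [Hh Hgh]]] := ps_deriv d0 db Hg.
exists (h z); apply: ddv_loc (Hgh z zd) _; exists (b - nm z); first by rewrite subr_gt0 (lt_trans zd).
move=> y /= yz; have yb : nm y < b by have := nmD (y - z) z; rewrite subrK; lra.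
apply: (cdv_unique (Hfg y yb)); apply: (hol0 H); exact: lt_trans (lt_trans yb ba) ar.
Qed.

Lemma hol_prim f f1 c r : hol f f1 c r -> exists F, hol F f c r.
Proof.
move=> H0; have H := hol_shift H0.
have [s Hs] := hol_series H.
pose S n := if n is m.+1 then s m / m.+1%:R else 0.
have [F HF] := ps_exists S.
exists (fun z => F (z - c)) => z zr.
suff : cdv F (z - c) (f z).
  have H1 : cdv (fun w => w - c) z 1.
    by apply: ddv_eqd (ddvB (cdv_id z) (cdv_cst c z)) _; rewrite subr0.
  by move=> H2; have := @ddv_comp R R[i] id F (fun w => w - c) z _ 1 H2 H1; rewrite mulr1.
have -> : f z = (fun w => f (c + w)) (z - c) by rewrite addrC subrK.
move: (z - c) zr => {}z zr.
pose a := (nm z + r) / 2; pose b := (nm z + a) / 2.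
have [zb ba ar] : [/\ nm z < b, b < a & a < r] by rewrite /b /a; split; lra.
have b0 : 0 < b by apply: le_lt_trans zb; exact: nm_ge0.
have a0 : 0 < a by exact: lt_trans ba.
have [B B0 HB] := hol_bound H ar.
have Ha := Hs a B a0 ar (fun z H => HB z (eq_ind_r (fun x => x <= a) (lexx a) H)).
have Sb : psbound S a (B * a).
  case=> [|n]; first by rewrite -[S 0%N]/(0 : R[i]) nm0 mul0r mulr_ge0 // ltW.
  rewrite -[S n.+1]/(s n / n.+1%:R).
  rewrite exprSr mulrA ler_wpM2r ?(ltW a0) //; apply: le_trans (Ha.1 n).
  rewrite ler_wpM2r ?exprn_ge0 ?(ltW a0) // nmf nm_n ler_pdivrMr ?ltr0n //.
  by rewrite ler_peMr ?nm_ge0 // ler1n.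
have [M1 [g [Hg HFg]]] := ps_deriv b0 ba (HF _ _ a0 Sb).
have -> : f (c + z) = g z; last exact: HFg.
have E : (fun n => n.+1%:R * S n.+1) = s.
  by apply/funext => n; rewrite /S mulrC divfK // pnatr_eq0.
rewrite E in Hg; apply: (@psrep_eq R s a B (fun z => f (c + z)) b M1 g) => //.
exact: lt_trans ba.
Qed.

Lemma cauchy_est f f1 c (r B : R) : 0 < r -> hol f f1 c r ->
  (forall z, nm (z - c) < r -> nm (f z) <= B) -> nm (f1 c) <= B / r.
Proof.
move=> r0 /hol_shift H HB.
have {}HB z : nm z < r -> nm (f (c + z)) <= B by move=> zr; apply: HB; rewrite addrC addKr.
have [s Hs] := hol_series H.
have E : f1 c = s 1%N.
  have r2 : 0 < r / 2 by rewrite divr_gt0.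
  have rr : r / 2 < r by lra.
  have zr : nm (0 : R[i]) < r by rewrite nm0.
  have Hp : psrep s (r / 2) B (fun z => f (c + z)).
    by apply: Hs => // z zr2; apply: HB; rewrite zr2.
  have := cdv_unique (psrep_cdv0 r2 Hp) (hol0 H zr).
  by rewrite addr0.
rewrite E ler_pdivlMr //.
have M0 := nm_ge0 (s 1%N).
apply: (@le_eps _ _ _ (nm (s 1%N))) => // e e0.
have [er|re] := ltP e r; last first.
  have B0 : 0 <= B by apply: le_trans (HB 0 _); rewrite ?nm_ge0 ?nm0.
  have : nm (s 1%N) * r <= nm (s 1%N) * e by rewrite ler_wpM2l.
  by rewrite (mulrC _ e); lra.
have re0 : 0 < r - e by rewrite subr_gt0.
have rer : r - e < r by lra.
have Hp : psrep s (r - e) B (fun z => f (c + z)).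
  by apply: Hs => // z zr2; apply: HB; rewrite zr2.
by have := Hp.1 1%N; rewrite expr1; lra.
Qed.

Lemma pow_le1 (x K : R) : 0 <= x -> (forall n, x ^+ n <= K) -> x <= 1.
Proof.
move=> x0 H; rewrite leNgt; apply/negP => x1.
have x10 : 0 < x - 1 by rewrite subr_gt0.
have B n : 1 + n%:R * (x - 1) <= x ^+ n.
  elim: n => [|n IH]; first by rewrite mul0r addr0 expr0.
  rewrite -natr1 exprS; have : x * (1 + n%:R * (x - 1)) <= x * x ^+ n by rewrite ler_wpM2l.
  have : 0 <= n%:R * (x - 1) ^+ 2 by rewrite mulr_ge0 // sqr_ge0.
  by rewrite expr2; move: (x ^+ n) (n%:R) => y m; lra.
have K0 : 0 <= K by apply: le_trans (H 0%N); rewrite expr0.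
have := archi_boundP (divr_ge0 K0 (ltW x10)); rewrite ltr_pdivrMr // => H1.
by have := le_trans (B _) (H (Num.bound (K / (x - 1)))); lra.
Qed.

Lemma hol_pow f f1 c r n : hol f f1 c r -> hol (fun z => f z ^+ n) (fun z => n%:R * f z ^+ n.-1 * f1 z) c r.
Proof. by move=> H z zr; apply: ddvX; exact: H. Qed.

(** Landau's trick: the crude bound |f z| <= B / (1 - |z|/rho), for c = 0, applied to f^n loses a
    constant that does not depend on n, and taking n-th roots removes it. *)
Lemma max_principle f f1 c (r rho B : R) : hol f f1 c r -> 0 < rho -> rho < r ->
  (forall z, nm (z - c) = rho -> nm (f z) <= B) ->
  forall z, nm (z - c) < rho -> nm (f z) <= B.
Proof.
move=> /hol_shift H rho0 rr HB.
have {}HB z : nm z = rho -> nm (f (c + z)) <= B by move=> zr; apply: HB; rewrite addrC addKr.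
move=> z; have -> : f z = f (c + (z - c)) by rewrite addrC subrK.
move: (z - c) => {}z zr.
have B0 : 0 <= B.
  by apply: le_trans (HB (rho%:C) _); rewrite ?nm_ge0 // nmR gtr0_norm.
have p0 : 0 < 1 - nm z / rho by rewrite subr_gt0; case/andP: (ratio01 rho0 zr).
have P n : nm (f (c + z)) ^+ n <= B ^+ n / (1 - nm z / rho).
  have [s Hs] := hol_series (hol_pow n H).
  have HBn w : nm w = rho -> nm (f (c + w) ^+ n) <= B ^+ n.
    by move=> wr; rewrite nmX lerXn2r ?nnegrE ?nm_ge0 // HB.
  have := (Hs rho (B ^+ n) rho0 rr HBn).2 z zr 0%N.
  by rewrite big_ord0 subr0 nmX expr0 mulr1.
have [Be|Bn] := eqVneq B 0.
  by have := P 1%N; rewrite Be !expr1 mul0r.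
have Bp : 0 < B by rewrite lt_neqAle eq_sym Bn.
rewrite -[leRHS]mul1r -ler_pdivrMr //; apply: (@pow_le1 _ (1 - nm z / rho)^-1).
  by rewrite divr_ge0 ?nm_ge0.
move=> n; rewrite expr_div_n ler_pdivrMr ?exprn_gt0 // mulrC; exact: P.
Qed.

Definition ent f f1 := forall z, cdv f z (f1 z).

Lemma ent_hol f f1 c r : ent f f1 -> hol f f1 c r.
Proof. by move=> H z _. Qed.
Arguments ent_hol {f f1} c r _.

Lemma seg_const f c r : hol f (fun _ => 0) c r -> forall z, nm (z - c) < r -> f z = f c.
Proof.
move=> H z zr; pose u (t : R) : R[i] := c + t%:C * (z - c).
have cu t : cdr u t (z - c).
  have := ddvD (ddv_cst (real_complex R) c t) (ddvM (ddv_io (real_complex R) t) (ddv_cst _ (z - c) t)).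
  by move=> H1; apply: ddv_eqd H1 _; ring.
have := @cdr_const R (fun t => f (u t)) 0 1 ler01.
have -> : u 1 = z by rewrite /u rmorph1 mul1r addrC subrK.
have -> : u 0 = c by rewrite /u rmorph0 mul0r addr0.
apply => t /andP[t0 t1].
apply: ddv_eqd (ddv_comp (f := f) (g := u) (H _ _) (cu t)) _; last by rewrite mul0r.
rewrite /u addrC addKr nmM nmR ger0_norm //; apply: le_lt_trans zr.
by rewrite ler_piMl ?nm_ge0.
Qed.

Lemma ent_const f : ent f (fun _ => 0) -> forall z, f z = f 0.
Proof.
move=> H z; apply: (@seg_const f 0 (nm z + 1)); first exact: ent_hol.
by rewrite subr0; lra.
Qed.

Lemma liouville f f1 B : ent f f1 -> (forall z, nm (f z) <= B) -> forall z, f1 z = 0.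
Proof.
move=> H HB z; apply/eqP; rewrite -nm_eq0 eq_le nm_ge0 andbT.
have B0 : 0 <= B by apply: le_trans (HB 0); exact: nm_ge0.
apply: (@le_eps _ _ _ B) => // e e0; rewrite add0r.
have ei : 0 < e^-1 by rewrite invr_gt0.
by have := cauchy_est ei (ent_hol z e^-1 H) (fun z _ => HB z); rewrite invrK mulrC.
Qed.

Lemma ent_deriv f f1 : ent f f1 -> exists f2, ent f1 f2.
Proof.
move=> H; have X z : exists l, cdv f1 z l.
  have [f2 H2] := hol_deriv (ent_hol z 1 H); exists (f2 z); apply: H2.
  by rewrite subrr nm0.
by have [f2 H2] := choice X; exists f2.
Qed.

End Hol.
Arguments ent_hol {R f f1} c r _.

(** * Exponential, logarithm, zeros *)

Section Exp.
Variable R : realType.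
Implicit Types (z w h : R[i]).

Lemma expCD z w : expC (z + w) = expC z * expC w.
Proof.
case: z w => x y [x' y']; rewrite /expC /= expRD cosD sinD.
by apply/eqP; rewrite eq_complex /=; apply/andP; split; apply/eqP; ring.
Qed.

Lemma nm_expC z : nm (expC z) = expR (complex.Re z).
Proof. by rewrite /expC nmM nmR -[X in nm X]/(eit _) nm_eit mulr1 ger0_norm // expR_ge0. Qed.

Lemma expC0 : expC (0 : R[i]) = 1.
Proof. by rewrite /expC /= expR0 cos0 sin0 -[1%:C]/(1 : R[i]) mul1r. Qed.

Lemma expC_neq0 z : expC z != 0.
Proof. by rewrite -nm_gt0 nm_expC expR_gt0. Qed.

Lemma expCN z : expC (- z) = (expC z)^-1.
Proof.
apply: (mulfI (expC_neq0 z)); rewrite -expCD subrr expC0 divff //; exact: expC_neq0.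
Qed.

Lemma expC_small (e : R) : 0 < e -> exists2 d : R, 0 < d &
  forall h, nm h < d -> nm (expC h - 1 - h) <= e * nm h.
Proof.
(* The four error terms below contribute 1, 2, 2 and 1 times [k * n]. *)
move=> e0; pose k := Num.min (e / 6) 1.
have k0 : 0 < k by rewrite lt_min ltr01 divr_gt0.
have k1 : k <= 1 by rewrite ge_min lexx orbT.
have ke : k <= e / 6 by rewrite ge_min lexx.
have [d1 d10 H1] := is_derive_eps (is_derive_expR (0 : R)) k0.
have [d2 d20 H2] := is_derive_eps (is_derive_cos (0 : R)) k0.
have [d3 d30 H3] := is_derive_eps (is_derive_sin (0 : R)) k0.
exists (Num.min (k / 2) (Num.min d1 (Num.min d2 d3))); first by rewrite !lt_min d10 d20 d30 divr_gt0.
move=> h; rewrite !lt_min => /and4P[hk hd1 hd2 hd3].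
have rx := nm_Re h; have ry := nm_Im h; have h0 := nm_ge0 h.
case: h rx ry hk hd1 hd2 hd3 h0 => x y; rewrite [complex.Re _]/= [complex.Im _]/=.
set n := nm _ => rx ry hk hd1 hd2 hd3 n0.
have := H1 x; rewrite subr0 expR0 mul1r => /(_ (le_lt_trans rx hd1)) {}H1.
have := H2 y; rewrite subr0 cos0 sin0 oppr0 mul0r subr0 => /(_ (le_lt_trans ry hd2)) {}H2.
have := H3 y; rewrite subr0 cos0 sin0 subr0 mul1r => /(_ (le_lt_trans ry hd3)) {}H3.
have -> : expC (x +i* y) - 1 - (x +i* y) =
   ((expR x - 1 - x) + expR x * (cos y - 1)) +i* (expR x * (sin y - y) + y * (expR x - 1)).
  by rewrite /expC /=; apply/eqP; rewrite eq_complex /=; apply/andP; split; apply/eqP; ring.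
apply: le_trans (nm_ReIm _) _; rewrite [complex.Re _]/= [complex.Im _]/=.
have E0 := expR_ge0 x.
have kx : k * `|x| <= k * n by rewrite ler_wpM2l // ltW.
have ky : k * `|y| <= k * n by rewrite ler_wpM2l // ltW.
have kn : k * n <= n by rewrite ler_piMl.
have E1 : `|expR x - 1| <= 2 * n.
  rewrite -(subrK x (expR x - 1)); apply: le_trans (ler_normD _ _) _; move: H1 kx kn rx.
  by move: `|_ - x| `|x| => *; lra.
have E2 : expR x <= 2.
  have := ler_norm (expR x - 1); move: k1 hk E1; move: `|_| => *; lra.
have T1 : `|expR x * (cos y - 1)| <= 2 * (k * n).
  by rewrite normrM (ger0_norm E0); apply: ler_pM => //; apply: le_trans H2 ky.
have T2 : `|expR x * (sin y - y)| <= 2 * (k * n).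
  by rewrite normrM (ger0_norm E0); apply: ler_pM => //; apply: le_trans H3 ky.
have T3 : `|y * (expR x - 1)| <= k * n.
  rewrite normrM mulrC; apply: (@le_trans _ _ (2 * n * n)); first exact: ler_pM.
  by apply: ler_wpM2r => //; lra.
apply: le_trans (lerD (ler_normD _ _) (ler_normD _ _)) _.
have en : k * n <= e / 6 * n by rewrite ler_wpM2r.
have := le_trans H1 kx; move: T1 T2 T3 en; move: `|_| `|_| `|_| `|_| => *; lra.
Qed.

Lemma cdv_expC z : cdv (@expC R) z (expC z).
Proof.
move=> e e0; have n0 : 0 < nm (expC z) by rewrite nm_gt0 expC_neq0.
have [d d0 Hd] := expC_small (divr_gt0 e0 n0); exists d => // y /= /Hd H.
have -> : expC y - expC z - expC z * (y - z) = expC z * (expC (y - z) - 1 - (y - z)).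
  have -> : expC y = expC z * expC (y - z) by rewrite -expCD addrC subrK.
  by ring.
rewrite nmM; apply: le_trans (ler_wpM2l (ltW n0) H) _.
by rewrite le_eqVlt; apply/orP; left; apply/eqP; field; rewrite gt_eqF.
Qed.

Lemma expC_surj z : z != 0 -> exists w, expC w = z.
Proof.
move=> z0; have n0 : 0 < nm z by rewrite nm_gt0.
have N : (complex.Re z / nm z) ^+ 2 + (complex.Im z / nm z) ^+ 2 = 1.
  by rewrite !expr_div_n -mulrDl -nm_sqr divff // expf_neq0 // gt_eqF.
set x := complex.Re z / nm z in N; set y := complex.Im z / nm z in N.
have x1 : -1 <= x <= 1.
  by rewrite -ler_norml /x normrM normfV (gtr0_norm n0) ler_pdivrMr // mul1r nm_Re.
have cx : cos (acos x) = x by rewrite acosK // in_itv.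
have sx : sin (acos x) = `|y|.
  by rewrite sin_acos // -N addrAC subrr add0r sqrtr_sqr.
have E (t : R) : cos t = x -> sin t = y -> expC (ln (nm z) +i* t) = z.
  move=> Hc Hs; rewrite /expC /= lnK ?posrE // Hc Hs /x /y.
  move: (nm z) n0 => s s0; case: (z) => a b; apply/eqP; rewrite eq_complex /=.
  by apply/andP; split; apply/eqP; field; exact: lt0r_neq0.
have [y0|y0] := leP 0 y.
  by exists (ln (nm z) +i* acos x); apply: E => //; rewrite sx ger0_norm.
exists (ln (nm z) +i* (- acos x)); apply: E; first by rewrite cosN.
by rewrite sinN sx ltr0_norm // opprK.
Qed.

(** For the primitive L of q'/q normalised at c, the function q exp(-L) has derivative 0 and the
    value 1 at c. *)
Lemma hol_log (q q1 : R[i] -> R[i]) (c : R[i]) (r : R) : 0 < r -> hol q q1 c r ->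
  (forall z, nm (z - c) < r -> q z != 0) ->
  exists2 L, hol L (fun z => q1 z / q z) c r & forall z, nm (z - c) < r -> q z = expC (L z).
Proof.
move=> r0 Hq q0; have [q2 Hq2] := hol_deriv Hq.
have Hd : hol (fun z => q1 z / q z) (fun z => (q2 z * q z - q1 z * q1 z) / q z ^+ 2) c r.
  by move=> z zr; apply: ddvf; [exact: q0|exact: Hq2|exact: Hq].
have [L0 HL0] := hol_prim Hd.
have cc : nm (c - c) < r by rewrite subrr nm0.
have [a Ha] := expC_surj (q0 c cc).
pose L z := L0 z + (a - L0 c).
have HL : hol L (fun z => q1 z / q z) c r.
  by move=> z zr; apply: ddv_eqd (ddvD (HL0 z zr) (cdv_cst _ z)) _; rewrite addr0.
exists L => // z zr.
have D w : nm (w - c) < r -> cdv (fun w => q w * expC (- L w)) w 0.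
  move=> wr; have H1 := @ddv_comp R R[i] id (@expC R) (fun w => - L w) w _ _ (cdv_expC _) (ddvN (HL w wr)).
  apply: ddv_eqd (ddvM (Hq w wr) H1) _; field; exact: q0.
have Lc : L c = a by rewrite /L addrC subrK.
have := seg_const D zr; rewrite Lc !expCN Ha divff ?q0 // => H.
by rewrite -[LHS](divfK (expC_neq0 (L z))) H mul1r.
Qed.

End Exp.

(** * Division by zeros, Schwarz's lemma, the identity theorem *)

Section Division.
Variable R : realType.
Implicit Types (f g : R[i] -> R[i]).

Lemma hol_div f f1 (c : R[i]) (r : R) : hol f f1 c r -> f c = 0 ->
  exists g g1, hol g g1 c r /\ forall z, f z = (z - c) * g z.
Proof.
move=> H fc; pose g z := if z == c then f1 c else f z / (z - c).
have E z : f z = (z - c) * g z.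
  rewrite /g; have [->|zc] := eqVneq z c; first by rewrite fc subrr mul0r.
  by rewrite mulrC divfK // subr_eq0.
suff X z : exists l, nm (z - c) < r -> cdv g z l.
  by have [g1 Hg1] := choice X; exists g, g1; split=> // z; exact: Hg1.
have [zr|zr] := ltP (nm (z - c)) r; last by exists 0.
have [zc|zc] := eqVneq z c; last first.
  eexists => _; apply: ddv_loc (@ddvf R R[i] id f (fun w => w - c) z _ _ _ (H z zr) (ddvB (cdv_id z) (cdv_cst c z))) _.
    by rewrite subr_eq0.
  exists (nm (z - c)); first by rewrite nm_gt0 subr_eq0.
  move=> y /= yz; rewrite /g; case: eqVneq => // yc; move: yz.
  by rewrite yc nmC ltxx.
rewrite zc; rewrite zc subrr nm0 in zr.
have [s Hs] := hol_series (hol_shift H).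
have r0 : 0 < r / 2 by rewrite divr_gt0.
have rr : r / 2 < r by lra.
have [B B0 HB] := hol_bound (hol_shift H) rr.
have Hp : psrep s (r / 2) B (fun z => f (c + z)).
  by apply: Hs => // w wr; apply: HB; rewrite wr.
have s0 : s 0%N = 0.
  have z0 : nm (0 : R[i]) < r / 2 by rewrite nm0.
  have := Hp.2 0 z0 1%N; rewrite addr0 fc big_ord1 expr0 mulr1 nm0 mul0r expr1 mulr0 mul0r sub0r nmN.
  by move=> h; apply/eqP; rewrite -nm_eq0 eq_le h nm_ge0.
have s1 : s 1%N = f1 c.
  have := cdv_unique (psrep_cdv0 r0 Hp) (hol0 (hol_shift H) _); rewrite addr0; apply.
  by rewrite nm0.
(* The quotient by z - c shifts the Taylor coefficients, so its derivative at c is the quadratic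
   coefficient of f. *)
exists (s 2%N) => _ e e0.
have K0 : 0 < 2 * B / (r / 2) ^+ 3 + 1.
  by rewrite ltr_wpDl // divr_ge0 ?exprn_ge0 ?(ltW r0) // mulr_ge0.
exists (Num.min (r / 2 / 2) (e / (2 * B / (r / 2) ^+ 3 + 1))).
  by rewrite lt_min !divr_gt0.
move=> y /=; rewrite lt_min => /andP[y1]; rewrite ltr_pdivlMr // => y2.
have [->|yc] := eqVneq y c; first by rewrite !subrr mulr0 subr0 nm0 mulr0.
have n0 : 0 < nm (y - c) by rewrite nm_gt0 subr_eq0.
rewrite /g eqxx (negbTE yc) -(ler_pM2r n0) -nmM.
have yc0 : y - c != 0 by rewrite subr_eq0.
have -> : (f y / (y - c) - f1 c - s 2%N * (y - c)) * (y - c) = f y - f1 c * (y - c) - s 2%N * (y - c) ^+ 2.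
  by field.
have yr : nm (y - c) < r / 2 by lra.
have := Hp.2 (y - c) yr 3%N.
have -> : c + (y - c) = y by rewrite addrC subrK.
have -> : f y - \sum_(i < 3) s i * (y - c) ^+ i = f y - f1 c * (y - c) - s 2%N * (y - c) ^+ 2.
  by rewrite !big_ord_recl big_ord0 /bump /= s0 s1; ring.
move=> /le_trans; apply; move: (nm (y - c)) n0 y1 y2 {yr} => n n0 n1 n2.
have q12 : n / (r / 2) <= 1 / 2 by rewrite ler_pdivrMr //; lra.
rewrite ler_pdivrMr ?subr_gt0; last by lra.
have X : B * (n / (r / 2)) ^+ 3 = 1 / 2 * (2 * B / (r / 2) ^+ 3 * n) * n * n.
  by field; rewrite gt_eqF.
have Y : 2 * B / (r / 2) ^+ 3 * n <= e.
  apply: le_trans (ltW n2); rewrite mulrC ler_wpM2l ?(ltW n0) // lerDl //.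
rewrite X; apply: (@le_trans _ _ (1 / 2 * e * n * n)).
  by do 2 (apply: ler_wpM2r; first exact: ltW); apply: ler_wpM2l => //; lra.
have -> : 1 / 2 * e * n * n = e * n * n * (1 / 2) by ring.
apply: ler_wpM2l; last by lra.
by rewrite !mulr_ge0 // ltW.
Qed.

Lemma ent_div f f1 (c : R[i]) : ent f f1 -> f c = 0 ->
  exists g g1, ent g g1 /\ forall z, f z = (z - c) * g z.
Proof.
move=> H fc; pose g z := if z == c then f1 c else f z / (z - c).
have E z : f z = (z - c) * g z.
  rewrite /g; have [->|zc] := eqVneq z c; first by rewrite fc subrr mul0r.
  by rewrite mulrC divfK // subr_eq0.
suff X z : exists l, cdv g z l by have [g1 Hg1] := choice X; exists g, g1.
have [h [h1 [Hh Eh]]] := hol_div (ent_hol c (nm (z - c) + 1) H) fc.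
have zr : nm (z - c) < nm (z - c) + 1 by lra.
have cr : nm (c - c) < nm (z - c) + 1 by rewrite subrr nm0; have := nm_ge0 (z - c); lra.
exists (h1 z); have := Hh z zr; have -> // : h = g.
apply/funext => w; have [->|wc] := eqVneq w c; last first.
  have w0 : w - c != 0 by rewrite subr_eq0.
  by apply: (mulfI w0); rewrite -E -Eh.
rewrite /g eqxx; have H2 := ddvM (ddvB (cdv_id c) (cdv_cst c c)) (Hh c cr).
have := cdv_unique (ddv_ext H2 (fun y => esym (Eh y))) (H c).
by rewrite subr0 mul1r subrr mul0r addr0.
Qed.

Lemma schwarz f f1 (c : R[i]) (r : R) : 0 < r -> hol f f1 c r -> f c = 0 ->
  (forall z, nm (z - c) < r -> nm (f z) <= 1) ->
  forall z, nm (z - c) < r -> nm (f z) <= nm (z - c) / r.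
Proof.
move=> r0 H fc H1 z zr; have [g [g1 [Hg E]]] := hol_div H fc.
rewrite ler_pdivlMr //; have f0 := nm_ge0 (f z).
apply: (@le_eps _ _ _ (nm (f z))) => // e e0.
pose rho := Num.max (r - e) ((nm (z - c) + r) / 2).
have rr : rho < r by rewrite gt_max; apply/andP; split; lra.
have zrho : nm (z - c) < rho by rewrite lt_max; apply/orP; right; lra.
have re : r <= rho + e by have : r - e <= rho by [rewrite le_max lexx]; lra.
have rho0 : 0 < rho by apply: le_lt_trans zrho; exact: nm_ge0.
have B : nm (g z) <= 1 / rho.
  apply: (max_principle Hg rho0 rr) => // w wr; rewrite ler_pdivlMr //.
  by have := H1 w; rewrite E nmM wr mulrC; apply.
have Hf : nm (f z) * rho <= nm (z - c).
  rewrite E nmM; move: B; rewrite ler_pdivlMr // => B.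
  by rewrite -mulrA -[leRHS]mulr1 ler_wpM2l ?nm_ge0.
have : nm (f z) * r <= nm (f z) * (rho + e) by rewrite ler_wpM2l.
by rewrite mulrDr (mulrC _ e); lra.
Qed.

(** If every power of z - c divided f, the maximum principle for the quotients on a circle of radius
    r > |p - c| would give |f p| <= B (|p - c|/r)^m for all m. *)
Lemma zero_order f f1 p (c : R[i]) : ent f f1 -> f p != 0 ->
  exists m g g1, [/\ ent g g1, forall z, f z = (z - c) ^+ m * g z & g c != 0].
Proof.
move=> H fp; apply: contrapT => no.
have X m : exists g g1, ent g g1 /\ forall z, f z = (z - c) ^+ m * g z.
  elim: m => [|m [g [g1 [Hg E]]]]; first by exists f, f1; split=> // z; rewrite expr0 mul1r.
  have gc : g c = 0.
    by apply: contrapT => /eqP gc; apply: no; exists m, g, g1.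
  have [h [h1 [Hh Eh]]] := ent_div Hg gc; exists h, h1; split=> // z.
  by rewrite E Eh mulrA exprSr.
have r0 : 0 < nm (p - c) + 1 by have := nm_ge0 (p - c); lra.
have rr : nm (p - c) + 1 < nm (p - c) + 2 by lra.
have [B B0 HB] := hol_bound (hol_shift (ent_hol c (nm (p - c) + 2) H)) rr.
set r := nm (p - c) + 1 in r0 rr HB.
have q01 : 0 <= nm (p - c) / r < 1.
  by apply: ratio01 => //; rewrite /r ltrDl.
have P m : nm (f p) <= B * (nm (p - c) / r) ^+ m.
  have [g [g1 [Hg E]]] := X m.
  have : nm (g p) <= B / r ^+ m.
    apply: (max_principle (ent_hol c (nm (p - c) + 2) Hg) r0 rr); last by rewrite /r ltrDl.
    move=> z zr; rewrite ler_pdivlMr ?exprn_gt0 //.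
    have := HB (z - c); rewrite zr lexx addrC subrK E nmM nmX zr mulrC; exact.
  move=> Hp; rewrite E nmM nmX expr_div_n mulrCA; apply: ler_wpM2l => //.
  by rewrite exprn_ge0 ?nm_ge0.
move: fp; rewrite -nm_gt0 => fp.
have [n0 Hn] := geo_small q01 B0 fp.
by have := lt_le_trans (Hn n0 (leqnn _)) (P n0); rewrite ltxx.
Qed.

Lemma ent_cont f f1 z (e : R) : ent f f1 -> 0 < e -> exists2 d : R, 0 < d & forall w, nm (w - z) < d -> nm (f w - f z) < e.
Proof. by move=> H e0; exact: (ddv_cntg (H z) e0). Qed.

Lemma ent_neq0_near f f1 z : ent f f1 -> f z != 0 -> exists2 d : R, 0 < d & forall w, nm (w - z) < d -> f w != 0.
Proof.
move=> H; rewrite -nm_gt0 => fz; have [d d0 Hd] := ent_cont z H fz; exists d => // w /Hd.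
by rewrite -nm_gt0; have := nm_tri (f z) (f w) 0; rewrite !subr0 nmC; lra.
Qed.

Lemma isolated_zero f f1 p c : ent f f1 -> f p != 0 ->
  exists2 d : R, 0 < d & forall z, z != c -> nm (z - c) < d -> f z != 0.
Proof.
move=> H fp; have [m [g [g1 [Hg E gc]]]] := zero_order c H fp.
have [d d0 Hd] := ent_neq0_near Hg gc; exists d => // z zc zd.
by rewrite E mulf_neq0 ?Hd // expf_neq0 // subr_eq0.
Qed.

Lemma ent_identity f f1 c (d : R) : ent f f1 -> 0 < d -> (forall z, nm (z - c) < d -> f z = 0) -> forall z, f z = 0.
Proof.
move=> H d0 H0 p; apply/eqP; apply: contrapT => /negP fp.
have [d' d'0 Hd] := isolated_zero c H fp.
pose t := Num.min d d' / 2.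
have m0 : 0 < Num.min d d' by rewrite lt_min d0.
have t0 : 0 < t by rewrite divr_gt0.
have : t < Num.min d d' by rewrite /t; move: (Num.min d d') m0 => x x0; lra.
rewrite lt_min => /andP[td td'].
have n : nm (c + t%:C - c) = t by rewrite addrC addKr nmR gtr0_norm.
have tc : c + t%:C != c by rewrite -subr_eq0 -nm_eq0 n gt_eqF.
by have := Hd _ tc; rewrite n => /(_ td'); rewrite H0 ?n // eqxx.
Qed.

Lemma ent_mul0 f f1 g g1 : ent f f1 -> ent g g1 -> (forall z, f z * g z = 0) ->
  (forall z, f z = 0) \/ (forall z, g z = 0).
Proof.
move=> Hf Hg H; have [|no] := pselect (exists p, f p != 0); last first.
  by left=> z; apply/eqP; apply: contrapT => /negP fz; apply: no; exists z.
move=> [p fp]; right; have [d d0 Hd] := ent_neq0_near Hf fp.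
apply: (ent_identity Hg d0 (c := p)) => z /Hd fz.
by have /eqP := H z; rewrite mulf_eq0 (negbTE fz) => /eqP.
Qed.

End Division.

(** * Logarithmic derivatives *)

Section Pommerenke.
Variable R : realType.
Implicit Types (f g q : R[i] -> R[i]).

(** Harnack's lower bound: x and y are real parts of two points of the right half-plane and d the
    difference of imaginary parts. If their Cayley quotient has modulus at most 1 - h, then x >= y
    h/(2 - h). *)
Lemma cayley_lower (x y d h : R) : 0 < x -> 0 < y -> 0 < h -> h <= 1 ->
  (x - y) ^+ 2 + d ^+ 2 <= (1 - h) ^+ 2 * ((x + y) ^+ 2 + d ^+ 2) -> y * (h / 2) <= x.
Proof.
move=> x0 y0 h0 h1 H.
have D : 0 <= d ^+ 2 * (1 - (1 - h) ^+ 2).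
  by apply: mulr_ge0; [exact: sqr_ge0|rewrite subr_ge0 expr_le1 //; lra].
have {D}H : (x - y) ^+ 2 <= ((1 - h) * (x + y)) ^+ 2 by rewrite exprMn; lra.
have {}H : y - x <= (1 - h) * (x + y).
  apply: le_trans (ler_norm _) _; rewrite distrC -(ger0_norm (_ : 0 <= (1 - h) * (x + y))).
    by rewrite -ler_sqr ?nnegrE // !real_normK ?num_real.
  by rewrite mulr_ge0 ?subr_ge0 // addr_ge0 // ltW.
have := mulr_gt0 h0 x0; have := mulr_gt0 h0 y0; lra.
Qed.

(* Harnack and Hopf for the positive harmonic function -log|q|, through the Cayley
   transform and Schwarz's lemma. *)
Lemma hopf_log_deriv q q1 (c zs l : R[i]) (r : R) : 0 < r -> hol q q1 c r ->
  (forall z, nm (z - c) < r -> q z != 0) -> (forall z, nm (z - c) < r -> nm (q z) < 1) ->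
  nm (zs - c) = r -> nm (q zs) = 1 -> cdv q zs l -> nm (q1 c) <= 4 * nm l * nm (q c).
Proof.
move=> r0 Hq q0 ql zsr qzs Hl; have [L HL EL] := hol_log r0 Hq q0.
have cc : nm (c - c) < r by rewrite subrr nm0.
pose a z := - complex.Re (L z).
have nq z : nm (z - c) < r -> nm (q z) = expR (- a z) by move=> zr; rewrite EL // nm_expC opprK.
have a0 z : nm (z - c) < r -> 0 < a z.
  by move=> zr; have := ql z zr; rewrite nq // -expR0 ltr_expR oppr_lt0.
pose K := a c; have K0 : 0 < K := a0 c cc.
(* The Cayley transform taking the half-plane of positive real part, where [- L] has its values, to
   the unit disc and [- L c] to 0. *)
pose S z := (- L z + L c) / (- L z - conjc (L c)).
have den z : nm (z - c) < r -> - L z - conjc (L c) != 0.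
  move=> zr; have := a0 z zr; have := a0 c cc; rewrite /a.
  case: (L z) (L c) => x y [x' y'] /= h1 h2; rewrite eq_complex /= negb_and.
  by apply/orP; left; lra.
have HS : hol S (fun z => (- (q1 z / q z) * (- L z - conjc (L c)) - (- L z + L c) * (- (q1 z / q z))) / (- L z - conjc (L c)) ^+ 2) c r.
  move=> z zr; apply: (@ddvf R R[i] id (fun z => - L z + L c) (fun z => - L z - conjc (L c))); first exact: den.
    by apply: ddv_eqd (ddvD (ddvN (HL z zr)) (cdv_cst _ z)) _; rewrite addr0.
  by apply: ddv_eqd (ddvB (ddvN (HL z zr)) (cdv_cst _ z)) _; rewrite subr0.
have S1 z : nm (z - c) < r -> nm (S z) <= 1.
  move=> zr; rewrite nmf ler_pdivrMr ?nm_gt0 ?den // mul1r -ler_sqr ?nnegrE ?nm_ge0 // !nm_sqr.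
  have := a0 z zr; have := a0 c cc; rewrite /a.
  by case: (L z) (L c) => x y [x' y'] /= h1 h2; nra.
have Sc : S c = 0 by rewrite /S addrC subrr mul0r.
have Sch := schwarz r0 HS Sc S1.
have dS : nm (q1 c / q c) <= 2 * K / r.
  have := cauchy_est r0 HS (fun z zr => S1 z zr).
  have E : - L c - conjc (L c) = (2 * K)%:C.
    by rewrite /K /a; case: (L c) => x y /=; apply/eqP; rewrite eq_complex /=; apply/andP; split; apply/eqP; ring.
  rewrite (addrC (- L c) (L c)) subrr mul0r subr0 E expr2 invfM mulrA mulfK; last first.
    by rewrite -nm_eq0 nmR normr_eq0 gt_eqF // mulr_gt0.
  rewrite [nm (- _ / _)]nmf nmN nmR gtr0_norm ?mulr_gt0 // ler_pdivrMr ?mulr_gt0 //.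
  by rewrite mulrAC mul1r mulrC.
have q1c : nm (q1 c) <= 2 * K / r * nm (q c).
  by rewrite -[q1 c](divfK (q0 c cc)) nmM ler_wpM2r ?nm_ge0.
apply: le_trans q1c _; apply: ler_wpM2r; first exact: nm_ge0.
rewrite ler_pdivrMr //.
(* compare with the behaviour of q at zs along the radius *)
have l0 := nm_ge0 l.
suff KK : K <= 2 * nm l * r by lra.
pose B := 2 * r * (nm l + 2).
have B0 : 0 <= B by rewrite /B !mulr_ge0 // ?ltW //; lra.
apply: (@le_eps _ _ _ B) => // e' e'0.
pose e := Num.min e' 1.
have e0 : 0 < e by rewrite lt_min e'0 ltr01.
have e1 : e <= 1 by rewrite ge_min lexx orbT.
have ee : e <= e' by rewrite ge_min lexx.
have [d d0 Hd] := Hl e e0.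
(* The point [z] below lies on the radius to [zs], at distance h r from it. The three bounds give h
   <= 1/2, |z - zs| < d and K h/2 <= e. *)
pose h := Num.min (1 / 2) (Num.min (d / (2 * r)) (2 * e / K)).
have h0 : 0 < h by rewrite !lt_min !divr_gt0 ?mulr_gt0.
have h1 : h <= 1 / 2 by rewrite ge_min lexx.
have hd : h * (2 * r) <= d by rewrite -ler_pdivlMr ?mulr_gt0 // !ge_min lexx orbT.
have hK : h * K <= 2 * e by rewrite -ler_pdivlMr // !ge_min lexx !orbT.
pose z := c + (1 - h)%:C * (zs - c).
have zc : nm (z - c) = (1 - h) * r.
  by rewrite /z addrC addKr nmM zsr nmR ger0_norm //; lra.
have zr : nm (z - c) < r by rewrite zc mulrBl mul1r gtrBl mulr_gt0.
have zzs : z - zs = - (h%:C * (zs - c)) by rewrite /z rmorphB rmorph1; ring.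
have nzzs : nm (z - zs) = h * r by rewrite zzs nmN nmM zsr nmR gtr0_norm.
have zd : nm (z - zs) < d.
  by rewrite nzzs; apply: lt_le_trans hd; have := mulr_gt0 h0 r0; lra.
have Q1 : 1 - (nm l + e) * (h * r) <= nm (q z).
  have := Hd z zd; rewrite /= nzzs => H3.
  have H4 := nmD (q z - q zs - l * (z - zs)) (l * (z - zs)).
  rewrite subrK nmM nzzs in H4.
  have := nm_tri (q zs) (q z) 0; rewrite !subr0 qzs (nmC (q zs)) mulrDl; lra.
have az : K * (h / 2) <= a z.
  have := Sch z zr; rewrite zc mulfK ?gt_eqF // nmf ler_pdivrMr ?nm_gt0 ?den // => H3.
  have h4 : 0 <= 1 - h by lra.
  have H5 : nm (- L z + L c) ^+ 2 <= ((1 - h) * nm (- L z - conjc (L c))) ^+ 2.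
    by rewrite lerXn2r ?nnegrE ?mulr_ge0 ?nm_ge0.
  move: H5; rewrite exprMn !nm_sqr; have := a0 z zr; have := K0; rewrite /K /a.
  case: (L z) (L c) => x y [x' y'] /= h5 h6; rewrite !opprK => H5.
  by apply: (@cayley_lower (- x) (- x') (- y + y')) => //; [lra|rewrite opprK].
have Q2 : nm (q z) * (1 + K * (h / 2)) <= 1.
  rewrite nq //; apply: le_trans (_ : expR (- a z) * expR (a z) <= 1); last by rewrite -expRD addrC subrr expR0.
  apply: ler_wpM2l; first exact: expR_ge0.
  by apply: le_trans (expR_ge1Dx _); rewrite lerD2l.
have kh : 0 < K * (h / 2) by rewrite mulr_gt0 // divr_gt0.
have Q3 : K * (h / 2) <= (nm l + e) * (h * r) * (1 + K * (h / 2)).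
  have : (1 - (nm l + e) * (h * r)) * (1 + K * (h / 2)) <= nm (q z) * (1 + K * (h / 2)).
    by apply: ler_wpM2r => //; lra.
  move: Q2; move: (K * (h / 2)) (nm (q z)) ((nm l + e) * (h * r)) => u v w; lra.
have Q4 : K <= 2 * r * ((nm l + e) * (1 + e)).
  rewrite -(ler_pM2l h0).
  have : (nm l + e) * (h * r) * (1 + K * (h / 2)) <= (nm l + e) * (h * r) * (1 + e).
    by apply: ler_wpM2l; [rewrite !mulr_ge0 ?(ltW h0) ?(ltW r0) //; lra|lra].
  move: Q3; move: (nm l) => x; lra.
apply: le_trans Q4 _; rewrite /B.
have : (nm l + e) * (1 + e) <= nm l + e' * (nm l + 2).
  have X1 : e * nm l <= e' * nm l by rewrite ler_wpM2r.
  have X2 : e * e <= e by rewrite ler_piMl // ltW.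
  move: X1 X2 ee; move: (nm l) => x; lra.
move=> /(ler_wpM2l (_ : 0 <= 2 * r)) H; apply: le_trans (H _) _; first by rewrite mulr_ge0 // ltW.
by rewrite le_eqVlt; apply/orP; left; apply/eqP; ring.
Qed.

End Pommerenke.

Section Pommerenke2.
Variable R : realType.
Implicit Types (f g q : R[i] -> R[i]).

(** The second hypothesis says that P is closed; a minimising sequence is bounded, and its cluster
    point attains the infimum of the distances. *)
Lemma nearest (P : R[i] -> Prop) z0 : (exists z, P z) ->
  (forall z, ~ P z -> exists2 d : R, 0 < d & forall w, nm (w - z) < d -> ~ P w) ->
  exists2 zs, P zs & forall w, nm (w - z0) < nm (zs - z0) -> ~ P w.
Proof.
move=> [p Pp] op.
pose D : set R := fun x => exists2 z, P z & x = nm (z - z0).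
have Dne : has_inf D.
  split; first by exists (nm (p - z0)), p.
  by exists 0 => _ [z _ ->]; exact: nm_ge0.
pose m := inf D.
have X (k : nat) : exists z, P z /\ nm (z - z0) < m + k.+1%:R^-1.
  have k0 : (0 : R) < k.+1%:R^-1 by rewrite invr_gt0 ltr0n.
  by have [_ [z Pz ->] zk] := inf_adherent k0 Dne; exists z.
have [u Hu] := choice X.
have [|w _ Hw] := @cluster_pt R (fun k => u k - z0) (m + 1).
  move=> k; apply: le_trans (ltW (Hu k).2) _; rewrite lerD2l invf_le1 ?ltr0n // ler1n //.
have near k0 (e : R) : 0 < e -> exists2 k, (k0 <= k)%N & nm (u k - (z0 + w)) < e.
  by move=> e0; have [k kk H] := Hw k0 e e0; exists k => //; rewrite opprD addrA.
have Pw : P (z0 + w).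
  apply: contrapT => nP; have [d d0 Hd] := op _ nP; have [k _ Hk] := near 0%N d d0.
  exact: Hd Hk (Hu k).1.
exists (z0 + w) => // v vz Pv.
have mv : m <= nm (v - z0) by apply: (ge_inf Dne.2); exists v.
pose e := (nm (z0 + w - z0) - nm (v - z0)) / 2.
have e0 : 0 < e by rewrite /e divr_gt0 // subr_gt0.
have [k kk Hk] := near (Num.bound e^-1) e e0.
have ke : k.+1%:R^-1 < e.
  rewrite -[ltRHS]invrK ltf_pV2 ?posrE ?invr_gt0 ?ltr0n //.
  apply: lt_le_trans (archi_boundP _) _; first by rewrite invr_ge0 ltW.
  by rewrite ler_nat ltnW.
have h1 := (Hu k).2; have h2 := nm_tri (z0 + w) (u k) z0; rewrite (nmC (z0 + w) (u k)) in h2.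
have E : e + e = nm (z0 + w - z0) - nm (v - z0) by rewrite /e; field.
suff : nm (z0 + w - z0) < nm (z0 + w - z0) by rewrite ltxx.
clearbody e m; move: (k.+1%:R^-1) ke h1 => x ke h1; lra.
Qed.

Lemma boundary_le f zs c (l : R[i]) (K : R) : cdv f zs l ->
  (forall w, nm (w - c) < nm (zs - c) -> nm (f w) <= K) -> zs != c -> nm (f zs) <= K.
Proof.
move=> Hf H zc; apply: (@le_eps _ _ _ 1) => // e e0.
have n0 : 0 < nm (zs - c) by rewrite nm_gt0 subr_eq0.
have [d d0 Hd] := ddv_cntg Hf e0.
pose h := Num.min 1 (d / (2 * nm (zs - c))).
have h0 : 0 < h by rewrite lt_min ltr01 divr_gt0 // mulr_gt0.
have h1 : h <= 1 by rewrite ge_min lexx.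
have hd : h * (2 * nm (zs - c)) <= d by rewrite -ler_pdivlMr ?mulr_gt0 // ge_min lexx orbT.
pose z := c + (1 - h)%:C * (zs - c).
have zin : nm (z - c) < nm (zs - c).
  rewrite /z addrC addKr nmM nmR ger0_norm ?subr_ge0 // mulrBl mul1r gtrBl mulr_gt0 //.
have zd : nm (z - zs) < d.
  have -> : z - zs = - (h%:C * (zs - c)) by rewrite /z rmorphB rmorph1; ring.
  rewrite nmN nmM nmR gtr0_norm //; apply: lt_le_trans hd; have := mulr_gt0 h0 n0; lra.
have := Hd z zd; have := H z zin; have := nm_tri (f zs) (f z) 0; rewrite !subr0 (nmC (f zs)); lra.
Qed.

(* Pommerenke's argument: a bound for F' on a level line |F - v| = delta gives a
   bound for the logarithmic derivative of F - v inside, when F omits v nearby. *)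
Lemma log_deriv_inside f f1 (v z0 : R[i]) (delta M : R) : ent f f1 -> 0 < delta ->
  nm (f z0 - v) < delta -> (exists p, delta <= nm (f p - v)) ->
  (forall z, nm (f z - v) = delta -> nm (f1 z) <= M) ->
  (forall z, (forall w, nm (w - z0) <= nm (z - z0) -> nm (f w - v) < delta) -> f z != v) ->
  nm (f1 z0) <= 4 * (M / delta) * nm (f z0 - v).
Proof.
move=> H d0 fz0 ex HM fv.
have Hc z : cdv (fun w => f w - v) z (f1 z).
  by apply: ddv_eqd (ddvB (H z) (cdv_cst v z)) _; rewrite subr0.
have [zs dzs Hzs] : exists2 zs, delta <= nm (f zs - v) & forall w, nm (w - z0) < nm (zs - z0) -> ~ (delta <= nm (f w - v)).
  apply: (@nearest (fun z => delta <= nm (f z - v))) => // z /negP; rewrite -ltNge => fz.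
  have e0 : 0 < delta - nm (f z - v) by rewrite subr_gt0.
  have [d dd Hd] := ddv_cntg (Hc z) e0; exists d => // w /Hd Hw; apply/negP; rewrite -ltNge.
  by have := nm_sub (f w - v) (f z - v); lra.
have zsz0 : zs != z0 by apply: contraTneq dzs => ->; rewrite -ltNge.
have r0 : 0 < nm (zs - z0) by rewrite nm_gt0 subr_eq0.
have ins w : nm (w - z0) < nm (zs - z0) -> nm (f w - v) < delta by move=> /Hzs /negP; rewrite -ltNge.
have zsd : nm (f zs - v) = delta.
  apply/eqP; rewrite eq_le dzs andbT.
  by apply: (@boundary_le (fun w => f w - v) zs z0 _ _ (Hc zs)) => // w /ins /ltW.
have nd : nm (delta%:C : R[i]) = delta by rewrite nmR gtr0_norm.
have dn0 : delta%:C != 0 :> R[i] by rewrite -nm_eq0 nd gt_eqF.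
have Hq z : cdv (fun w => (delta%:C)^-1 * (f w - v)) z ((delta%:C)^-1 * f1 z) by exact: ddvZ.
have := @hopf_log_deriv R (fun w => (delta%:C)^-1 * (f w - v)) (fun z => (delta%:C)^-1 * f1 z) z0 zs _ _ r0 (ent_hol _ _ Hq) _ _ erefl _ (Hq zs).
have nq x : nm ((delta%:C)^-1 * x) = nm x / delta by rewrite nmM nmV nd mulrC.
rewrite !nq zsd divff ?gt_eqF // => /(_ _ _ erefl) HH.
have : nm (f1 z0) / delta <= 4 * (nm (f1 zs) / delta) * (nm (f z0 - v) / delta).
  apply: HH => z zr; last by rewrite nq ltr_pdivrMr // mul1r; exact: ins.
  rewrite mulf_neq0 ?invr_eq0 // subr_eq0; apply: fv => w wz; apply: ins; exact: le_lt_trans zr.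
have di : 0 < delta^-1 by rewrite invr_gt0.
move=> H3; rewrite -(ler_pM2r di) -[leRHS]mulrA; apply: le_trans H3 _; apply: ler_wpM2r.
  by rewrite divr_ge0 ?nm_ge0 // ltW.
by apply: ler_wpM2l => //; apply: ler_wpM2r; [rewrite invr_ge0 ltW|exact: HM].
Qed.

(** The Hopf estimate for K/f, which has no zero and modulus less than 1 on the largest disc about
    z0 where |f| > K. The first level point met is no farther from z0 than p, which localises the
    bound needed on f1. *)
Lemma log_deriv_outside f f1 (z0 p : R[i]) (K M : R) : ent f f1 -> 0 < K ->
  K < nm (f z0) -> nm (f p) <= K ->
  (forall z, nm (f z) = K -> nm (z - z0) <= nm (p - z0) -> nm (f1 z) <= M) ->
  nm (f1 z0) <= 4 * (M / K) * nm (f z0).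
Proof.
move=> H K0 fz0 fp HM.
have [zs dzs Hzs] : exists2 zs, nm (f zs) <= K & forall w, nm (w - z0) < nm (zs - z0) -> ~ (nm (f w) <= K).
  apply: (@nearest (fun z => nm (f z) <= K)); first by exists p.
  move=> z /negP; rewrite -ltNge => fz.
  have e0 : 0 < nm (f z) - K by rewrite subr_gt0.
  have [d dd Hd] := ddv_cntg (H z) e0; exists d => // w /Hd Hw; apply/negP; rewrite -ltNge.
  by have := nm_sub (f z) (f w); rewrite nmC; lra.
have zsz0 : zs != z0 by apply: contraTneq dzs => ->; rewrite -ltNge.
have r0 : 0 < nm (zs - z0) by rewrite nm_gt0 subr_eq0.
have ins w : nm (w - z0) < nm (zs - z0) -> K < nm (f w) by move=> /Hzs /negP; rewrite -ltNge.
have nK : nm (K%:C : R[i]) = K by rewrite nmR gtr0_norm.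
have fn0 x : K <= nm (f x) -> f x != 0 by move=> h; rewrite -nm_gt0; exact: lt_le_trans h.
have Kn0 : K%:C != 0 :> R[i] by rewrite -nm_eq0 nK gt_eqF.
have Hq z : f z != 0 -> cdv (fun w => K%:C / f w) z (- (K%:C * f1 z) / f z ^+ 2).
  by move=> fz; apply: ddv_eqd (ddvf fz (cdv_cst K%:C z) (H z)) _; rewrite mul0r sub0r.
have zsK : nm (f zs) = K.
  apply/eqP; rewrite eq_le dzs /= leNgt; apply/negP => lt.
  have e0 : 0 < K - nm (f zs) by rewrite subr_gt0.
  have [d d0 Hd] := ddv_cntg (H zs) e0.
  pose h := Num.min (1 / 2) (d / (2 * nm (zs - z0))).
  have h0 : 0 < h by rewrite lt_min !divr_gt0 // mulr_gt0.
  have h1 : h <= 1 / 2 by rewrite ge_min lexx.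
  have hd : h * (2 * nm (zs - z0)) <= d by rewrite -ler_pdivlMr ?mulr_gt0 // ge_min lexx orbT.
  pose z := z0 + (1 - h)%:C * (zs - z0).
  have zin : nm (z - z0) < nm (zs - z0).
    rewrite /z addrC addKr nmM nmR ger0_norm ?mulrBl ?mul1r ?gtrBl ?mulr_gt0 //; lra.
  have zd : nm (z - zs) < d.
    have -> : z - zs = - (h%:C * (zs - z0)) by rewrite /z rmorphB rmorph1; ring.
    rewrite nmN nmM nmR gtr0_norm //; apply: lt_le_trans hd; have := mulr_gt0 h0 r0; lra.
  by have := Hd z zd; have := ins z zin; have := nm_sub (f z) (f zs); lra.
have hq : hol (fun w => K%:C / f w) (fun z => - (K%:C * f1 z) / f z ^+ 2) z0 (nm (zs - z0)).
  by move=> z zr; apply: Hq; apply: fn0; exact: ltW (ins z zr).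
have zsn0 : f zs != 0 by apply: fn0; rewrite zsK.
have := @hopf_log_deriv R (fun w => K%:C / f w) (fun z => - (K%:C * f1 z) / f z ^+ 2) z0 zs _ _ r0 hq _ _ erefl _ (Hq zs zsn0).
rewrite !nmf !nmX !nmN !nmM nK zsK divff ?gt_eqF //.
have F0 : 0 < nm (f z0) by exact: lt_trans fz0.
move=> HH; have {HH} : K * nm (f1 z0) / nm (f z0) ^+ 2 <= 4 * (K * nm (f1 zs) / K ^+ 2) * (K / nm (f z0)).
  apply: HH => // z zr; first by rewrite mulf_neq0 ?invr_eq0 // fn0 // ltW // ins.
  by rewrite nmf nK ltr_pdivrMr ?mul1r ?ins // (lt_trans K0) // ins.
have zsM : nm (f1 zs) <= M.
  apply: HM => //; rewrite leNgt; apply/negP => lt; by have := ins p lt; rewrite ltNge fp.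
rewrite ler_pdivrMr ?exprn_gt0 // => HH.
rewrite -(ler_pM2l K0); apply: le_trans HH _.
have -> : 4 * (K * nm (f1 zs) / K ^+ 2) * (K / nm (f z0)) * nm (f z0) ^+ 2 = K * (4 * (nm (f1 zs) / K) * nm (f z0)).
  by field; rewrite !gt_eqF.
apply: ler_wpM2l; first exact: ltW.
apply: ler_wpM2r; first exact: ltW.
by apply: ler_wpM2l => //; apply: ler_wpM2r; [rewrite invr_ge0 ltW|exact: zsM].
Qed.

(** The entire function f1/(f - v) is bounded, where |f - v| < 1 by [log_deriv_inside] and elsewhere
    by the growth hypothesis, so it is constant. If |f - v| < 1 everywhere, f itself is constant and
    [al] is 0. *)
Lemma omit_ode f f1 v (C : R) : ent f f1 -> (forall z, nm (f1 z) <= C * (1 + nm (f z))) ->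
  (forall z, f z != v) -> exists al, forall z, f1 z = al * (f z - v).
Proof.
move=> H HC fv.
have C0 : 0 <= C.
  have := le_trans (nm_ge0 _) (HC 0); rewrite pmulr_lge0 //.
  by have := nm_ge0 (f 0); lra.
have fv0 z : f z - v != 0 by rewrite subr_eq0.
have [ex|no] := pselect (exists p, 1 <= nm (f p - v)); last first.
  exists 0 => z; rewrite mul0r; apply: (liouville (B := 1 + nm v) H) => w.
  have : nm (f w - v) < 1 by rewrite ltNge; apply/negP => h; apply: no; exists w.
  by have := nmD (f w - v) v; rewrite subrK; lra.
have [f2 H2] := ent_deriv H.
pose B := C * (2 + nm v).
have nv := nm_ge0 v.
have B0 : 0 <= B by rewrite mulr_ge0 //; lra.
have HB z : nm (f z - v) <= 1 -> nm (f1 z) <= B.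
  move=> h; apply: le_trans (HC z) _; apply: ler_wpM2l => //.
  by have := nmD (f z - v) v; rewrite subrK; lra.
have Ht z : cdv (fun w => f1 w / (f w - v)) z ((f2 z * (f z - v) - f1 z * f1 z) / (f z - v) ^+ 2).
  apply: (@ddvf R R[i] id f1 (fun w => f w - v)) => //.
  by apply: ddv_eqd (ddvB (H z) (cdv_cst v z)) _; rewrite subr0.
have bt z : nm (f1 z / (f z - v)) <= 4 * B.
  have n0 : 0 < nm (f z - v) by rewrite nm_gt0.
  rewrite nmf ler_pdivrMr //.
  have [h|h] := ltP (nm (f z - v)) 1.
    have := @log_deriv_inside f f1 v z 1 B H ltr01 h ex; rewrite divr1; apply => //.
    by move=> w hw; apply: HB; rewrite hw.
  apply: le_trans (HC z) _; have : nm (f z) <= nm (f z - v) + nm v.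
    by have := nmD (f z - v) v; rewrite subrK.
  move=> h2; have h3 : 1 + nm (f z) <= (2 + nm v) * nm (f z - v).
    have : nm v * 1 <= nm v * nm (f z - v) by rewrite ler_wpM2l.
    lra.
  apply: le_trans (ler_wpM2l C0 h3) _; rewrite mulrA -/B.
  by have := mulr_ge0 B0 (ltW n0); lra.
have t0 := ent_const (fun z => ddv_eqd (Ht z) (liouville Ht bt z)).
exists (f1 0 / (f 0 - v)) => z; rewrite -(t0 z) divfK //.
Qed.

End Pommerenke2.

(** * Growth, normal families and Hurwitz's theorem *)

Section Tools.
Variable R : realType.
Implicit Types (f g : R[i] -> R[i]).

Lemma nonincreasing_Re (F dF : R -> R[i]) (a b : R) : a <= b ->
  (forall t, a <= t <= b -> cdr F t (dF t)) -> (forall t, a <= t <= b -> complex.Re (dF t) <= 0) ->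
  complex.Re (F b) <= complex.Re (F a).
Proof.
move=> ab HF Hk; apply: (@le_eps _ _ _ (b - a)); first by lra.
move=> e e0.
suff : complex.Re (F b - F a) <= e * (b - a) by case: (F a) (F b) => x y [x' y'] /=; lra.
have := @cousin R (fun s s' _ _ => complex.Re (F s' - F s) <= e * (s' - s)) a b 0 0 ab (lexx _).
apply.
  move=> s s' _ _ ss' _ H1 _ H2 _; move: H1 H2.
  by case: (F s) (F s') (F _) => x y [x' y'] [x2 y2] /=; lra.
move=> c c' cab _; have [d d0 Hd] := HF c cab _ e0.
exists d => // s s' _ _ as_ sc cs' s'b _ _ _ _ ss' _.
have X y : nm (y%:C - c%:C) = `|y - c| by rewrite -rmorphB nmR.
have [H1 H2] : nm ((s'%:C : R[i]) - c%:C) < d /\ nm ((s%:C : R[i]) - c%:C) < d.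
  by rewrite !X !ltr_norml; lra.
have Y y : nm (F y - F c - dF c * (y%:C - c%:C)) <= e * `|y - c| ->
    `|complex.Re (F y) - complex.Re (F c) - complex.Re (dF c) * (y - c)| <= e * `|y - c|.
  apply: le_trans; apply: le_trans (nm_Re _).
  by case: (F y) (F c) (dF c) => x1 y1 [x2 y2] [x3 y3] /=; rewrite subr0 mulr0 subr0.
have := Y _ (eq_ind _ (fun u => nm (F s' - F c - dF c * (s'%:C - c%:C)) <= e * u) (Hd _ H1) _ (X s')).
have := Y _ (eq_ind _ (fun u => nm (F s - F c - dF c * (s%:C - c%:C)) <= e * u) (Hd _ H2) _ (X s)).
have -> : complex.Re (F s' - F s) = complex.Re (F s') - complex.Re (F s) by case: (F s) (F s') => ? ? [].
rewrite (ger0_norm (_ : 0 <= s' - c)) ?subr_ge0 // (ler0_norm (_ : s - c <= 0)) ?subr_le0 //.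
rewrite !ler_norml => /andP[A1 A2] /andP[B1 B2].
have N := Hk c cab.
have : complex.Re (dF c) * (s' - s) <= 0 by rewrite mulr_le0_ge0 //; lra.
lra.
Qed.

Lemma nm_conj (z : R[i]) : nm (conjc z) = nm z.
Proof. by case: z => x y /=; rewrite sqrrN. Qed.

Lemma cdr_conj (F : R -> R[i]) t l : cdr F t l -> cdr (fun s => conjc (F s)) t (conjc l).
Proof.
move=> H e e0; have [d d0 Hd] := H e e0; exists d => // y /Hd.
rewrite -[nm (F y - _ - _)]nm_conj; congr (nm _ <= _).
case: (F y) (F t) (l) => x1 y1 [x2 y2] [x3 y3] /=; apply/eqP; rewrite eq_complex /=.
by apply/andP; split; apply/eqP; ring.
Qed.

(** Along the segment from c to z, 1 + |f|^2 is differentiable, unlike |f|, and 2 x (1 + x) <= 4 (1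
    + x^2) bounds its growth rate by k = 4 C |z - c|. *)
Lemma gronwall f f1 c (L C : R) z : hol f f1 c L -> 0 <= C ->
  (forall w, nm (w - c) < L -> nm (f1 w) <= C * (1 + nm (f w))) -> nm (z - c) < L ->
  nm (f z) ^+ 2 <= (1 + nm (f c) ^+ 2) * expR (4 * C * nm (z - c)).
Proof.
move=> H C0 HC zL; pose n := nm (z - c); have n0 : 0 <= n by exact: nm_ge0.
pose u (t : R) : R[i] := c + t%:C * (z - c).
have cu t : cdr u t (z - c).
  have := ddvD (ddv_cst (real_complex R) c t) (ddvM (ddv_io (real_complex R) t) (ddv_cst _ (z - c) t)).
  by move=> H1; apply: ddv_eqd H1 _; ring.
have uin t : 0 <= t <= 1 -> nm (u t - c) < L.
  move=> /andP[t0 t1]; rewrite /u addrC addKr nmM nmR ger0_norm //; apply: le_lt_trans zL.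
  by rewrite ler_piMl ?nm_ge0.
pose k := 4 * C * n.
pose E (t : R) : R[i] := (expR (- k * t))%:C.
have cE t : cdr E t (- k%:C * E t).
  have H1 : cdr (fun t => (- k)%:C * t%:C) t (- k)%:C.
    by apply: ddv_eqd (ddvZ (- k)%:C (ddv_io (real_complex R) t)) _; rewrite mulr1.
  have EE : E = (fun s => expC ((- k)%:C * s%:C)).
    by apply/funext => s; rewrite /E -rmorphM /expC /= cos0 sin0 (_ : 1 +i* 0 = 1) // mulr1.
  rewrite EE -rmorphN (mulrC (- k)%:C).
  exact: (@ddv_comp R R (real_complex R) (@expC R) (fun t => (- k)%:C * t%:C) t _ _ (cdv_expC _) H1).
pose v t := 1 + f (u t) * conjc (f (u t)).
have cf t : 0 <= t <= 1 -> cdr (fun t => f (u t)) t (f1 (u t) * (z - c)).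
  by move=> tt; apply: (@ddv_comp R R (real_complex R) f u) (cu t); apply: H; exact: uin.
have cv t : 0 <= t <= 1 -> cdr (fun t => v t * E t) t
   ((f1 (u t) * (z - c) * conjc (f (u t)) + f (u t) * conjc (f1 (u t) * (z - c))) * E t + v t * (- k%:C * E t)).
  move=> tt; apply: ddvM (cE t).
  apply: ddv_eqd (ddvD (ddv_cst _ 1 t) (ddvM (cf t tt) (cdr_conj (cf t tt)))) _; rewrite add0r //.
have Rv t : v t = (1 + nm (f (u t)) ^+ 2)%:C.
  rewrite /v nm_sqr; case: (f (u t)) => x y /=; apply/eqP; rewrite eq_complex /=.
  by apply/andP; split; apply/eqP; ring.
have := @nonincreasing_Re (fun t => v t * E t) _ 0 1 ler01 cv.
have -> : complex.Re (v 1 * E 1) = (1 + nm (f z) ^+ 2) * expR (- k).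
  have u1 : u 1 = z by rewrite /u rmorph1 mul1r addrC subrK.
  by rewrite Rv /E mulr1 -rmorphM u1.
have -> : complex.Re (v 0 * E 0) = 1 + nm (f c) ^+ 2.
  have u0 : u 0 = c by rewrite /u rmorph0 mul0r addr0.
  by rewrite Rv /E mulr0 expR0 -rmorphM u0 mulr1.
move=> /(_ _) HH; have {HH} : (1 + nm (f z) ^+ 2) * expR (- k) <= 1 + nm (f c) ^+ 2.
  apply: HH => t tt; rewrite Rv /E.
  set p := f1 (u t) * (z - c); set q := f (u t); set ex := expR _.
  have -> : complex.Re ((p * conjc q + q * conjc p) * ex%:C + (1 + nm q ^+ 2)%:C * (- k%:C * ex%:C))
      = (complex.Re (p * conjc q) * 2 - k * (1 + nm q ^+ 2)) * ex.
    by case: p q => x y [x' y'] /=; rewrite !mulr0 ?mul0r; ring.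
  apply: mulr_le0_ge0; last exact: expR_ge0.
  have h1 : complex.Re (p * conjc q) <= nm p * nm q.
    by rewrite -(nm_conj q) -nmM; apply: le_trans (nm_Re _); exact: ler_norm.
  have h2 : nm p <= C * (1 + nm q) * n by rewrite nmM ler_wpM2r ?nm_ge0 // HC // uin.
  have q0 := nm_ge0 q.
  have h3 : nm p * nm q <= C * (1 + nm q) * n * nm q by rewrite ler_wpM2r.
  have h4 : C * n * ((1 + nm q) * nm q * 2) <= C * n * (4 * (1 + nm q ^+ 2)).
    by apply: ler_wpM2l; [exact: mulr_ge0|have := sqr_ge0 (nm q - 1); move: (nm q) q0 => x x0; nra].
  by rewrite /k; lra.
rewrite expRN ler_pdivrMr ?expR_gt0 // => HH; apply: le_trans HH; lra.
Qed.

Lemma ode_sol f f1 (al v : R[i]) : ent f f1 -> (forall z, f1 z = al * (f z - v)) ->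
  forall z, f z = v + (f 0 - v) * expC (al * z).
Proof.
move=> H E z.
have D w : cdv (fun w => (f w - v) * expC (- al * w)) w 0.
  have H1 : cdv (fun w => - al * w) w (- al).
    by apply: ddv_eqd (ddvZ (- al) (cdv_id w)) _; rewrite mulr1.
  have H2 := @ddv_comp R R[i] id (@expC R) (fun w => - al * w) w _ _ (cdv_expC _) H1.
  apply: ddv_eqd (ddvM (ddvB (H w) (cdv_cst v w)) H2) _; rewrite E; ring.
have := ent_const D z; rewrite mulr0 expC0 mulr1 mulNr expCN => <-.
by rewrite divfK ?expC_neq0 // addrC subrK.
Qed.

Lemma ode_takes f f1 (al v u : R[i]) : ent f f1 -> (forall z, f1 z = al * (f z - v)) ->
  al != 0 -> f 0 != v -> u != v -> exists z, f z = u.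
Proof.
move=> H E al0 f0 uv.
have f0' : f 0 - v != 0 by rewrite subr_eq0.
have [|w Hw] := @expC_surj R ((u - v) / (f 0 - v)).
  by rewrite mulf_neq0 ?invr_eq0 // subr_eq0.
exists (w / al); rewrite (ode_sol H E) (mulrC al) divfK // Hw (mulrC (f 0 - v)) divfK //.
by rewrite addrC subrK.
Qed.

(** On a small circle |H| >= mu, hence |K| >= 3/4 mu. If K had no zero in the disc, the maximum
    principle for 1/K would carry this bound to z0, where |K| < mu/4. The tolerance depends on H
    alone, which suits sequences. *)
Lemma hurwitz H H1 z0 p (s : R) : ent H H1 -> H p != 0 -> H z0 = 0 -> 0 < s ->
  exists2 e : R, 0 < e & forall K K1, ent K K1 -> (forall z, nm (z - z0) <= s -> nm (K z - H z) < e) ->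
    exists2 z, nm (z - z0) < s & K z = 0.
Proof.
move=> HH Hp Hz s0; have [m [g [g1 [Hg E gz]]]] := zero_order z0 HH Hp.
have g0 : 0 < nm (g z0) / 2 by rewrite divr_gt0 // nm_gt0.
have [d d0 Hd] := ent_cont z0 Hg g0.
have m0 : 0 < Num.min s d by rewrite lt_min s0.
pose t := Num.min s d / 2.
have t0 : 0 < t by rewrite divr_gt0.
have : t < Num.min s d by rewrite /t; move: (Num.min s d) m0 => x x0; lra.
rewrite lt_min => /andP[ts td].
pose mu := t ^+ m * (nm (g z0) / 2).
have mu0 : 0 < mu by rewrite mulr_gt0 // exprn_gt0.
have low z : nm (z - z0) = t -> mu <= nm (H z).
  move=> zt; rewrite E nmM nmX zt /mu ler_wpM2l ?exprn_ge0 ?(ltW t0) //.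
  have := Hd z; rewrite zt => /(_ td); have := nm_sub (g z0) (g z); rewrite nmC; lra.
exists (mu / 4); first by rewrite divr_gt0.
move=> K K1 HK Hap; apply: contrapT => no.
have K0 z : nm (z - z0) < s -> K z != 0.
  by move=> zs; apply/eqP => Kz; apply: no; exists z.
have hV : hol (fun z => (K z)^-1) (fun z => - K1 z / K z ^+ 2) z0 s.
  by move=> z zs; apply: ddvV; [exact: K0|exact: HK].
have zz : nm (z0 - z0) < t by rewrite subrr nm0.
have := max_principle (B := (3 / 4 * mu)^-1) hV t0 ts _ zz.
have zs : nm (z0 - z0) < s by rewrite subrr nm0.
have mu4 : 0 < 3 / 4 * mu by lra.
have kz := K0 z0 zs.
rewrite nmV lef_pV2 ?posrE ?nm_gt0 // => HM.
have : 3 / 4 * mu <= nm (K z0).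
  apply: HM => z zt; have h1 := low z zt; have h2 : nm (K z - H z) < mu / 4 by apply: Hap; rewrite zt ltW.
  have h3 : 3 / 4 * mu <= nm (K z) by have := nm_sub (H z) (K z); rewrite nmC; lra.
  by rewrite nmV lef_pV2 // posrE // (lt_le_trans mu4).
have := Hap z0 (ltW zs); rewrite Hz subr0; lra.
Qed.

(** The limit is the power series whose coefficients are a cluster point of the coefficient
    sequences. The conclusion speaks of arbitrarily late indices k close to the limit on a given
    disc, so no subsequence has to be extracted. *)
Lemma montel (F F1 : nat -> R[i] -> R[i]) : (forall k, ent (F k) (F1 k)) ->
  (forall rho : R, exists B k0, forall k, (k0 <= k)%N -> forall z, nm z <= rho -> nm (F k z) <= B) ->
  exists G G1, ent G G1 /\ forall (rho e : R) k0, 0 < e ->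
    exists2 k, (k0 <= k)%N & forall z, nm z <= rho -> nm (F k z - G z) < e /\ nm (F1 k z - G1 z) < e.
Proof.
move=> HF HB.
have X k : exists c : nat -> R[i], forall rho B, 0 < rho -> (forall z, nm z = rho -> nm (F k z) <= B) ->
    psrep c rho B (F k).
  have [c1 Hc1] := hol_series (ent_hol 0 2 (HF k)).
  exists c1 => rho B rho0 Hb.
  have [c2 Hc2] := hol_series (ent_hol 0 (rho + 2) (HF k)).
  have r1 : (0 : R) < 1 by []. have r12 : (1 : R) < 2 by rewrite ltr1n.
  have [B1 _ HB1] := hol_bound (ent_hol 0 2 (HF k)) r12.
  have H1 := Hc1 1 B1 r1 r12 (fun z zr => HB1 z (eq_ind_r (fun x => x <= 1) (lexx 1) zr)).
  have H2 := Hc2 rho B rho0 (_ : rho < rho + 2) Hb.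
  have -> : c1 = c2 by apply/funext => n; apply: (psrep_uniq r1 rho0 H1 (H2 _)); lra.
  by apply: H2; lra.
have [s Hs] := choice X.
have [B1 [k1 HB1]] := HB 1.
have Hs1 k n : (k1 <= k)%N -> nm (s k n) <= B1.
  move=> kk; have := (Hs k 1 B1 ltr01 _).1 n; rewrite expr1n mulr1; apply => z zr.
  by apply: HB1 => //; rewrite zr.
(* Real parts sit at even and imaginary parts at odd indices; the shift by [k1] makes the bound [B1]
   valid for every k. *)
pose u k n := if odd n then complex.Im (s (k + k1)%N n./2) else complex.Re (s (k + k1)%N n./2).
have [|c Hc] := @cluster_seq R u B1.
  move=> k n; apply: le_trans (Hs1 (k + k1)%N n./2 (leq_addl _ _)).
  by rewrite /u; case: odd; [exact: nm_Im|exact: nm_Re].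
pose t n := c n.*2 +i* c n.*2.+1.
have near N k0 (e : R) : 0 < e -> exists2 k, (k0 <= k)%N & forall n, (n < N)%N -> nm (s k n - t n) < e.
  move=> e0; have e2 : 0 < e / 2 by lra.
  have [k kk Hk] := Hc N.*2 k0 _ e2; exists (k + k1)%N; first exact: leq_trans (leq_addr _ _).
  move=> n nN; apply: le_lt_trans (nm_ReIm _) _.
  have n1 : (n.*2 < N.*2)%N by rewrite ltn_double.
  have n2 : (n.*2.+1 < N.*2)%N by rewrite ltn_Sdouble.
  have := Hk _ n1; have := Hk _ n2; rewrite /u /= odd_double /= doubleK uphalf_double /t.
  by case: (s _ n) => x y /=; lra.
have Ht rho B k0 : 0 < rho -> (forall k, (k0 <= k)%N -> forall z, nm z <= rho -> nm (F k z) <= B) -> psbound t rho B.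
  move=> r0 Hb n; have rn : 0 <= rho ^+ n by rewrite exprn_ge0 // ltW.
  apply: (@le_eps _ _ _ (rho ^+ n)) => // e e0.
  have [k kk Hk] := near n.+1 k0 e e0.
  have h1 : nm (s k n) * rho ^+ n <= B.
    by apply: (Hs k rho B r0 _).1 => z zr; apply: Hb => //; rewrite zr.
  have h2 := Hk n (ltnSn n).
  have : nm (t n) * rho ^+ n <= (nm (s k n) + e) * rho ^+ n.
    by apply: ler_wpM2r => //; have := nm_sub (t n) (s k n); rewrite nmC; lra.
  by rewrite mulrDl; lra.
have [G HG] := ps_exists t.
have Gd z : exists l, cdv G z l.
  have r0 : 0 < nm z + 2 by have := nm_ge0 z; lra.
  have [B [k0 HB2]] := HB (nm z + 2).
  have Hp := HG _ _ r0 (Ht _ _ _ r0 HB2).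
  have r1 : 0 < nm z + 1 by have := nm_ge0 z; lra.
  have r12 : nm z + 1 < nm z + 2 by lra.
  have [M1 [f1 [_ Hf]]] := ps_deriv r1 r12 Hp.
  by exists (f1 z); apply: Hf; lra.
have [G1 HG1] := choice Gd.
exists G, G1; split=> //.
have approx (rho e : R) k0 : 0 < e -> exists2 k, (k0 <= k)%N & forall z, nm z <= rho -> nm (F k z - G z) < e.
  move=> e0; have [rn|r0] := ltP rho 0.
    by exists k0 => // z zr; have := le_lt_trans (le_trans (nm_ge0 z) zr) rn; rewrite ltxx.
  pose r := rho + 1; have rp : 0 < r by rewrite /r; lra.
  have r2 : 0 < 2 * r by lra.
  have [B [kB HB2]] := HB (2 * r).
  have Hp := HG _ _ r2 (Ht _ _ _ r2 HB2).
  have B0 : 0 <= B by exact: psbound_ge0 Hp.1.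
  have q01 : (0 : R) <= (1 / 2 : R) < 1 by apply/andP; split; lra.
  have e4 : 0 < e / 4 by rewrite divr_gt0.
  have B2 : 0 <= B * 2 by rewrite mulr_ge0.
  have [N HN] := geo_small q01 B2 e4.
  have tail z : nm z <= r -> B * (nm z / (2 * r)) ^+ N / (1 - nm z / (2 * r)) <= e / 4.
    move=> zr; apply: le_trans (ltW (HN N (leqnn _))).
    have q12 : nm z / (2 * r) <= 1 / 2 by rewrite ler_pdivrMr //; lra.
    have q0 : 0 <= nm z / (2 * r) by rewrite divr_ge0 ?nm_ge0 // ltW.
    rewrite ler_pdivrMr ?subr_gt0; last by lra.
    have h1 : (nm z / (2 * r)) ^+ N <= (1 / 2) ^+ N by rewrite lerXn2r // nnegrE; lra.
    have h2 : 0 <= B * (1 / 2) ^+ N by rewrite mulr_ge0 // exprn_ge0 //; lra.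
    apply: le_trans (ler_wpM2l B0 h1) _.
    have -> : B * 2 * (1 / 2) ^+ N * (1 - nm z / (2 * r)) = B * (1 / 2) ^+ N * (2 * (1 - nm z / (2 * r))) by ring.
    by rewrite -[leLHS]mulr1 ler_wpM2l //; lra.
  pose S := \sum_(i < N) r ^+ i.
  have S0 : 0 <= S by apply: sumr_ge0 => i _; rewrite exprn_ge0 // ltW.
  have e5 : 0 < e / 4 / (S + 1) by rewrite divr_gt0 // ltr_wpDl.
  have [k kk Hk] := near N (maxn k0 kB) _ e5.
  have kk0 : (k0 <= k)%N := leq_trans (leq_maxl _ _) kk.
  have kkB : (kB <= k)%N := leq_trans (leq_maxr _ _) kk.
  exists k => // z zr; have zr' : nm z <= r by rewrite /r; lra.
  have zr2 : nm z < 2 * r by rewrite /r; lra.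
  have Fk := Hs k (2 * r) B r2 (fun w wr => HB2 k kkB w (eq_ind_r (fun x => x <= 2 * r) (lexx _) wr)).
  have h1 := le_trans (Fk.2 z zr2 N) (tail z zr').
  have h2 := le_trans (Hp.2 z zr2 N) (tail z zr').
  have h3 : nm (\sum_(i < N) s k i * z ^+ i - \sum_(i < N) t i * z ^+ i) <= e / 4.
    rewrite -sumrB; apply: le_trans (nm_sum _) _.
    apply: le_trans (_ : \sum_(i < N) e / 4 / (S + 1) * r ^+ i <= _).
      apply: ler_sum => i _; rewrite -mulrBl nmM nmX; apply: ler_pM; rewrite ?nm_ge0 ?exprn_ge0 ?nm_ge0 //.
        exact: ltW (Hk i (ltn_ord i)).
      by rewrite lerXn2r ?nnegrE ?nm_ge0 // ltW.
    rewrite -mulr_sumr -/S -mulrA -[leRHS]mulr1; apply: ler_wpM2l; first exact: ltW.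
    by rewrite mulrC ler_pdivrMr ?mul1r ?lerDl // ltr_wpDl.
  have -> : F k z - G z = (F k z - \sum_(i < N) s k i * z ^+ i) + (\sum_(i < N) s k i * z ^+ i - \sum_(i < N) t i * z ^+ i)
     - (G z - \sum_(i < N) t i * z ^+ i) by ring.
  apply: le_lt_trans (nmB _ _) _; apply: le_lt_trans (lerD (nmD _ _) (lexx _)) _.
  apply: le_lt_trans (lerD (lerD h1 h3) h2) _; lra.
move=> rho e k0 e0; have e2 : 0 < e / 2 by lra.
(* The extra 1 in the radius leaves room for Cauchy's estimate on unit discs, which gives the
   closeness of the derivatives. *)
have [k kk Hk] := approx (rho + 1) (e / 2) k0 e2; exists k => // z zr.
split; first by apply: lt_trans (Hk z _) _; lra.
have HD : hol (fun w => F k w - G w) (fun w => F1 k w - G1 w) z 1.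
  by move=> w _; apply: ddvB; [exact: HF|exact: HG1].
have := cauchy_est ltr01 HD (B := e / 2); rewrite divr1 => HE.
apply: le_lt_trans (HE _) _; last by lra.
move=> w wz; apply: ltW; apply: Hk; have := nmD (w - z) z; rewrite subrK; lra.
Qed.

End Tools.

(** * Functions sharing values with their derivative *)

Definition sharing (R : realType) (g g1 : R[i] -> R[i]) (a b : R[i]) :=
  [/\ ent g g1, forall z, g z = a -> g1 z = a, forall z, g z = b -> g1 z = b & forall z, g1 z = b -> g z = b].

Section BoundedDerivative.
Variable R : realType.
Variables (g g1 : R[i] -> R[i]) (a b : R[i]).
Hypothesis Hg : sharing g g1 a b.

(** The point y maximises (1 - |z - p|) |g1 z| up to a factor 2 among the points of the unit disc
    about p where |g| <= 1, and d is its distance to the boundary. Within d/2 of y the weight is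
    still at least d/2, whence the factor 4. *)
Lemma selection (k : R) : 0 < k -> (exists z, nm (g z) <= 1 /\ k < nm (g1 z)) ->
  exists y d, [/\ nm (g y) <= 1, 0 < d, k / 2 < nm (g1 y), k / 2 < d * nm (g1 y) &
    forall z, nm (z - y) <= d / 2 -> nm (g z) <= 1 -> nm (g1 z) <= 4 * nm (g1 y)].
Proof.
move=> k0 [p [gp kp]]; have [He _ _ _] := Hg; have [g2 He2] := ent_deriv He.
have r12 : (1 : R) < 2 by rewrite ltr1n.
have [B B0 HB] := hol_bound (hol_shift (ent_hol p 2 He2)) r12.
pose E : set R := fun x => exists z, [/\ nm (z - p) <= 1, nm (g z) <= 1 & x = (1 - nm (z - p)) * nm (g1 z)].
have E1 : E (nm (g1 p)) by exists p; rewrite subrr nm0 subr0 mul1r.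
have supE : has_sup E.
  split; first by exists (nm (g1 p)).
  exists B => _ [z [zp gz ->]]; have := HB (z - p) zp; rewrite addrC subrK => h.
  by apply: le_trans h; rewrite ler_piMl ?nm_ge0 //; have := nm_ge0 (z - p); lra.
pose s := sup E.
have sp : nm (g1 p) <= s by apply: (ub_le_sup supE.2).
have s2 : 0 < s / 2 by lra.
have [_ [y [yp gy ->]]] := sup_adherent s2 supE; rewrite -/s => ys.
pose d := 1 - nm (y - p); have ny := nm_ge0 (y - p); have n1 := nm_ge0 (g1 y).
have dA : s / 2 < d * nm (g1 y) by rewrite /d; lra.
have d0 : 0 < d.
  rewrite ltNge; apply/negP => dn; have : d * nm (g1 y) <= 0 by rewrite mulr_le0_ge0.
  lra.
have d1 : d <= 1 by rewrite /d; lra.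
have A1 : d * nm (g1 y) <= nm (g1 y) by rewrite ler_piMl.
exists y, d; split=> //; [lra|lra|move=> z zy gz].
have t := nm_tri z y p; have nz := nm_ge0 (z - p).
have dz : d / 2 <= 1 - nm (z - p) by rewrite /d in zy *; lra.
have zp1 : nm (z - p) <= 1 by lra.
have : (1 - nm (z - p)) * nm (g1 z) <= s by apply: (ub_le_sup supE.2); exists z.
have : d / 2 * nm (g1 z) <= (1 - nm (z - p)) * nm (g1 z) by rewrite ler_wpM2r ?nm_ge0.
move=> h1 h2; rewrite -(ler_pM2l d0); lra.
Qed.

(** Where |g| > 1, [log_deriv_outside] applies with y as reference point: the level points concerned
    lie within 2 |z - y| < d/2 of y. Hence the radius d/4 and the constant 16 = 4 * 4. *)
Lemma scaled_bound y d : nm (g y) <= 1 -> 0 < d ->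
  (forall z, nm (z - y) <= d / 2 -> nm (g z) <= 1 -> nm (g1 z) <= 4 * nm (g1 y)) ->
  forall z, nm (z - y) < d / 4 -> nm (g1 z) <= 16 * nm (g1 y) * (1 + nm (g z)).
Proof.
move=> gy d0 H z zy; have [He _ _ _] := Hg.
have A0 := nm_ge0 (g1 y); have gz0 := nm_ge0 (g z).
have P : 0 <= nm (g1 y) * nm (g z) by rewrite mulr_ge0.
have [gz|gz] := leP (nm (g z)) 1.
  have zy2 : nm (z - y) <= d / 2 by lra.
  by apply: le_trans (H z zy2 gz) _; lra.
have := @log_deriv_outside R g g1 z y 1 (4 * nm (g1 y)) He ltr01 gz gy.
rewrite divr1 => /(_ _) h; apply: le_trans (h _) _; last by lra.
move=> w gw wz; apply: H; last by rewrite gw.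
by have := nm_tri w z y; rewrite nmC (nmC y z) in wz *; lra.
Qed.

End BoundedDerivative.

Lemma scale_ent (R : realType) (g g1 : R[i] -> R[i]) (y k : R[i]) : ent g g1 ->
  ent (fun z => g (y + k * z)) (fun z => k * g1 (y + k * z)).
Proof.
move=> H z; have H1 : cdv (fun z => y + k * z) z k.
  by apply: ddv_eqd (ddvD (cdv_cst y z) (ddvZ k (cdv_id z))) _; rewrite add0r mulr1.
by have := @ddv_comp R R[i] id g (fun z => y + k * z) z _ _ (H _) H1; rewrite mulrC.
Qed.

(** The rescaled functions satisfy |F' 0| = 1, so the limit is not constant, and F = v forces F' = v
    / A for v = a, b, with A tending to infinity. Thus both the a-points and the b-points of the
    limit are critical. *)
Lemma bounded_deriv (R : realType) (g g1 : R[i] -> R[i]) (a b : R[i]) : b != a -> sharing g g1 a b ->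
  exists M, forall z, nm (g z) <= 1 -> nm (g1 z) <= M.
Proof.
move=> ab Hg; apply: contrapT => no.
have [He ga gb gb'] := Hg.
have X (k : nat) : exists yd : R[i] * R, [/\ nm (g yd.1) <= 1, 0 < yd.2, k.+1%:R / 2 < nm (g1 yd.1), k.+1%:R / 2 < yd.2 * nm (g1 yd.1) &
    forall z, nm (z - yd.1) <= yd.2 / 2 -> nm (g z) <= 1 -> nm (g1 z) <= 4 * nm (g1 yd.1)].
  have k0 : (0 : R) < k.+1%:R by rewrite ltr0n.
  have [|y [d H]] := selection Hg k0; last by exists (y, d).
  apply: contrapT => no'; apply: no; exists k.+1%:R => z gz; rewrite leNgt; apply/negP => gz1.
  by apply: no'; exists z.
have [yd Hyd] := choice X; pose y k := (yd k).1; pose d k := (yd k).2; pose A k := nm (g1 (y k)).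
have A0 k : 0 < A k by have [_ _ h _ _] := Hyd k; apply: lt_trans h; rewrite divr_gt0 // ltr0n.
pose e k : R[i] := (A k)^-1%:C.
have ne k : nm (e k) = (A k)^-1 by rewrite nmR gtr0_norm // invr_gt0.
have e0 k : e k != 0 by rewrite -nm_eq0 ne invr_eq0 gt_eqF.
pose F k z := g (y k + e k * z); pose F1 k z := e k * g1 (y k + e k * z).
have HF k : ent (F k) (F1 k) by exact: scale_ent.
have bF k z : nm z < k.+1%:R / 8 -> nm (F1 k z) <= 16 * (1 + nm (F k z)).
  move=> zk; have [gy d0 _ dA Hb] := Hyd k.
  have h := @scaled_bound R g g1 a b Hg (y k) (d k) gy d0 Hb (y k + e k * z).
  rewrite /F1 /F nmM ne ler_pdivrMl ?A0 // mulrA (mulrC (A k)); apply: h.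
  rewrite (addrC (y k)) addrK nmM ne mulrC ltr_pdivrMr ?A0 //.
  by rewrite -/(d k) -/(A k) in dA; lra.
have F0 k : nm (F k 0) <= 1 by have [gy _ _ _ _] := Hyd k; rewrite /F mulr0 addr0.
have F10 k : nm (F1 k 0) = 1 by rewrite /F1 mulr0 addr0 nmM ne mulVf // gt_eqF.
(* 64 is 4 * 16 in the Gronwall bound, and 2 comes from |F k 0| <= 1. The discs of radius (k + 1)/8
   exhaust the plane, so the family is locally bounded. *)
have gw k z : nm z < k.+1%:R / 8 -> nm (F k z) ^+ 2 <= 2 * expR (64 * nm z).
  move=> zk; have zk' : nm (z - 0) < k.+1%:R / 8 by rewrite subr0.
  have h16 : (0 : R) <= 16 by [].
  have := @gronwall R (F k) (F1 k) 0 (k.+1%:R / 8) 16 z (ent_hol 0 _ (HF k)) h16.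
  rewrite subr0 => /(_ _ zk) h; apply: le_trans (h _) _.
    by move=> w; rewrite subr0; exact: bF.
  have -> : 4 * 16 * nm z = 64 * nm z by ring.
  apply: ler_wpM2r; first exact: expR_ge0.
  by rewrite -[leRHS]/(1 + 1) lerD2l expr_le1 ?nm_ge0.
have big (rho : R) : exists k0, forall k, (k0 <= k)%N -> rho < k.+1%:R / 8.
  exists (Num.bound (8 * `|rho|)) => k kk.
  have := archi_boundP (_ : 0 <= 8 * `|rho|); rewrite mulr_ge0 // => /(_ isT) h.
  have : (Num.bound (8 * `|rho|))%:R <= k.+1%:R :> R by rewrite ler_nat leqW.
  by have := ler_norm rho; lra.
have [G [G1 [HG ap]]] := montel HF (fun rho => ltac:(
  have [k0 Hk0] := big rho; exists (1 + 2 * expR (64 * rho)), k0 => k kk z zr;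
  have h1 := le_lt_trans zr (Hk0 k kk); have h2 := gw k z h1;
  have h3 : expR (64 * nm z) <= expR (64 * rho) by [rewrite ler_expR; lra];
  have := sqr_ge0 (nm (F k z) - 1); move: (nm (F k z)) h2 => x; nra)).
have [G2 HG2] := ent_deriv HG.
have G10 : G1 0 != 0.
  have h2 : (0 : R) < 1 / 2 by lra.
  have [k _ Hk] := ap 0 (1 / 2) 0%N h2; have [|_ h] := Hk 0; first by rewrite nm0.
  rewrite -nm_gt0; have := nm_sub (F1 k 0) (G1 0); rewrite F10; lra.
have bG z : nm (G1 z) <= 16 * (1 + nm (G z)).
  apply: (@le_eps _ _ _ 17) => // e' e'0; have [k0 Hk0] := big (nm z).
  have [k kk Hk] := ap (nm z) e' k0 e'0; have [h1 h2] := Hk z (lexx _).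
  have h3 := bF k z (Hk0 k kk).
  have := nm_sub (G1 z) (F1 k z); rewrite nmC.
  by have := nm_sub (F k z) (G z); lra.
have kA (m : R) : 0 < m -> exists k0, forall k, (k0 <= k)%N -> nm a / A k < m /\ nm b / A k < m.
  move=> m0; exists (Num.bound ((nm a + nm b) * 2 / m)) => k kk.
  have na := nm_ge0 a; have nb := nm_ge0 b.
  have := archi_boundP (_ : 0 <= (nm a + nm b) * 2 / m); rewrite divr_ge0 ?(ltW m0) //; last by lra.
  move=> /(_ isT) h; have h1 : (Num.bound ((nm a + nm b) * 2 / m))%:R <= k.+1%:R :> R by rewrite ler_nat leqW.
  have [_ _ h2 _ _] := Hyd k; rewrite -/(y k) -/(A k) in h2.
  have h3 : (nm a + nm b) * 2 / m < A k * 2 by lra.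
  rewrite ltr_pdivrMr // in h3; rewrite !ltr_pdivrMr ?A0 //; split; lra.
(* By Hurwitz some late [F k] takes the value v near z, and its derivative [e k * v] there is small.
   If [G1 z] were not 0, three errors each below a third of its modulus would add up to it. *)
have ram v z : (v = a \/ v = b) -> G z = v -> G1 z = 0.
  move=> Hv Gz; apply/eqP; apply: contrapT => /negP n1; rewrite -nm_gt0 in n1.
  have m0 : 0 < nm (G1 z) / 3 by rewrite divr_gt0.
  have [s s0 Hs] := ent_cont z HG2 m0.
  have Hv1 : ent (fun w => G w - v) G1.
    by move=> w; apply: ddv_eqd (ddvB (HG w) (cdv_cst v w)) _; rewrite subr0.
  have [p Gp] : exists p, G p - v != 0.
    apply: contrapT => nop; move: n1; rewrite nm_gt0.
    have -> : G1 z = 0; last by rewrite eqxx.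
    apply: (cdv_unique (Hv1 z)); apply: ddv_ext (cdv_cst 0 z) _ => w.
    by apply/eqP; rewrite eq_sym; apply: contrapT => /negP h; apply: nop; exists w.
  have Gz0 : G z - v = 0 by rewrite Gz subrr.
  have [e1 e10 He1] := hurwitz Hv1 Gp Gz0 s0.
  have m1 : 0 < Num.min e1 (nm (G1 z) / 3) by rewrite lt_min e10.
  have [k0 Hk0] := kA _ m0.
  have [k kk Hk] := ap (nm z + s) _ k0 m1.
  have inb w : nm (w - z) <= s -> nm w <= nm z + s by move=> h; have := nmD (w - z) z; rewrite subrK; lra.
  have HK : ent (fun w => F k w - v) (F1 k).
    by move=> w; apply: ddv_eqd (ddvB (HF k w) (cdv_cst v w)) _; rewrite subr0.
  have [w ws Fw] : exists2 w, nm (w - z) < s & F k w - v = 0.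
    apply: (He1 _ _ HK) => w wz; rewrite opprB addrA subrK.
    by have [h _] := Hk w (inb w wz); apply: lt_le_trans h _; rewrite ge_min lexx.
  have {}Fw : F k w = v by apply/eqP; rewrite -subr_eq0 Fw.
  have F1w : F1 k w = e k * v.
    by rewrite /F1; congr (_ * _); case: Hv Fw => ->; [exact: ga|exact: gb].
  have [_ h1] := Hk w (inb w (ltW ws)); move: h1; rewrite lt_min => /andP[_ h1].
  have h2 := Hs w ws; have [h3 h4] := Hk0 k kk.
  have h5 : nm (F1 k w) < nm (G1 z) / 3.
    by rewrite F1w nmM ne mulrC; case: Hv => ->.
  have h6 := nm_tri (G1 z) (G1 w) (F1 k w); have h7 := nm_sub (G1 z) (F1 k w).
  rewrite (nmC (G1 z) (G1 w)) (nmC (G1 w) (F1 k w)) in h6.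
  suff : nm (G1 z) < nm (G1 z) by rewrite ltxx.
  lra.
(* Hurwitz is applied to the derivatives: [F1 k - e k * b] is close to [G1], and its zeros are
   b-points of g1, hence of g. *)
have crit z : G1 z = 0 -> G z = b.
  move=> G1z; apply/eqP; rewrite -subr_eq0 -nm_eq0 eq_le nm_ge0 andbT.
  apply: (@le_eps _ _ _ 2) => // m m0; rewrite add0r.
  have [s s0 Hs] := ent_cont z HG m0.
  have [e1 e10 He1] := hurwitz HG2 G10 G1z s0.
  have e2 : 0 < e1 / 2 by rewrite divr_gt0.
  have m1 : 0 < Num.min (e1 / 2) m by rewrite lt_min e2.
  have [k0 Hk0] := kA _ e2.
  have [k kk Hk] := ap (nm z + s) _ k0 m1.
  have inb w : nm (w - z) <= s -> nm w <= nm z + s by move=> h; have := nmD (w - z) z; rewrite subrK; lra.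
  have [F2 HF2] := ent_deriv (HF k).
  have HK : ent (fun w => F1 k w - e k * b) F2.
    by move=> w; apply: ddv_eqd (ddvB (HF2 w) (cdv_cst _ w)) _; rewrite subr0.
  have [w ws Fw] : exists2 w, nm (w - z) < s & F1 k w - e k * b = 0.
    apply: (He1 _ _ HK) => w wz; have [_ h] := Hk w (inb w wz).
    move: h; rewrite lt_min => /andP[h _].
    have -> : F1 k w - e k * b - G1 w = (F1 k w - G1 w) - e k * b by ring.
    apply: le_lt_trans (nmB _ _) _; rewrite nmM ne (mulrC _ (nm b)).
    have [_ h2] := Hk0 k kk; lra.
  have Fb : F k w = b.
    apply: gb'; apply: (mulfI (e0 k)); apply/eqP; rewrite -subr_eq0; exact/eqP.
  have [h1 _] := Hk w (inb w (ltW ws)); move: h1; rewrite lt_min Fb => /andP[_ h1].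
  have h2 := Hs w ws; rewrite nmC in h1; rewrite nmC in h2.
  have := nm_tri (G z) (G w) b; lra.
have om z : G z != a.
  by apply/eqP => Gz; move: ab; rewrite -(crit z (ram a z (or_introl erefl) Gz)) Gz eqxx.
have [al Hal] := omit_ode HG bG om.
have al0 : al != 0 by apply: contraNneq G10 => al0; rewrite Hal al0 mul0r.
have [z Gz] := ode_takes HG Hal al0 (om 0) ab.
have := Hal z; rewrite (ram b z (or_intror erefl) Gz) Gz => /eqP; rewrite eq_sym mulf_eq0 (negbTE al0) /=.
by rewrite subr_eq0 (negbTE ab).
Qed.

(** Outside |g| <= 1 the bound spreads from the level line |g| = 1 by [log_deriv_outside]. If |g| >
    1 everywhere, then 1/g is bounded and g' = 0. *)
Lemma linear_growth (R : realType) (g g1 : R[i] -> R[i]) (a b : R[i]) : b != a -> sharing g g1 a b ->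
  exists2 C, 0 <= C & forall z, nm (g1 z) <= C * (1 + nm (g z)).
Proof.
move=> ab Hg; have [He _ _ _] := Hg; have [M HM] := bounded_deriv ab Hg.
have [[p gp]|no] := pselect (exists p, nm (g p) <= 1); last first.
  exists 0 => // z; rewrite mul0r.
  have gt z' : 1 < nm (g z') by rewrite ltNge; apply/negP => h; apply: no; exists z'.
  have g0 z' : g z' != 0 by rewrite -nm_gt0 (lt_trans ltr01).
  have HV : ent (fun z => (g z)^-1) (fun z => - g1 z / g z ^+ 2) by move=> w; apply: ddvV.
  have := liouville (B := 1) HV _ z => /(_ _)/eqP; rewrite mulf_eq0 invr_eq0 expf_eq0 (negbTE (g0 z)) orbF oppr_eq0.
  move=> h; rewrite (eqP (h _)) ?nm0 // => w; rewrite nmV invf_le1 ?(lt_trans ltr01) // ltW //.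
have M0 : 0 <= M by apply: le_trans (HM p gp); exact: nm_ge0.
exists (4 * M); first by rewrite mulr_ge0.
move=> z; have gz0 := nm_ge0 (g z); have P := mulr_ge0 M0 gz0.
have [gz|gz] := leP (nm (g z)) 1; first by apply: le_trans (HM z gz) _; lra.
have := @log_deriv_outside R g g1 z p 1 M He ltr01 gz gp; rewrite divr1 => h.
apply: le_trans (h _) _; last by lra.
by move=> w gw _; apply: HM; rewrite gw.
Qed.

(** * Quotients of entire functions *)

Section Quotients.
Variable R : realType.
Implicit Types (f g P Q : R[i] -> R[i]).

(** The value at each z is that of a local quotient chosen about z. Zeros of Q are isolated, so in a
    punctured neighbourhood every choice equals P/Q, and the glued function coincides with the local
    quotient about z. *)
Lemma quot_glue P P1 Q Q1 p : ent P P1 -> ent Q Q1 -> Q p != 0 ->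
  (forall z, Q z = 0 -> exists q q1 (d : R), [/\ 0 < d, hol q q1 z d & forall w, nm (w - z) < d -> P w = q w * Q w]) ->
  exists f f1, ent f f1 /\ forall z, P z = f z * Q z.
Proof.
move=> HP HQ Qp loc.
have X z : exists qd : (R[i] -> R[i]) * (R[i] * R), 0 < qd.2.2 /\ cdv qd.1 z qd.2.1 /\
    forall w, nm (w - z) < qd.2.2 -> P w = qd.1 w * Q w.
  have [Qz|Qz] := eqVneq (Q z) 0.
    have [q [q1 [d [d0 Hq E]]]] := loc z Qz; exists (q, (q1 z, d)); split=> //; split=> //.
    by apply: Hq; rewrite subrr nm0.
  have [d d0 Hd] := ent_neq0_near HQ Qz.
  exists (fun w => P w / Q w, ((P1 z * Q z - P z * Q1 z) / Q z ^+ 2, d)); split=> //=; split.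
    exact: ddvf.
  by move=> w /Hd Qw; rewrite divfK.
have [t Ht] := choice X.
have self w : P w = (t w).1 w * Q w by have [d0 [_ E]] := Ht w; apply: E; rewrite subrr nm0.
exists (fun z => (t z).1 z), (fun z => (t z).2.1); split=> //.
move=> z; have [d0 [Hq E]] := Ht z; have [d' d'0 Hd'] := isolated_zero z HQ Qp.
apply: ddv_loc Hq _; exists (Num.min (t z).2.2 d'); first by rewrite lt_min d0.
move=> w; rewrite /= lt_min => /andP[w1 w2].
have [->//|wz] := eqVneq w z.
by apply: (mulIf (Hd' w wz w2)); rewrite -E // self.
Qed.

Lemma quot_simple P P1 Q Q1 p : ent P P1 -> ent Q Q1 -> Q p != 0 ->
  (forall z, Q z = 0 -> P z = 0 /\ Q1 z != 0) ->
  exists f f1, ent f f1 /\ forall z, P z = f z * Q z.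
Proof.
move=> HP HQ Qp H; apply: (quot_glue HP HQ Qp) => z Qz; have [Pz Q1z] := H z Qz.
have [U [U1 [HU EU]]] := ent_div HP Pz; have [V [V1 [HV EV]]] := ent_div HQ Qz.
have Vz : V z != 0.
  have H2 := ddvM (ddvB (cdv_id z) (cdv_cst z z)) (HV z).
  have := cdv_unique (ddv_ext H2 (fun y => esym (EV y))) (HQ z).
  by rewrite subr0 mul1r subrr mul0r addr0 => ->.
have [d d0 Hd] := ent_neq0_near HV Vz.
exists (fun w => U w / V w), (fun w => (U1 w * V w - U w * V1 w) / V w ^+ 2), d; split=> //.
  by move=> w /Hd Vw; apply: ddvf.
by move=> w /Hd Vw; rewrite EU EV mulrCA divfK.
Qed.

(** At a zero of order n >= 2 of g, the square of g' vanishes to order 2 (n - 1), which is at least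
    n. *)
Lemma quot_square g g1 p : ent g g1 -> g p != 0 -> (forall z, g z = 0 -> g1 z = 0) ->
  exists f f1, ent f f1 /\ forall z, g1 z ^+ 2 = f z * g z.
Proof.
move=> Hg gp H; have [g2 Hg2] := ent_deriv Hg.
have HP : ent (fun z => g1 z ^+ 2) (fun z => 2%:R * g1 z ^+ 1 * g2 z) by move=> z; exact: (ddvX 2 (Hg2 z)).
apply: (quot_glue HP Hg gp) => z gz.
have [m [h [h1 [Hh E hz]]]] := zero_order z Hg gp.
have D n w : cdv (fun w => (w - z) ^+ n) w (n%:R * (w - z) ^+ n.-1).
  apply: ddv_eqd (ddvX n (ddvB (cdv_id w) (cdv_cst z w))) _; by rewrite subr0 mulr1.
have E1 w : g1 w = m%:R * (w - z) ^+ m.-1 * h w + (w - z) ^+ m * h1 w.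
  by apply: (cdv_unique (Hg w)); apply: ddv_ext (ddvM (D m w) (Hh w)) _ => y; rewrite E.
case: m E E1 => [|[|m]] E E1.
- by move: hz; have := E z; rewrite expr0 mul1r gz => <-; rewrite eqxx.
- have := E1 z; rewrite (H z gz) /= expr0 expr1 subrr mul0r addr0 mulr1 mul1r => h0.
  by move: hz; rewrite -h0 eqxx.
have [d d0 Hd] := ent_neq0_near Hh hz; have [h2 Hh2] := ent_deriv Hh.
pose k w := m.+2%:R * h w + (w - z) * h1 w.
have Hk w : cdv k w (m.+2%:R * h1 w + (1 * h1 w + (w - z) * h2 w)).
  apply: ddvD (ddvZ _ (Hh w)) (ddvM _ (Hh2 w)).
  by apply: ddv_eqd (ddvB (cdv_id w) (cdv_cst z w)) _; rewrite subr0.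
have X w : exists l, nm (w - z) < d -> cdv (fun w => (w - z) ^+ m * k w ^+ 2 / h w) w l.
  have [wd|wd] := ltP (nm (w - z)) d; last by exists 0.
  eexists => _; apply: (@ddvf R R[i] id (fun w => (w - z) ^+ m * k w ^+ 2) h w _ _ (Hd w wd) _ (Hh w)).
  exact: ddvM (D m w) (ddvX 2 (Hk w)).
have [q1 Hq1] := choice X.
exists (fun w => (w - z) ^+ m * k w ^+ 2 / h w), q1, d; split=> // w /Hd hw.
rewrite E E1 /k /= !exprS; field; exact: hw.
Qed.

Lemma seg_mvt f f1 c (r k : R) z : hol f f1 c r -> (forall w, nm (w - c) < r -> nm (f1 w) <= k) ->
  nm (z - c) < r -> nm (f z - f c) <= k * nm (z - c).
Proof.
move=> H Hk zr; pose u (t : R) : R[i] := c + t%:C * (z - c).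
have cu t : cdr u t (z - c).
  have := ddvD (ddv_cst (real_complex R) c t) (ddvM (ddv_io (real_complex R) t) (ddv_cst _ (z - c) t)).
  by move=> H1; apply: ddv_eqd H1 _; ring.
have uin t : 0 <= t <= 1 -> nm (u t - c) < r.
  move=> /andP[t0 t1]; rewrite /u addrC addKr nmM nmR ger0_norm //; apply: le_lt_trans zr.
  by rewrite ler_piMl ?nm_ge0.
have := @mvt R (fun t => f (u t)) (fun t => f1 (u t) * (z - c)) 0 1 (k * nm (z - c)) ler01.
have -> : u 1 = z by rewrite /u rmorph1 mul1r addrC subrK.
have -> : u 0 = c by rewrite /u rmorph0 mul0r addr0.
rewrite subr0 mulr1; apply => t tt.
  by apply: (@ddv_comp R R (real_complex R) f u) (cu t); apply: H; exact: uin.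
by rewrite nmM ler_wpM2r ?nm_ge0 // Hk // uin.
Qed.

End Quotients.

(** * The quotient phi is a bounded entire function *)

Section Phi.
Variable R : realType.
Variables (g g1 : R[i] -> R[i]) (C : R) (p : R[i]).
Hypotheses (Hg : ent g g1) (C0 : 0 <= C) (HC : forall z, nm (g1 z) <= C * (1 + nm (g z))) (g1p : g1 p != 0).

Lemma unbounded v (K : R) : exists z, K <= nm (g z - v).
Proof.
apply: contrapT => no; move: g1p.
have -> : g1 p = 0; last by rewrite eqxx.
apply: (@liouville R g g1 (K + nm v) Hg) => z.
have h : nm (g z - v) < K by rewrite ltNge; apply/negP => h; apply: no; exists z.
by have := nmD (g z - v) v; rewrite subrK; lra.
Qed.

(** The bound depends on K and rho but not on the centre c: this replaces a normality argument for
    the translates of g. *)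
Lemma local_bound (K rho : R) : 0 <= rho -> exists2 B, 0 <= B &
  forall c z, nm (g c) <= K -> nm (z - c) <= rho -> nm (g z) <= B /\ nm (g1 z) <= B.
Proof.
move=> r0; have C0' := C0; pose G := 1 + (1 + K ^+ 2) * expR (4 * C * rho).
have G0 : 0 <= G by rewrite /G addr_ge0 // mulr_ge0 ?expR_ge0 // addr_ge0 // sqr_ge0.
exists (G + C * (1 + G)); first by rewrite addr_ge0 // mulr_ge0 //; lra.
move=> c z gc zc.
have zr : nm (z - c) < rho + 1 by lra.
have := gronwall (ent_hol c (rho + 1) Hg) C0 (fun w _ => HC w) zr => h.
have nz := nm_ge0 (g z); have nc := nm_ge0 (g c).
have e1 : expR (4 * C * nm (z - c)) <= expR (4 * C * rho).
  by rewrite ler_expR; apply: ler_wpM2l => //; rewrite mulr_ge0.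
have e2 : 1 + nm (g c) ^+ 2 <= 1 + K ^+ 2.
  by rewrite lerD2l lerXn2r // nnegrE //; lra.
have h2 : nm (g z) ^+ 2 <= (1 + K ^+ 2) * expR (4 * C * rho).
  by apply: le_trans h _; apply: ler_pM; [rewrite addr_ge0 // sqr_ge0|exact: expR_ge0|exact: e2|exact: e1].
have gG : nm (g z) <= G.
  have h3 := sqr_ge0 (nm (g z) - 1).
  have h4 : nm (g z) <= 1 + nm (g z) ^+ 2 by move: (nm (g z)) h3 nz => x; nra.
  by apply: le_trans h4 _; rewrite lerD2l.
have h5 : nm (g1 z) <= C * (1 + G) by apply: le_trans (HC z) _; rewrite ler_wpM2l // lerD2l.
split; last by apply: le_trans h5 _; rewrite lerDr.
by apply: le_trans gG _; rewrite lerDl mulr_ge0 // addr_ge0.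
Qed.

Section Near.
Variables (v u : R[i]) (f f1 : R[i] -> R[i]).
Hypotheses (uv : u != v) (v0 : v != 0) (gv : forall z, g z = v -> g1 z = v).
Hypotheses (Hf : ent f f1) (E : forall z, g1 z * (g1 z - g z) = f z * (g z - v) * (g z - u)).

(* Near a v-point zs, g behaves like v + v (z - zs), uniformly in zs. *)
Lemma uniform_simple : exists r B : R, [/\ 0 < r, forall zs z, g zs = v -> nm (z - zs) = r ->
   nm v * r / 2 <= nm (g z - v) & forall zs z, g zs = v -> nm (z - zs) < r -> nm (f z) <= B].
Proof.
have [G G0 HG] := @local_bound (nm v) 2 (ler0n R 2).
have [g2 Hg2] := ent_deriv Hg.
have nv : 0 < nm v by rewrite nm_gt0.
have nuv : 0 < nm (u - v) by rewrite nm_gt0 subr_eq0.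
(* 1/4 keeps the auxiliary discs within the range of [HG], the second bound keeps the quadratic
   error below half the linear term, and the third keeps g away from u on the circle. *)
pose r := Num.min (1 / 4) (Num.min (nm v / (4 * (G + 1))) (nm (u - v) / (4 * nm v))).
have G1 : 0 < 4 * (G + 1) by lra.
have v4 : 0 < 4 * nm v by lra.
have r0 : 0 < r by rewrite !lt_min !divr_gt0.
have r4 : r <= 1 / 4 by rewrite ge_min lexx.
have rG : r * (4 * (G + 1)) <= nm v by rewrite -ler_pdivlMr // !ge_min lexx orbT.
have ruv : r * (4 * nm v) <= nm (u - v) by rewrite -ler_pdivlMr // !ge_min lexx !orbT.
clearbody r.
have lin zs z : g zs = v -> nm (z - zs) = r -> nm (g z - v - v * (z - zs)) <= nm v / 2 * r.
  move=> gz zr.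
  have B2 w : nm (w - zs) < 1 -> nm (g2 w) <= G.
    move=> w1; have := cauchy_est ltr01 (ent_hol w 1 Hg2) (B := G); rewrite divr1; apply => w' ww'.
    have nzs : nm (g zs) <= nm v by rewrite gz.
    have ww2 : nm (w' - zs) <= 2 by have := nm_tri w' w zs; lra.
    by have [] := HG zs w' nzs ww2.
  have L w : nm (w - zs) < 2 * r -> nm (g1 w - v) <= G * (2 * r).
    move=> w1; have w2 : nm (w - zs) < 1 by lra.
    have := seg_mvt (ent_hol zs 1 Hg2) B2 w2; rewrite (gv gz) => /le_trans; apply.
    by rewrite ler_wpM2l // ltW.
  have Hh : hol (fun w => g w - v * w) (fun w => g1 w - v) zs (2 * r).
    move=> w _; apply: ddvB; first exact: Hg.
    by apply: ddv_eqd (ddvZ v (cdv_id w)) _; rewrite mulr1.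
  have zr2 : nm (z - zs) < 2 * r by rewrite zr; lra.
  have := seg_mvt Hh L zr2; rewrite zr gz.
  have -> : g z - v * z - (v - v * zs) = g z - v - v * (z - zs) by ring.
  move=> /le_trans; apply; apply: ler_wpM2r; first exact: ltW.
  by lra.
have low zs z : g zs = v -> nm (z - zs) = r -> nm v * r / 2 <= nm (g z - v).
  move=> gz zr; have := lin zs z gz zr; have := nm_sub (v * (z - zs)) (v * (z - zs) - (g z - v)).
  have -> : v * (z - zs) - (v * (z - zs) - (g z - v)) = g z - v by ring.
  by rewrite -(nmC (g z - v)) nmM zr; lra.
have vr : 0 < nm v * r / 2 by rewrite divr_gt0 // mulr_gt0.
have uv4 : 0 < nm (u - v) / 4 by rewrite divr_gt0.
have D0 : 0 < nm v * r / 2 * (nm (u - v) / 4) by rewrite mulr_gt0.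
exists r, (G * (G + G) / (nm v * r / 2 * (nm (u - v) / 4))); split=> // zs z gz zr.
have r1 : r < 1 by lra.
apply: (max_principle (ent_hol zs 1 Hf) r0 r1) => // w wr.
have nzs : nm (g zs) <= nm v by rewrite gz.
have w2 : nm (w - zs) <= 2 by rewrite wr; lra.
have [b1 b2] := HG zs w nzs w2.
have up : nm (g w - v) <= 3 / 2 * (nm v * r).
  have := lin zs w gz wr; have := nmD (g w - v - v * (w - zs)) (v * (w - zs)).
  by rewrite subrK nmM wr; lra.
have gu : nm (u - v) / 4 <= nm (g w - u).
  have := nm_tri u (g w) v; rewrite (nmC u (g w)); lra.
rewrite ler_pdivlMr //; apply: (@le_trans _ _ (nm (g1 w * (g1 w - g w)))).
  rewrite E !nmM -[leRHS]mulrA; apply: ler_wpM2l; first exact: nm_ge0.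
  by apply: ler_pM; [exact: ltW|exact: ltW|exact: (low zs)|exact: gu].
rewrite nmM; apply: ler_pM; rewrite ?nm_ge0 //.
by apply: le_trans (nmB _ _) _; exact: lerD.
Qed.

(** Within r of a v-point, [uniform_simple] bounds f. Farther away, [log_deriv_inside] gives |g1| <=
    const |g - v|, and this factor of the numerator absorbs the vanishing g - v in the
    denominator. *)
Lemma near_value : exists d B : R, 0 < d /\ forall z, nm (g z - v) < d -> nm (f z) <= B.
Proof.
have [r [B [r0 Hlow HB]]] := uniform_simple.
have nv : 0 < nm v by rewrite nm_gt0.
have nuv : 0 < nm (u - v) by rewrite nm_gt0 subr_eq0.
have C0' := C0.
pose d := Num.min (nm v * r / 2) (nm (u - v) / 2).
have d0 : 0 < d by rewrite lt_min !divr_gt0 // mulr_gt0.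
have d1 : d <= nm v * r / 2 by rewrite ge_min lexx.
have d2 : d <= nm (u - v) / 2 by rewrite ge_min lexx orbT.
clearbody d; pose M := C * (1 + nm v + d).
have M0 : 0 <= M by rewrite mulr_ge0 //; lra.
exists d, (Num.max B (4 * (M / d) * (M + (nm v + d)) / (nm (u - v) / 2))); split=> // z zd.
have [[zs [gzs zzs]]|no] := pselect (exists zs, g zs = v /\ nm (z - zs) < r).
  by rewrite le_max (HB zs z).
have far w : g w = v -> r <= nm (z - w).
  by move=> gw; rewrite leNgt; apply/negP => h; apply: no; exists w.
have gz : g z - v != 0.
  rewrite subr_eq0; apply/eqP => gz; have := far z gz; rewrite subrr nm0; lra.
have MM w : nm (g w - v) <= d -> nm (g1 w) <= M.
  move=> h; apply: le_trans (HC w) _; rewrite ler_wpM2l //.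
  by have := nmD (g w - v) v; rewrite subrK; lra.
have := @log_deriv_inside R g g1 v z d M Hg d0 zd (unbounded v d) => /(_ _ _) h.
have {}h : nm (g1 z) <= 4 * (M / d) * nm (g z - v).
  apply: h; first by move=> w gw; apply: MM; rewrite gw.
  move=> w hw; apply/eqP => gw; have fw := far w gw.
  pose n := nm (z - w); have n0 : 0 < n by apply: lt_le_trans fw.
  (* The point at distance r from w on the way to z: it is no farther from z than w is, yet |g - v|
     >= d there, so w cannot lie in a disc where |g - v| < d. *)
  pose x := w + (r / n)%:C * (z - w).
  have rn : r / n <= 1 by rewrite ler_pdivrMr // mul1r.
  have rn0 : 0 < r / n by rewrite divr_gt0.
  have xw : nm (x - w) = r by rewrite /x (addrC w) addrK nmM nmR gtr0_norm // divfK // gt_eqF.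
  have xz : nm (x - z) <= nm (w - z).
    have -> : x - z = (1 - r / n)%:C * (w - z) by rewrite /x rmorphB rmorph1; ring.
    by rewrite nmM nmR ger0_norm ?subr_ge0 // ler_piMl ?nm_ge0 //; lra.
  by have := Hlow w x gw xw; have := hw x xz; lra.
rewrite le_max; apply/orP; right.
have gu : nm (u - v) / 2 <= nm (g z - u) by have := nm_tri u (g z) v; rewrite (nmC u (g z)); lra.
have nz : 0 < nm (g z - v) by rewrite nm_gt0.
have uv2 : 0 < nm (u - v) / 2 by rewrite divr_gt0.
rewrite ler_pdivlMr // -(ler_pM2l nz).
apply: (@le_trans _ _ (nm (g1 z * (g1 z - g z)))).
  rewrite E !nmM [leRHS]mulrAC [leRHS]mulrC; apply: ler_wpM2l; first exact: nm_ge0.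
  by apply: ler_wpM2l gu; exact: nm_ge0.
rewrite nmM.
have -> : nm (g z - v) * (4 * (M / d) * (M + (nm v + d))) = 4 * (M / d) * nm (g z - v) * (M + (nm v + d)) by ring.
apply: ler_pM; [exact: nm_ge0|exact: nm_ge0|exact: h|].
apply: le_trans (nmB _ _) _; apply: lerD; first by apply: MM; exact: ltW.
by have := nmD (g z - v) v; rewrite subrK; lra.
Qed.

End Near.

(* The identity F^2 = 2 g'' F - F' g' for F = g'^2/g, evaluated where F is almost maximal. *)
Lemma near_zero (F F1 : R[i] -> R[i]) : ent F F1 -> (forall z, g1 z ^+ 2 = F z * g z) ->
  exists B, forall z, nm (g z) <= 1 -> nm (F z) <= B.
Proof.
move=> HF E; have [g2 Hg2] := ent_deriv Hg; have [g3 Hg3] := ent_deriv Hg2.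
have [F2 HF2] := ent_deriv HF.
have Id1 z : 2 * g1 z * g2 z = F1 z * g z + F z * g1 z.
  have := cdv_unique (ddv_ext (ddvX 2 (Hg2 z)) E) (ddvM (HF z) (Hg z)).
  by rewrite expr1.
have Id z : F z ^+ 2 = 2 * g2 z * F z - F1 z * g1 z.
  have HD : ent (fun z => F z ^+ 2 - (2 * g2 z * F z - F1 z * g1 z)) (fun w => 2%:R * F w ^+ 1 * F1 w -
      ((2 * g3 w) * F w + (2 * g2 w) * F1 w - (F2 w * g1 w + F1 w * g2 w))).
    move=> w; apply: ddvB; first exact: (ddvX 2 (HF w)).
    by apply: ddvB; [exact: ddvM (ddvZ 2 (Hg3 w)) (HF w)|exact: ddvM (HF2 w) (Hg2 w)].
  (* Multiplied by g1 the identity follows from [Id1] and [E]; since g1 is not identically 0, the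
     factor can be cancelled. *)
  have [|h|h] := ent_mul0 Hg2 HD.
  - move=> w; have -> : g1 w * (F w ^+ 2 - (2 * g2 w * F w - F1 w * g1 w))
      = F w ^+ 2 * g1 w - F w * (2 * g1 w * g2 w) + F1 w * g1 w ^+ 2 by ring.
    by rewrite Id1 E; ring.
  - by move: g1p; rewrite h eqxx.
  by apply/eqP; rewrite -subr_eq0 h.
have [G G0 HG] := @local_bound 1 2 (ler0n R 2).
have D2 z w : nm (g z) <= 1 -> nm (w - z) <= 1 -> nm (g2 w) <= G.
  move=> gz wz; have := cauchy_est ltr01 (ent_hol w 1 Hg2) (B := G); rewrite divr1; apply => w' ww'.
  have w2 : nm (w' - z) <= 2 by have := nm_tri w' w z; lra.
  by have [] := HG z w' gz w2.
(* 36 = 2 * 18: the supremum below is at most twice its almost maximal value, and [H4] bounds that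
   value by 18 G. *)
exists (36 * G) => z gz.
have r12 : (1 : R) < 2 by rewrite ltr1n.
have [B B0 HB] := hol_bound (hol_shift (ent_hol z 2 HF)) r12.
pose S : set R := fun x => exists w, nm (w - z) <= 1 /\ x = (1 - nm (w - z)) ^+ 2 * nm (F w).
have Sz : S (nm (F z)) by exists z; rewrite subrr nm0 subr0 expr1n mul1r.
have supS : has_sup S.
  split; first by exists (nm (F z)).
  exists B => _ [w [wz ->]]; have := HB (w - z) wz; rewrite addrC subrK => h.
  apply: le_trans h; rewrite ler_piMl ?nm_ge0 // expr_le1 //; have := nm_ge0 (w - z); lra.
pose s := sup S; have Fs : nm (F z) <= s by apply: (ub_le_sup supS.2).
apply: le_trans Fs _; have [s0|s0] := leP s 0; first by apply: le_trans s0 _; rewrite mulr_ge0.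
have s2 : 0 < s / 2 by rewrite divr_gt0.
have [_ [y [yz ->]]] := sup_adherent s2 supS; rewrite -/s => ys.
pose d := 1 - nm (y - z); rewrite -/d in ys.
have d1 : d <= 1 by rewrite /d; have := nm_ge0 (y - z); lra.
have d0 : 0 < d.
  rewrite lt_neqAle subr_ge0 yz andbT eq_sym; apply/eqP => d0.
  by move: ys; rewrite d0 expr0n mul0r; lra.
have A0 : 0 < nm (F y).
  rewrite lt_neqAle nm_ge0 andbT eq_sym; apply/eqP => A0.
  by move: ys; rewrite A0 mulr0; lra.
have d2 : 0 < d ^+ 2 by rewrite exprn_gt0.
have up w : nm (w - y) < d / 2 -> nm (F w) <= 8 * nm (F y).
  move=> wy; have t := nm_tri w y z.
  have dw : d / 2 <= 1 - nm (w - z) by rewrite /d in wy *; lra.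
  have w1 : nm (w - z) <= 1 by lra.
  have h1 : (1 - nm (w - z)) ^+ 2 * nm (F w) <= s by apply: (ub_le_sup supS.2); exists w.
  have h2 : (d / 2) ^+ 2 * nm (F w) <= (1 - nm (w - z)) ^+ 2 * nm (F w).
    by rewrite ler_wpM2r ?nm_ge0 // lerXn2r // nnegrE; lra.
  have h3 : (d / 2) ^+ 2 * nm (F w) < 2 * (d ^+ 2 * nm (F y)) by lra.
  rewrite -(ler_pM2l d2); apply: ltW.
  have -> : d ^+ 2 * nm (F w) = 4 * ((d / 2) ^+ 2 * nm (F w)) by field.
  by lra.
have dd2 : 0 < d / 2 by rewrite divr_gt0.
have H1 := cauchy_est dd2 (ent_hol y (d / 2) HF) up.
have y2 : nm (y - z) <= 2 by lra.
have [_ Gy] := HG z y gz y2; have G2y := D2 z y gz yz.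
have H2 : nm (F y) ^+ 2 <= 2 * G * nm (F y) + 16 * nm (F y) / d * G.
  rewrite -nmX Id; apply: le_trans (nmB _ _) _; apply: lerD.
    by rewrite !nmM nm_n ler_wpM2r ?nm_ge0 // ler_wpM2l.
  rewrite nmM; apply: ler_pM; rewrite ?nm_ge0 //; apply: le_trans H1 _.
  by rewrite le_eqVlt; apply/orP; left; apply/eqP; field; rewrite gt_eqF.
have H3 : nm (F y) <= 2 * G + 16 / d * G.
  rewrite -(ler_pM2r A0) -expr2; apply: le_trans H2 _.
  by rewrite le_eqVlt; apply/orP; left; apply/eqP; ring.
have H4 : d ^+ 2 * nm (F y) <= 18 * G.
  apply: le_trans (ler_wpM2l (ltW d2) H3) _.
  have -> : d ^+ 2 * (2 * G + 16 / d * G) = (2 * d ^+ 2 + 16 * d) * G by field; rewrite gt_eqF.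
  apply: ler_wpM2r => //; have : d ^+ 2 <= d by rewrite expr2 ler_piMl // ltW.
  lra.
lra.
Qed.

End Phi.

(** If a is not 0, the numerator vanishes at the simple zeros of g - a and g - b. If a = 0, g1^2/g
    is entire and equals g1 at the b-points, so the difference is divisible by g - b. Away from both
    values, numerator and denominator compare through the linear growth of g1. *)
Lemma phi_const (R : realType) (g g1 : R[i] -> R[i]) (a b p : R[i]) : b != a -> b != 0 ->
  sharing g g1 a b -> g1 p != 0 ->
  exists c, forall z, g1 z * (g1 z - g z) = c * (g z - a) * (g z - b).
Proof.
move=> ab b0 Hs g1p; have [Hg ga gb gb'] := Hs.
have [C C0 HC] := linear_growth ab Hs; have [g2 Hg2] := ent_deriv Hg.
have Hv v : ent (fun z => g z - v) g1.
  by move=> w; apply: ddv_eqd (ddvB (Hg w) (cdv_cst v w)) _; rewrite subr0.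
have nz v : exists q, g q - v != 0.
  have [q hq] := unbounded Hg g1p v 1; exists q; rewrite -nm_gt0; exact: lt_le_trans hq.
have HP : ent (fun z => g1 z * (g1 z - g z)) (fun z => g2 z * (g1 z - g z) + g1 z * (g2 z - g1 z)).
  by move=> z; apply: ddvM => //; apply: ddvB.
have [qb Qb] := nz b; have [qa Qa] := nz a.
have ba : b - a != 0 by rewrite subr_eq0.
have [f [f1 [Hf E [da [Ba [da0 Hda]]]]]] : exists f f1, [/\ ent f f1,
    forall z, g1 z * (g1 z - g z) = f z * (g z - a) * (g z - b) &
    exists d B : R, 0 < d /\ forall z, nm (g z - a) < d -> nm (f z) <= B].
  have [a0|a0] := eqVneq a 0.
    have ga0 z : g z = 0 -> g1 z = 0 by move=> h; rewrite -a0; apply: ga; rewrite a0.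
    have Qa0 : g qa != 0 by move: Qa; rewrite a0 subr0.
    have [F [F1 [HF EF]]] := quot_square Hg Qa0 ga0.
    have HFg : ent (fun z => F z - g1 z) (fun z => F1 z - g2 z) by move=> z; apply: ddvB.
    have [|f [f1 [Hf Ef]]] := quot_simple HFg (Hv b) Qb.
      move=> z /eqP; rewrite subr_eq0 => /eqP gz; rewrite (gb z gz); split=> //.
      apply/eqP; rewrite subr_eq0; apply/eqP; apply: (mulIf b0).
      by rewrite -{1}gz -EF (gb z gz) expr2.
    exists f, f1; split=> //.
      move=> z; rewrite a0 subr0 mulrAC -Ef mulrBr -expr2 EF; ring.
    have [B HB] := near_zero Hg C0 HC g1p HF EF.
    have nb : 0 < nm b by rewrite nm_gt0.
    exists (Num.min 1 (nm b / 2)), ((B + C * 2) / (nm b / 2)); split; first by rewrite lt_min ltr01 divr_gt0.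
    move=> z; rewrite a0 subr0 lt_min => /andP[z1 z2].
    have nb2 : 0 < nm b / 2 by rewrite divr_gt0.
    have zb : nm b / 2 <= nm (g z - b) by have := nm_sub b (g z); rewrite nmC; lra.
    rewrite ler_pdivlMr //; apply: (@le_trans _ _ (nm (F z - g1 z))).
      by rewrite Ef nmM ler_wpM2l ?nm_ge0.
    apply: le_trans (nmB _ _) _; apply: lerD; first by apply: HB; exact: ltW.
    by apply: le_trans (HC z) _; apply: ler_wpM2l => //; lra.
  have [|h [h1 [Hh Eh]]] := quot_simple HP (Hv a) Qa.
    by move=> z /eqP; rewrite subr_eq0 => /eqP gz; rewrite (ga z gz) gz subrr mulr0.
  have [|f [f1 [Hf Ef]]] := quot_simple Hh (Hv b) Qb.
    move=> z /eqP; rewrite subr_eq0 => /eqP gz; rewrite (gb z gz); split=> //.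
    by have := Eh z; rewrite (gb z gz) gz subrr mulr0 => /esym/eqP; rewrite mulf_eq0 (negbTE ba) orbF => /eqP.
  have E z : g1 z * (g1 z - g z) = f z * (g z - a) * (g z - b) by rewrite Eh Ef mulrAC.
  exists f, f1; split=> //; exact: (near_value Hg C0 HC g1p ab a0 ga Hf E).
have E' z : g1 z * (g1 z - g z) = f z * (g z - b) * (g z - a) by rewrite E mulrAC.
have ab' : a != b by rewrite eq_sym.
have [db [Bb [db0 Hdb]]] := near_value Hg C0 HC g1p ab' b0 gb Hf E'.
(* The constant that turns 1 + |g| into a multiple of |g - v| wherever |g - v| >= d. *)
pose K v (d : R) := 1 + (1 + nm v) / d.
have K0 v d : 0 < d -> 0 <= K v d.
  by move=> d0; rewrite addr_ge0 // divr_ge0 // ?(ltW d0) // addr_ge0 ?nm_ge0.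
have HK v d z : 0 < d -> d <= nm (g z - v) -> 1 + nm (g z) <= K v d * nm (g z - v).
  move=> d0 h; rewrite /K mulrDl mul1r; have nv := nm_ge0 v.
  have h1 : 1 + nm v <= (1 + nm v) / d * nm (g z - v).
    by rewrite mulrAC ler_pdivlMr // ler_wpM2l //; lra.
  by have := nmD (g z - v) v; rewrite subrK; lra.
have bound z : nm (f z) <= Num.max Ba (Num.max Bb (C * (C + 1) * K a da * K b db)).
  rewrite !le_max; have [za|za] := ltP (nm (g z - a)) da; first by rewrite Hda.
  have [zb|zb] := ltP (nm (g z - b)) db; first by rewrite (Hdb z) ?orbT.
  apply/orP; right; apply/orP; right.
  have n1 : 0 < nm (g z - a) by exact: lt_le_trans za.
  have n2 : 0 < nm (g z - b) by exact: lt_le_trans zb.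
  rewrite -(ler_pM2r n1) -(ler_pM2r n2) -!nmM -E nmM.
  have ng := nm_ge0 (g z).
  have t1 : nm (g1 z - g z) <= (C + 1) * (1 + nm (g z)).
    by apply: le_trans (nmB _ _) _; have := HC z; lra.
  apply: le_trans (ler_pM (nm_ge0 _) (nm_ge0 _) (HC z) t1) _.
  have -> : C * (1 + nm (g z)) * ((C + 1) * (1 + nm (g z))) = C * (C + 1) * ((1 + nm (g z)) * (1 + nm (g z))) by ring.
  have -> : C * (C + 1) * K a da * K b db * nm (g z - a) * nm (g z - b) =
     C * (C + 1) * ((K a da * nm (g z - a)) * (K b db * nm (g z - b))) by ring.
  apply: ler_wpM2l; first by rewrite mulr_ge0 // addr_ge0.
  by apply: ler_pM; rewrite ?addr_ge0 //; apply: HK.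
have fc := ent_const (fun z => ddv_eqd (Hf z) (liouville Hf bound z)).
by exists (f 0) => z; rewrite -(fc z).
Qed.

(** * Solving the quadratic differential equation *)

Section Classification.
Variable R : realType.
Variables (g g1 : R[i] -> R[i]) (a b p : R[i]).
Hypotheses (ab : b != a) (b0 : b != 0) (Hs : sharing g g1 a b) (g1p : g1 p != 0).

Definition first_order_ode := (forall z, g1 z = g z) \/ (forall z, g1 z = b / (b - a) * (g z - a)).

(** Here g1 = al (g - r), and g takes every other value. r = b is impossible: at g = b + b/al one
    has g1 = b. So b = al (b - r). If r = a this is the second equation; otherwise a = al (a - r)
    too, and subtracting gives al = 1, r = 0. *)
Lemma omitted_value r : (forall z, g z != r) -> first_order_ode.
Proof.
move=> gr; have [Hg ga gb gb'] := Hs; have [C _ HC] := linear_growth ab Hs.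
have [al Hal] := omit_ode Hg HC gr.
have al0 : al != 0 by apply: contraNneq g1p => h; rewrite Hal h mul0r.
have takes u : u != r -> exists z, g z = u by exact: ode_takes Hg Hal al0 (gr 0).
have ba : b - a != 0 by rewrite subr_eq0.
have [rb|rb] := eqVneq b r.
  have [|z gz] := takes (b + b / al).
    by rewrite -rb -subr_eq0 addrC addKr mulf_neq0 // invr_eq0.
  have : g1 z = b by rewrite Hal gz -rb addrC addKr mulrC divfK.
  by move/gb' => gzb; have := gr z; rewrite gzb rb eqxx.
have [z gz] := takes b rb.
have Eb : b = al * (b - r) by rewrite -{2}gz -Hal; rewrite (gb z gz).
have [ra|ra] := eqVneq a r.
  right=> w; rewrite Hal -ra; congr (_ * _); rewrite {1}Eb -ra mulfK //.
have [y gy] := takes a ra.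
have Ea : a = al * (a - r) by rewrite -{2}gy -Hal (ga y gy).
have al1 : al = 1.
  apply: (mulIf ba); rewrite mul1r.
  have -> : al * (b - a) = al * (b - r) - al * (a - r) by ring.
  by rewrite -Eb -Ea.
have r0 : r = 0 by move: Eb; rewrite al1 mul1r => /eqP; rewrite -subr_eq0 opprB addrC subrK => /eqP.
by left=> w; rewrite Hal al1 r0 mul1r subr0.
Qed.

(** For al = 0, g is affine and takes the value b, so g1 is the constant b, which forces g = b
    everywhere. Otherwise g omits -be/al. *)
Lemma linear_case al be : (forall z, g1 z = al * g z + be) -> first_order_ode.
Proof.
move=> E; have [Hg ga gb gb'] := Hs.
have [al0|al0] := eqVneq al 0.
  have E' z : g1 z = be by rewrite E al0 mul0r add0r.
  have be0 : be != 0 by rewrite -(E' p).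
  have D w : cdv (fun w => g w - be * w) w 0.
    by apply: ddv_eqd (ddvB (Hg w) (ddvZ be (cdv_id w))) _; rewrite E' mulr1 subrr.
  have aff z : g z = g 0 + be * z.
    by have := ent_const D z; rewrite mulr0 subr0 => <-; rewrite subrK.
  have gz : g ((b - g 0) / be) = b by rewrite aff mulrC divfK // addrC subrK.
  have beb : be = b by rewrite -(E' ((b - g 0) / be)); exact: gb.
  have gz1 z : g z = b by apply: gb'; rewrite E' beb.
  have : g1 p = 0 by apply: (cdv_unique (Hg p)); apply: ddv_ext (cdv_cst b p) _ => y; rewrite gz1.
  by move/eqP; rewrite (negbTE g1p).
pose r := - be / al.
have E' z : g1 z = al * (g z - r) by rewrite E /r; field.
apply: (@omitted_value r) => z; have S := ode_sol Hg E'.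
have g0r : g 0 - r != 0.
  by apply: contraNneq g1p => h; rewrite E' S h mul0r addr0 subrr mulr0.
by rewrite S -subr_eq0 addrC addKr mulf_neq0 ?expC_neq0.
Qed.

(** The cases follow the roots of the polynomial k X^2 + B X + D: two roots, a double root, degree
    one with nonzero or zero root, and degree zero. *)
Lemma classification : first_order_ode.
Proof.
have [Hg ga gb gb'] := Hs.
have [c Hc] := phi_const ab b0 Hs g1p; have [g2 Hg2] := ent_deriv Hg.
pose s z := 2 * g1 z - g z; pose s1 z := 2 * g2 z - g1 z.
have Hsd : ent s s1 by move=> z; apply: ddvB => //; exact: ddvZ.
pose k := 1 + 4 * c; pose B := - (4 * c * (a + b)); pose D := 4 * c * a * b.
have Q z : s z ^+ 2 = k * g z ^+ 2 + B * g z + D.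
  have -> : s z ^+ 2 = 4 * (g1 z * (g1 z - g z)) + g z ^+ 2 by rewrite /s; ring.
  by rewrite Hc /k /B /D; ring.
have Q1 z : 2 * s z * s1 z = (2 * k * g z + B) * g1 z.
  have H1 := ddvX 2 (Hsd z).
  have H2 := ddvD (ddvD (ddvZ k (ddvX 2 (Hg z))) (ddvZ B (Hg z))) (cdv_cst D z).
  have := cdv_unique (ddv_ext H1 Q) H2; rewrite /= expr1 => ->; rewrite expr1; ring.
have g1s z : g1 z = (s z + g z) / 2 by rewrite /s; field.
(* At g = r both s and, by the derived identity [Q1], g1 would vanish, whereas s = 2 g1 - g is then
   -r. *)
have simple r : r != 0 -> k * r ^+ 2 + B * r + D = 0 -> 2 * k * r + B != 0 -> first_order_ode.
  move=> r0 rt dr; apply: (@omitted_value r) => z; apply/eqP => gz.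
  have sz : s z = 0 by apply/eqP; have /eqP := Q z; rewrite gz rt sqrf_eq0.
  have /esym/eqP := Q1 z; rewrite sz mulr0 mul0r gz mulf_eq0 (negbTE dr) /= => /eqP g1z.
  by move: r0; rewrite -gz; have := sz; rewrite /s g1z mulr0 sub0r => /eqP; rewrite oppr_eq0 => ->.
have two : (2 : R[i]) != 0 by rewrite pnatr_eq0.
have four : (4 : R[i]) != 0 by rewrite pnatr_eq0.
have [k0|k0] := eqVneq k 0; last first.
  pose w := sqrtc (B ^+ 2 - 4 * k * D); have Ew : w ^+ 2 = B ^+ 2 - 4 * k * D by exact: sqr_sqrtc.
  (* A vanishing discriminant gives s^2 = k (g - r)^2, which factors into two linear equations; the
     identity theorem selects one of them. *)
  have [w0|w0] := eqVneq w 0.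
    pose r := - B / (2 * k); pose q := sqrtc k; have Eq : q ^+ 2 = k by exact: sqr_sqrtc.
    have Hr v : ent (fun z => s z - v * (g z - r)) (fun z => s1 z - v * g1 z).
      move=> z; apply: ddvB => //; apply: ddvZ.
      by apply: ddv_eqd (ddvB (Hg z) (cdv_cst r z)) _; rewrite subr0.
    have D4 : D = B ^+ 2 / (4 * k).
      move: Ew; rewrite w0 expr0n /= => /eqP; rewrite eq_sym subr_eq0 => /eqP ->.
      by rewrite mulrAC divff ?mul1r // mulf_neq0.
    have Z z : (s z - q * (g z - r)) * (s z - - q * (g z - r)) = 0.
      have -> : (s z - q * (g z - r)) * (s z - - q * (g z - r)) = s z ^+ 2 - q ^+ 2 * (g z - r) ^+ 2 by ring.
      by rewrite Q Eq D4 /r; field.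
    have lin v : (forall z, s z - v * (g z - r) = 0) -> first_order_ode.
      move=> h; apply: (@linear_case ((v + 1) / 2) (- v * r / 2)) => z.
      have /eqP := h z; rewrite subr_eq0 => /eqP sz; rewrite g1s sz; ring.
    by have [h|h] := ent_mul0 (Hr q) (Hr (- q)) Z; exact: lin h.
  have root e : e ^+ 2 = w ^+ 2 -> e != 0 -> (- B + e) / (2 * k) != 0 -> first_order_ode.
    move=> Ee e0 r0; apply: (simple _ r0).
      have -> : k * ((- B + e) / (2 * k)) ^+ 2 + B * ((- B + e) / (2 * k)) + D = (e ^+ 2 - (B ^+ 2 - 4 * k * D)) / (4 * k).
        by field.
      by rewrite Ee Ew subrr mul0r.
    by have -> : 2 * k * ((- B + e) / (2 * k)) + B = e by field.
  (* The two roots differ by w/k, so at least one of them is not 0. *)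
  have [r0|r0] := eqVneq ((- B + w) / (2 * k)) 0; last exact: root r0.
  apply: (root (- w)); rewrite ?sqrrN ?oppr_eq0 //.
  have -> : (- B - w) / (2 * k) = (- B + w) / (2 * k) - w / k by field.
  by rewrite r0 sub0r oppr_eq0 mulf_neq0 // invr_eq0.
have c4 : 4 * c = -1 by apply/eqP; rewrite -addr_eq0 addrC -/k k0.
have EB : B = a + b by rewrite /B c4; ring.
have ED : D = - (a * b) by rewrite /D c4; ring.
have [B0|B0] := eqVneq B 0.
  have Z z : s z * s1 z = 0.
    by apply: (mulfI two); rewrite mulrA Q1 k0 B0; ring.
  have [g3 Hg3] := ent_deriv Hg2.
  have Hs1d : ent s1 (fun z => 2 * g3 z - g2 z) by move=> z; apply: ddvB => //; exact: ddvZ.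
  have sc z : s z = s 0.
    have [h|h] := ent_mul0 Hsd Hs1d Z; first by rewrite !h.
    exact: (ent_const (fun z => ddv_eqd (Hsd z) (h z))).
  by apply: (@linear_case (1 / 2) (s 0 / 2)) => z; rewrite g1s sc; ring.
have [D0|D0] := eqVneq D 0; last first.
  apply: (simple (- D / B)); rewrite ?k0.
  - by rewrite mulf_neq0 ?oppr_eq0 ?invr_eq0.
  - by rewrite mul0r add0r mulrC divfK // addNr.
  - by rewrite mulr0 mul0r add0r.
have a0 : a = 0.
  by apply/eqP; move: D0; rewrite ED => /eqP; rewrite oppr_eq0 mulf_eq0 (negbTE b0) orbF.
have Bb : B = b by rewrite EB a0 add0r.
have Q' z : s z ^+ 2 = b * g z by rewrite Q k0 D0 Bb mul0r add0r addr0.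
have Q1' z : 2 * s z * s1 z = b * g1 z by rewrite Q1 k0 Bb; ring.
have [g3 Hg3] := ent_deriv Hg2.
have H4 : ent (fun z => 4 * s1 z - s z - b) (fun z => 4 * (2 * g3 z - g2 z) - s1 z).
  move=> z; apply: ddv_eqd (ddvB (ddvB (ddvZ 4 (ddvB (ddvZ 2 (Hg3 z)) (Hg2 z))) (Hsd z)) (cdv_cst b z)) _.
  by rewrite subr0.
have gconst v : ~ (forall z, s z = v).
  move=> h; have : b * g1 p = 0.
    rewrite -Q1'; have -> : s1 p = 0; last by rewrite mulr0.
    by apply: (cdv_unique (Hsd p)); apply: ddv_ext (cdv_cst v p) _ => y; rewrite h.
  by move/eqP; rewrite mulf_eq0 (negbTE b0) (negbTE g1p).
have Z z : s z * (4 * s1 z - s z - b) = 0.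
  have -> : s z * (4 * s1 z - s z - b) = 2 * (2 * s z * s1 z) - s z ^+ 2 - b * s z by ring.
  by rewrite Q1' Q' /s; ring.
have [h|h] := ent_mul0 Hsd H4 Z; first by case: (@gconst 0).
have E4 z : s1 z = 4^-1 * (s z - - b).
  by rewrite opprK; apply: (mulfI four); rewrite mulrA divff // mul1r; apply/eqP; rewrite -subr_eq0 opprD addrA h.
have s0b : s 0 != - b.
  apply/eqP => sb; apply: (@gconst (- b)) => z; rewrite (ode_sol Hsd E4) sb.
  by rewrite subrr mul0r addr0.
have i4 : (4 : R[i])^-1 != 0 by rewrite invr_eq0.
(* At s = -2b the equation b g = s^2 gives g = 4b, and b g1 = 2 s s' with s' = -b/4 gives g1 = b,
   against g1 = b => g = b. *)
have [|z sz] := @ode_takes R s s1 4^-1 (- b) (- (2 * b)) Hsd E4 i4 s0b.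
  by rewrite -subr_eq0 (_ : - (2 * b) - - b = - b) ?oppr_eq0 //; ring.
have gz : g z = 4 * b.
  by apply: (mulfI b0); rewrite -Q' sz; ring.
have g1z : g1 z = b.
  by apply: (mulfI b0); rewrite -Q1' E4 sz; field.
have := gb' z g1z; rewrite gz => /eqP; rewrite -subr_eq0 (_ : 4 * b - b = 3 * b); last by ring.
by rewrite mulf_eq0 (negbTE b0) pnatr_eq0.
Qed.

End Classification.

Lemma one_variable (R : realType) (g g1 : R[i] -> R[i]) (a b : R[i]) : b != a -> b != 0 ->
  sharing g g1 a b ->
  [\/ forall z, g z = g 0, forall z, g z = g 0 * expC z |
      forall z, g z = a + (g 0 - a) * expC (b / (b - a) * z)].
Proof.
move=> ab b0 Hs; have [Hg _ _ _] := Hs.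
have [[p g1p]|no] := pselect (exists p, g1 p != 0); last first.
  have g10 z : g1 z = 0 by apply/eqP; apply: contrapT => /negP h; apply: no; exists z.
  by constructor 1; exact: (ent_const (fun z => ddv_eqd (Hg z) (g10 z))).
have [h|h] := classification ab b0 Hs g1p; last by constructor 3; exact: ode_sol.
constructor 2 => z; have E w : g1 w = 1 * (g w - 0) by rewrite mul1r subr0 h.
by rewrite (ode_sol Hg E) mul1r subr0 add0r.
Qed.

(** * Several variables *)

Section Lines.
Variables (R : realType) (n : nat).
Implicit Types (f g : 'rV[R[i]]_n -> R[i]) (z v : 'rV[R[i]]_n).

Lemma normr_nm (x : R[i]) : `|x| = (nm x)%:C.
Proof. by rewrite normc_def; case: x. Qed.

Lemma line_cdv f z v : entire f -> ent (fun t : R[i] => f (z + t *: v)) (fun t => 'D_v f (z + t *: v)).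
Proof.
move=> Hf t e e0; set w := z + t *: v.
have dv : derivable f w v by apply: diff_derivable; exact: Hf.
have : (h^-1 *: (f (h *: v + w) - f w) @[h --> (0 : R[i])^'] --> 'D_v f w)%classic by exact: dv.
have eC : 0 < e%:C :> R[i] by rewrite ltcR.
move=> /cvgrPdist_le /(_ _ eC) /nbhs_ballP [d /= d0 Hd].
(* The radius supplied by the filter is an element of [R[i]]; being positive, it is real. *)
have dR : d = (complex.Re d)%:C by case: d d0 {Hd} => x y; rewrite ltcE /= => /andP[/eqP -> _].
have d0' : 0 < complex.Re d by rewrite dR ltcR in d0.
exists (complex.Re d) => // y /= yt.
have [->|yt0] := eqVneq y t; first by rewrite !subrr mulr0 subr0 nm0 mulr0.
have h0 : y - t != 0 by rewrite subr_eq0.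
have := Hd (y - t); rewrite /ball /= sub0r normrN normr_nm dR ltcR => /(_ yt h0).
have -> : (y - t) *: v + w = z + y *: v by rewrite /w scalerBl addrCA subrK.
rewrite /w normr_nm lecR => H.
have -> : f (z + y *: v) - f (z + t *: v) - 'D_v f (z + t *: v) * (y - t) =
   - (('D_v f (z + t *: v) - (y - t)^-1 * (f (z + y *: v) - f (z + t *: v))) * (y - t)) by field.
by rewrite nmN nmM ler_wpM2r ?nm_ge0.
Qed.

(** Holomorphy along complex lines suffices for the identity theorem in several variables, because
    any two points lie on such a line. *)
Definition line_entire f := forall z v, exists h : R[i] -> R[i], ent (fun t => f (z + t *: v)) h.

Lemma line_entire_mul0 f g : line_entire f -> line_entire g -> (forall z, f z * g z = 0) ->
  (forall z, f z = 0) \/ (forall z, g z = 0).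
Proof.
move=> Hf Hg H; have [|no] := pselect (exists p, f p != 0); last first.
  by left=> z; apply/eqP; apply: contrapT => /negP fz; apply: no; exists z.
move=> [p fp]; right=> z; have [f1 Hf1] := Hf p (z - p); have [g1 Hg1] := Hg p (z - p).
have [h|h] := ent_mul0 Hf1 Hg1 (fun t => H _).
  by have := h 0; rewrite scale0r addr0 => /eqP; rewrite (negbTE fp).
by have := h 1; rewrite scale1r addrC subrK.
Qed.

(** A is an action of the additive group on values; going from 0 to z one coordinate at a time adds
    up the parameters. *)
Lemma coordinates f (A : R[i] -> R[i] -> R[i]) :
  (forall x, A 0 x = x) -> (forall s t x, A s (A t x) = A (s + t) x) ->
  (forall i z t, f (z + t *: 'e_i) = A t (f z)) ->
  forall z, f z = A (\sum_(i < n) z 0 i) (f 0).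
Proof.
move=> A0 AD H z; rewrite {1}(row_sum_delta z) -[in LHS](add0r (\sum_(j < n) _)).
have X (s : seq 'I_n) : f (0 + \sum_(j <- s) z 0 j *: 'e_j) = A (\sum_(j <- s) z 0 j) (f 0).
  elim: s => [|j s IH]; first by rewrite !big_nil addr0 A0.
  by rewrite !big_cons addrCA addrC H IH AD.
exact: X.
Qed.

End Lines.

Section Directions.
Variables (R : realType) (n : nat) (f : 'rV[R[i]]_n -> R[i]) (a b : R[i]).
Hypotheses (Hf : entire f) (ab : b != a) (b0 : b != 0).
Hypothesis (h1 : forall i z, f z = a -> partial i f z = a).
Hypothesis (h2 : forall i z, f z = b <-> partial i f z = b).

Lemma line_sharing i z : sharing (fun t : R[i] => f (z + t *: 'e_i)) (fun t => 'D_('e_i) f (z + t *: 'e_i)) a b.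
Proof.
split=> [|t|t|t]; [exact: line_cdv|exact: h1|by move/(h2 i)|by move/(h2 i)].
Qed.

Lemma line_entire_shift i (t k m : R[i]) : line_entire (fun z => f (z + t *: 'e_i) - k * f z - m).
Proof.
move=> z v; eexists => s; apply: ddvB; last exact: cdv_cst.
apply: ddvB; last exact: (ddvZ k (line_cdv z v Hf s)).
have -> : (fun s : R[i] => f (z + s *: v + t *: 'e_i)) = (fun s => f (z + t *: 'e_i + s *: v)).
  by apply/funext => s'; rewrite addrAC.
exact: line_cdv.
Qed.

(* On each line parallel to a coordinate axis one of the three types occurs; by the
   identity theorem the type depends only on the axis. *)
Lemma direction_type i : [\/ forall z t, f (z + t *: 'e_i) = f z,
  forall z t, f (z + t *: 'e_i) = f z * expC t |
  forall z t, f (z + t *: 'e_i) = a + (f z - a) * expC (b / (b - a) * t)].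
Proof.
(* All three types say that f (z + t e_i) = k f z + m: with k = 1, m = 0; with k = e^t, m = 0; with
   k = [e t], m = a - a k. *)
pose F (t k m : R[i]) z := f (z + t *: 'e_i) - k * f z - m.
pose e t := expC (b / (b - a) * t).
have tri z : [\/ forall t, F t 1 0 z = 0, forall t, F t (expC t) 0 z = 0 | forall t, F t (e t) (a - a * e t) z = 0].
  have := one_variable ab b0 (line_sharing i z); rewrite scale0r addr0 => -[H|H|H].
  - by constructor 1 => t; rewrite /F H mul1r subrr subr0.
  - by constructor 2 => t; rewrite /F H subr0 mulrC subrr.
  - by constructor 3 => t; rewrite /F H -/(e t); ring.
have [H|/existsNP[t /existsNP[p Hp]]] := pselect (forall t z, F t 1 0 z = 0).
  by constructor 1 => z t; have := H t z; rewrite /F mul1r subr0 => /eqP; rewrite subr_eq0 => /eqP.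
have [H|/existsNP[s /existsNP[q Hq]]] := pselect (forall t z, F t (expC t) 0 z = 0).
  by constructor 2 => z s; have := H s z; rewrite /F subr0 mulrC => /eqP; rewrite subr_eq0 => /eqP.
constructor 3 => z u.
(* Every point has one type for all shifts at once, so one factor vanishes although t, s and u
   differ. The shifts t and s were chosen so that the first two factors are not identically 0. *)
have Z1 w : F t 1 0 w * (F s (expC s) 0 w * F u (e u) (a - a * e u) w) = 0.
  by case: (tri w) => H; rewrite H ?mul0r ?mulr0.
have L k1 k2 k3 : line_entire (F k1 k2 k3) by exact: line_entire_shift.
have LM : line_entire (fun w => F s (expC s) 0 w * F u (e u) (a - a * e u) w).
  move=> w v; have [x Hx] := L s (expC s) 0 w v; have [y Hy] := L u (e u) (a - a * e u) w v.
  by eexists => r; exact: ddvM (Hx r) (Hy r).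
have [H|H] := line_entire_mul0 (L t 1 0) LM Z1; first by case: Hp.
have [H'|H'] := line_entire_mul0 (L s (expC s) 0) (L u (e u) (a - a * e u)) H; first by case: Hq.
by have /eqP := H' z; rewrite /F subr_eq0 subr_eq => /eqP ->; rewrite -/(e u); ring.
Qed.

End Directions.

Theorem theorem1p1 (R : realType) (n : nat) (hn : (1 <= n)%N)
    (f : 'rV[R[i]]_n -> R[i]) (hf : transcendental_entire f)
    (a b : R[i]) (hba : b <> a) (hb0 : b <> 0)
    (h1 : forall (i : 'I_n) (z : 'rV[R[i]]_n), f z = a -> partial i f z = a)
    (h2 : forall (i : 'I_n) (z : 'rV[R[i]]_n), f z = b <-> partial i f z = b) :
  (exists c : R[i], c <> 0 /\
     forall z : 'rV[R[i]]_n, f z = c * expC (\sum_(i < n) z 0 i))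
  \/
  (exists c : R[i], c <> 0 /\
     forall z : 'rV[R[i]]_n,
       f z = a + c * expC (b / (b - a) * \sum_(i < n) z 0 i))
  \/
  (a <> 0 /\ exists c : R[i], c <> 0 /\
     forall z : 'rV[R[i]]_n,
       f z = b + c * expC (a / (a - b) * \sum_(i < n) z 0 i)).
Proof.
have [Hf npoly] := hf.
have ab : b != a by apply/eqP. have b0 : b != 0 by apply/eqP.
have ba0 : b - a != 0 by rewrite subr_eq0.
have nconst (c : R[i]) : ~ (forall z, f z = c).
  by move=> H; apply: npoly; exists (mpoly.mpolyC n c) => z; rewrite mpoly.mevalC.
pose la := b / (b - a).
have la0 : la != 0 by rewrite mulf_neq0 // invr_eq0.
have solve (k x y : R[i]) : k != 0 -> x != 0 -> y != 0 -> exists t, x * expC (k * t) = y.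
  move=> k0 x0 y0; have [|w Hw] := @expC_surj R (y / x); first by rewrite mulf_neq0 // invr_eq0.
  by exists (w / k); rewrite (mulrC k) divfK // Hw mulrC divfK.
have D0 i z : (forall t, f (z + t *: 'e_i) = f z) -> partial i f z = 0.
  move=> H; have := line_cdv z 'e_i Hf 0; rewrite scale0r addr0 => Hd.
  by apply: (cdv_unique Hd); apply: ddv_ext (cdv_cst (f z) 0) _ => t; rewrite H.
have tp := direction_type Hf ab b0 h1 h2.
(* If b were omitted, no non-constant behaviour would be possible along any axis, since both
   exponential types reach b; f would be constant, hence polynomial. *)
have [bz fb] : exists z, f z = b.
  apply: contrapT => nb; apply: (nconst (f 0)) => z.
  have fb z' : f z' != b by apply/eqP => h; apply: nb; exists z'.
  apply: (@coordinates _ _ f (fun _ x => x)) => // i w t; case: (tp i) => H //.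
  - have [fw|fw] := eqVneq (f w) 0; first by rewrite H fw mul0r.
    have [s Hs] := solve 1 (f w) b (oner_neq0 _) fw b0.
    by have := fb (w + s *: 'e_i); rewrite H -[s in expC s]mul1r Hs eqxx.
  - have [fw|fw] := eqVneq (f w - a) 0.
      by rewrite H fw mul0r addr0; apply/esym/eqP; rewrite -subr_eq0 fw.
    have [s Hs] := solve la (f w - a) (b - a) la0 fw ba0.
    by have := fb (w + s *: 'e_i); rewrite H Hs addrC subrK eqxx.
have not0 i : ~ (forall z t, f (z + t *: 'e_i) = f z).
  move=> H; have := D0 i bz (H bz); have /(h2 i) -> := fb.
  by move/eqP; rewrite (negbTE b0).
have all1 : (forall i z t, f (z + t *: 'e_i) = f z * expC t) ->
    exists c : R[i], c <> 0 /\ forall z, f z = c * expC (\sum_(i < n) z 0 i).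
  move=> H.
  have S z : f z = f 0 * expC (\sum_(i < n) z 0 i).
    apply: (@coordinates _ _ f (fun t x => x * expC t)) => // [x|s t x].
      by rewrite expC0 mulr1.
    by rewrite -mulrA -expCD (addrC t).
  by exists (f 0); split=> // h; apply: (nconst 0) => z; rewrite S h mul0r.
have all2 : (forall i z t, f (z + t *: 'e_i) = a + (f z - a) * expC (la * t)) ->
    exists c : R[i], c <> 0 /\ forall z, f z = a + c * expC (la * \sum_(i < n) z 0 i).
  move=> H.
  have S z : f z = a + (f 0 - a) * expC (la * \sum_(i < n) z 0 i).
    apply: (@coordinates _ _ f (fun t x => a + (x - a) * expC (la * t))) => // [x|s t x].
      by rewrite mulr0 expC0 mulr1 addrC subrK.
    by rewrite (addrC a ((x - a) * _)) addrK -mulrA -expCD -mulrDr (addrC t).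
  by exists (f 0 - a); split=> // h; apply: (nconst a) => z; rewrite S h mul0r addr0.
(* For a = 0 the rate b/(b - a) is 1 and the two exponential types coincide. *)
have [a0|a0] := eqVneq a 0.
  left; apply: all1 => i z t; case: (tp i) => H //; first by case: (not0 i).
  by rewrite H a0 subr0 add0r subr0 divff // mul1r.
have [[i Hi]|no1] := pselect (exists i, forall z t, f (z + t *: 'e_i) = f z * expC t); last first.
  right; left; apply: all2 => j; case: (tp j) => H //; first by case: (not0 j).
  by case: no1; exists j.
left; apply: all1 => j; case: (tp j) => H //; first by case: (not0 j).
(* Two different types meet: moving along axis i from a b-point reaches the nonzero value a, where
   the formula for axis j is stationary, so the j-th partial derivative is 0 instead of a. *)
exfalso; have fb0 : f bz != 0 by rewrite fb.
have [s Hs] := solve 1 (f bz) a (oner_neq0 _) fb0 a0.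
have fa : f (bz + s *: 'e_i) = a by rewrite Hi -[s in expC s]mul1r Hs.
have pj : partial j f (bz + s *: 'e_i) = 0 by apply: D0 => t; rewrite H fa subrr mul0r addr0.
by move: a0; rewrite -(h1 j _ fa) pj eqxx.
Qed.
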